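(* Let $R=\mathbb{k}[x_1,\dots,x_d]$ be a polynomial ring over a field $\mathbb{k}$ of characteristic zero and $\mathfrak m=(x_1,\dots,x_d)$ the maximal homogeneous ideal of $R$. Let $g$ and $\delta$ be integers such that $2\leqslant g\leqslant d$ and $\delta\geqslant2$. Let $L$ be one of the following (lex-segment) ideals: (1) $(x_1,\dots,x_{g-1})\mathfrak m^{\delta-1}+(x_g^\delta)$, or (2) $(x_1,\dots,x_g)\mathfrak m^{\delta-1}$. Then $\operatorname{core}(L)=L\,\mathfrak m^{d(\delta-2)+g-\delta+1}$.
   Context: A subideal $J\subseteq L$ is a reduction of $L$ if $L^{m+1}=JL^m$ for $m\gg0$; $\operatorname{core}(L)$ is the intersection of all reductions of $L$. A lex-segment ideal is a monomial ideal $L=\bigoplus_{i\geqslant 0}L_i$ such that each $L_i$ is spanned by the $\dim_{\mathbb{k}}L_i$ largest monomials of degree $i$ in the lexicographic order with $x_1>\cdots>x_d$. *)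

(* Defs.v *)
From mathcomp Require Export all_boot all_algebra.
From mathcomp Require Export mpoly.

Set Implicit Arguments.
Unset Strict Implicit.
Unset Printing Implicit Defensive.

Import GRing.Theory.
Local Open Scope ring_scope.

(* Ideals are Prop-valued subsets: MathComp's [idealr_closed] concerns boolean,
   proper ideals, whereas membership in an intersection over all reductions is
   not given by a boolean. *)
Section Ideals.

Variable A : comNzRingType.
Implicit Types S I J L : A -> Prop.

Definition is_ideal I : Prop :=
  [/\ I 0, (forall a b, I a -> I b -> I (a + b))
    & (forall r a, I a -> I (r * a))].

Definition ideal_le I J : Prop := forall f, I f -> J f.

Definition ideal_eq I J : Prop := forall f, I f <-> J f.

Definition ideal_span S : A -> Prop := fun f =>
  exists (n : nat) (r s : 'I_n -> A),
    (forall i, S (s i)) /\ f = \sum_(i < n) r i * s i.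

Definition ideal_add I J : A -> Prop := fun f =>
  exists a b, [/\ I a, J b & f = a + b].

Definition ideal_mul I J : A -> Prop :=
  ideal_span (fun f => exists a b, [/\ I a, J b & f = a * b]).

Fixpoint ideal_exp I (n : nat) : A -> Prop :=
  if n is n'.+1 then ideal_mul I (ideal_exp I n') else fun=> True.

Definition is_reduction J L : Prop :=
  [/\ is_ideal J, ideal_le J L
    & exists m0 : nat, forall m : nat, (m0 <= m)%N ->
        ideal_eq (ideal_exp L m.+1) (ideal_mul J (ideal_exp L m))].

Definition core L : A -> Prop := fun f => forall J, is_reduction J L -> J f.

End Ideals.

(* The variables are indexed from 0: x_j is ['X_i] with [i.+1 = j]. *)
Section LexIdeals.

Variables (k : fieldType) (d : nat).

(* (x_1, ..., x_r) *)
Definition var_ideal (r : nat) : {mpoly k[d]} -> Prop :=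
  ideal_span (fun f => exists2 i : 'I_d, (i.+1 <= r)%N & f = 'X_i).

Definition max_ideal : {mpoly k[d]} -> Prop := var_ideal d.

(* (x_j ^ n), for 1 <= j <= d *)
Definition var_pow_ideal (j n : nat) : {mpoly k[d]} -> Prop :=
  ideal_span (fun f => exists2 i : 'I_d, i.+1 = j & f = 'X_i ^+ n).

Definition lex_ideal1 (g delta : nat) : {mpoly k[d]} -> Prop :=
  ideal_add (ideal_mul (var_ideal (g - 1)) (ideal_exp max_ideal (delta - 1)))
            (var_pow_ideal g delta).

Definition lex_ideal2 (g delta : nat) : {mpoly k[d]} -> Prop :=
  ideal_mul (var_ideal g) (ideal_exp max_ideal (delta - 1)).

End LexIdeals.

Arguments var_ideal k d r _ : clear implicits.
Arguments max_ideal k d _ : clear implicits.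
Arguments var_pow_ideal k d j n _ : clear implicits.
Arguments lex_ideal1 k d g delta _ : clear implicits.
Arguments lex_ideal2 k d g delta _ : clear implicits.

(* Main.v *)
(** Put om = delta in case (1) and om = 1 in case (2), and give x_1, ..., x_(g-1)
    weight om, x_g weight 1 and x_(g+1), ..., x_d weight 0.  Then L^p is spanned by
    the monomials of degree >= p delta and weight >= p om, and the claimed core by
    those of degree > d (delta - 2) + g and weight >= om.

    Lower bound.  By Noether normalisation a reduction J contains d elements whose
    parts f_1, ..., f_d of degree delta satisfy L^(p+1) = (f) L^p.  Such a system
    carries a residue functional phi that kills f_i r for r of weight
    >= (d-g) om, but not the determinant of a suitably weighted matrix expressing f
    through x.  Writing h(x) - h(x') and f_i(x) - f_i(x') through difference quotients
    and applying Cramer's rule and then phi in the variables x' (Morley forms), every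
    form h of degree > d (delta - 2) + g and weight >= om lies in (f).  By successive
    approximation the claimed core is contained in J up to terms of arbitrarily high
    degree, and these lie in J because, after inverting any variable, J and L agree.

    Upper bound.  The core is stable under the linear automorphisms that respect the
    weight.  Hence it is monomial, and a monomial of too small degree in it would
    produce, by shears, the element x_1^a prod_i (x_i - x_1)^(delta-1) of degree
    d (delta - 2) + g.  That element is not in the reduction generated by the
    Schmitt-Vogel sums sum_(i+j=k) x_i z_j^(delta-1): multiplied by x_1^(d-g) it is,
    up to terms killed by phi, a nonzero multiple of the determinant above. *)

(* For d > g the elements f_1, ..., f_d are no complete intersection: they all vanish where x_1 =
   ... = x_g = 0, so no ordinary residue is at hand. The functional phi is built to replace it. An
   extra variable absorbs surplus weight; the lifted f are then compared with the d coefficients of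
   the product of two generic polynomials of degrees g-1 and d-g, which have no common zero on a
   product of projective spaces of total dimension d-1. There the residue is explicit, being dual to
   a cross resultant, and a transformation law for determinants carries it to f. The constant d
   (delta-2) + g comes from the determinant of difference quotients. Its degree in x and x' together
   is at most d (delta-1), and each of the d-g columns of a variable of weight 0 contributes weight
   om in x'. So every term has x'-degree at least d-g and x-degree at most d (delta-1) - (d-g).
   Characteristic zero enters through factorials and multinomial coefficients, through points off a
   hypersurface, and through the separation of monomials by scaling. *)
Require Import Defs.
From HB Require Import structures.
From mathcomp Require Import all_boot fingroup perm all_algebra.
From mathcomp Require Import ssrcomplements mpoly.
From mathcomp Require Import zify ring.

Set Implicit Arguments.
Unset Strict Implicit.
Unset Printing Implicit Defensive.

Import GRing.Theory.
Local Open Scope ring_scope.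

(** * Monomial spans *)

Section MonomialSpans.

Variables (n : nat) (R : comNzRingType).
Implicit Types (f h : {mpoly R[n]}) (P Q S : 'X_{1..n} -> Prop).

(** A property of monomials stands for the span of the monomials that have it. For upward closed [P]
    this is a monomial ideal; the same encoding expresses homogeneity and bounds on degree or
    weight. *)
Definition MI P f : Prop := forall m, f@_m != 0 -> P m.

Lemma MI_0 P : MI P 0.
Proof. by move=> m; rewrite mcoeff0 eqxx. Qed.

Lemma MI_D P f h : MI P f -> MI P h -> MI P (f + h).
Proof.
move=> Pf Ph m; rewrite mcoeffD; case: (eqVneq f@_m 0) => [->|/Pf //].
by rewrite add0r => /Ph.
Qed.

Lemma MI_N P f : MI P f -> MI P (- f).
Proof. by move=> Pf m; rewrite mcoeffN oppr_eq0 => /Pf. Qed.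

Lemma MI_B P f h : MI P f -> MI P h -> MI P (f - h).
Proof. by move=> Pf Ph; apply: MI_D => //; apply: MI_N. Qed.

Lemma MI_Z P c f : MI P f -> MI P (c *: f).
Proof.
move=> Pf m; rewrite mcoeffZ; have [->|/Pf //] := eqVneq f@_m 0.
by rewrite mulr0 eqxx.
Qed.

Lemma MI_sum P (I : Type) (r : seq I) (A : pred I) (F : I -> {mpoly R[n]}) :
  (forall i, A i -> MI P (F i)) -> MI P (\sum_(i <- r | A i) F i).
Proof. by move=> PF; elim/big_ind: _ => //; [apply: MI_0 | apply: MI_D]. Qed.

Lemma MI_X P m : P m -> MI P 'X_[m].
Proof. by move=> Pm m'; rewrite mcoeffX; case: (eqVneq m m') => [<-|]; rewrite ?eqxx. Qed.

Lemma MI_S P Q f : (forall m, P m -> Q m) -> MI P f -> MI Q f.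
Proof. by move=> PQ Pf m /Pf /PQ. Qed.

Lemma MI_M P Q S f h :
  (forall m1 m2, P m1 -> Q m2 -> S (m1 + m2)%MM) ->
  MI P f -> MI Q h -> MI S (f * h).
Proof.
move=> PQS Pf Qh m; rewrite -mcoeff_msupp => /msuppM_le /allpairsP.
case=> -[m1 m2] /= []; rewrite !mcoeff_msupp => /Pf P1 /Qh P2 ->.
exact: PQS.
Qed.

Lemma MI_ind P (K : {mpoly R[n]} -> Prop) :
  K 0 -> (forall f h, K f -> K h -> K (f + h)) ->
  (forall c m, P m -> K (c *: 'X_[m])) ->
  forall f, MI P f -> K f.
Proof.
move=> K0 KD KX f Pf; rewrite [f]mpolyE big_seq.
by elim/big_ind: _ => // m; rewrite mcoeff_msupp => /Pf /KX.
Qed.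

(** Used with the degree and with the weight, so that the homogeneous components of both gradings
    are one notion. *)
Definition mpart (p : pred 'X_{1..n}) f : {mpoly R[n]} :=
  \sum_(m <- msupp f | p m) f@_m *: 'X_[m].

Lemma mcoeff_mpart p f m : (mpart p f)@_m = if p m then f@_m else 0.
Proof.
rewrite /mpart raddf_sum /=.
under eq_bigr do rewrite mcoeffZ mcoeffX.
have [mf|mf] := boolP (m \in msupp f); last first.
  rewrite (memN_msupp_eq0 mf) if_same big_seq_cond big1 // => i /andP[mi _].
  by case: eqP mi mf => [->->|_ _ _] //; rewrite mulr0.
rewrite -big_filter; case: ifP => pm.
  rewrite (bigD1_seq m) /= ?filter_uniq ?msupp_uniq ?mem_filter ?pm //.
  rewrite eqxx mulr1 big1 ?addr0 // => i /negbTE ->; by rewrite mulr0.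
rewrite big_seq_cond big1 // => i; rewrite mem_filter andbT => /andP[pi _].
by case: eqP pi => [->|_ _]; rewrite ?pm ?mulr0.
Qed.

Lemma mpart_is_linear p : linear (mpart p).
Proof.
move=> c f h; apply/mpolyP => m.
rewrite mcoeffD mcoeffZ !mcoeff_mpart mcoeffD mcoeffZ.
by case: ifP; rewrite ?mulr0 ?addr0.
Qed.

HB.instance Definition _ p :=
  GRing.isLinear.Build R {mpoly R[n]} {mpoly R[n]} _ (mpart p)
    (mpart_is_linear p).

Lemma mpart_MI P (p : pred 'X_{1..n}) f : (forall m, P m -> p m) -> MI P f -> mpart p f = f.
Proof.
move=> Pp Pf; apply/mpolyP => m; rewrite mcoeff_mpart.
by case: ifP => // pm; apply/esym/eqP; apply: contraFT pm => /Pf /Pp.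
Qed.

Lemma mpart_MI0 P (p : pred 'X_{1..n}) f : (forall m, P m -> ~~ p m) -> MI P f -> mpart p f = 0.
Proof.
move=> Pp Pf; apply/mpolyP => m; rewrite mcoeff_mpart mcoeff0.
by case: ifP => // pm; apply/eqP; apply: contraTT pm => /Pf /Pp.
Qed.

Lemma MI_mpart P (p : pred 'X_{1..n}) f :
  MI P f -> MI (fun m => P m /\ p m) (mpart p f).
Proof.
by move=> Pf m; rewrite mcoeff_mpart; case: ifP => [? /Pf|]; rewrite ?eqxx.
Qed.

End MonomialSpans.

Section IdealAlgebra.

Variable A : comNzRingType.
Implicit Types S I J L : A -> Prop.

Lemma ideal_span_ideal S : is_ideal (ideal_span S).
Proof.
split.
- by exists 0%N, (fun=> 0), (fun=> 0); split => [[]|]; rewrite ?big_ord0.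
- move=> a b [m [r [s [Ss ->]]]] [m' [r' [s' [Ss' ->]]]].
  exists (m + m')%N, (fun i => match split i with inl j => r j | inr j => r' j end),
   (fun i => match split i with inl j => s j | inr j => s' j end).
  split=> [i|]; first by case: (split i).
  rewrite big_split_ord /=; congr (_ + _); apply: eq_bigr => i _.
    by rewrite (unsplitK (inl i)).
  by rewrite (unsplitK (inr i)).
- move=> c a [m [r [s [Ss ->]]]]; exists m, (fun i => c * r i), s.
  by split=> //; rewrite mulr_sumr; apply: eq_bigr => i _; rewrite mulrA.
Qed.

Lemma ideal_span_gen S f : S f -> ideal_span S f.
Proof.
by move=> Sf; exists 1%N, (fun=> 1), (fun=> f); rewrite big_ord1 mul1r.
Qed.

Lemma ideal_span_min S I : is_ideal I -> (forall f, S f -> I f) ->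
  ideal_le (ideal_span S) I.
Proof.
move=> [I0 ID IM] SI f [m [r [s [Ss ->]]]].
by elim/big_ind: _ => // i _; apply: IM; apply: SI.
Qed.

Lemma ideal_sum I (T : Type) (r : seq T) (B : pred T) F : is_ideal I ->
  (forall i, B i -> I (F i)) -> I (\sum_(i <- r | B i) F i).
Proof. by move=> [I0 ID _] IF; elim/big_ind: _. Qed.

Lemma ideal_opp I f : is_ideal I -> I f -> I (- f).
Proof. by move=> [_ _ IM] If; rewrite -mulN1r; apply: IM. Qed.

Lemma ideal_sub I f h : is_ideal I -> I f -> I h -> I (f - h).
Proof. by move=> Ii If Ih; case: (Ii) => _ ID _; apply: ID => //; apply: ideal_opp. Qed.

Lemma ideal_mul_gen I J a b : I a -> J b -> ideal_mul I J (a * b).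
Proof. by move=> Ia Jb; apply: ideal_span_gen; exists a, b. Qed.

Lemma ideal_mul_le I I' J J' : ideal_le I I' -> ideal_le J J' ->
  ideal_le (ideal_mul I J) (ideal_mul I' J').
Proof.
move=> II' JJ' f [m [r [s [Ss ->]]]]; exists m, r, s; split=> // i.
by have [a [b [/II' Ia /JJ' Jb ->]]] := Ss i; exists a, b.
Qed.

Lemma ideal_mul_eq I I' J J' : ideal_eq I I' -> ideal_eq J J' ->
  ideal_eq (ideal_mul I J) (ideal_mul I' J').
Proof.
by move=> II' JJ' f; split; apply: ideal_mul_le => h; rewrite (II', JJ').
Qed.

Lemma ideal_exp_eq I I' m : ideal_eq I I' ->
  ideal_eq (ideal_exp I m) (ideal_exp I' m).
Proof. by move=> II'; elim: m => //= m IH; apply: ideal_mul_eq. Qed.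

Lemma ideal_eq_trans I J K : ideal_eq I J -> ideal_eq J K -> ideal_eq I K.
Proof. by move=> IJ JK f; rewrite IJ JK. Qed.

End IdealAlgebra.

Section MonomialIdeals.

Variables (n : nat) (R : comNzRingType).
Implicit Types (f h : {mpoly R[n]}) (P Q S : 'X_{1..n} -> Prop).

Definition upc P := forall m m', P m -> P (m' + m)%MM.

Lemma MI_ideal P : upc P -> is_ideal (@MI n R P).
Proof.
move=> uP; split; [exact: MI_0 | move=> a b; exact: MI_D |].
move=> r a Pa; apply: (@MI_M _ _ (fun=> True) P) => // m1 m2 _; exact: uP.
Qed.

Lemma MI_mul P Q : upc Q ->
  ideal_eq (ideal_mul (@MI n R P) (@MI n R Q))
    (MI (fun m => exists m1 m2, [/\ P m1, Q m2 & m = m1 + m2]%MM)).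
Proof.
move=> uQ f; split.
  apply: ideal_span_min => [|_ [a [b [Pa Qb ->]]]].
    apply: MI_ideal => m m' [m1 [m2 [P1 Q2 ->]]].
    exists m1, (m' + m2)%MM; split=> //; first exact: uQ.
    by rewrite addmA [(m' + m1)%MM]addmC -addmA.
  by apply: MI_M Pa Qb => m1 m2 P1 Q2; exists m1, m2.
have [K0 KD KM] := ideal_span_ideal
  (fun f => exists a b, [/\ @MI n R P a, @MI n R Q b & f = a * b]).
move: f; apply: MI_ind => // c m [m1 [m2 [P1 Q2 ->]]].
rewrite -mul_mpolyC; apply: KM; rewrite mpolyXD.
by apply: ideal_mul_gen; apply: MI_X.
Qed.

Lemma MI_eq P Q : (forall m, P m <-> Q m) -> ideal_eq (@MI n R P) (MI Q).
Proof. by move=> PQ f; split; apply: MI_S => m; rewrite PQ. Qed.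

Lemma span_X P (T : 'X_{1..n} -> Prop) :
  (forall m, P m <-> exists2 m0, T m0 & (m0 <= m)%MM) ->
  ideal_eq (@ideal_span {mpoly R[n]} (fun f => exists2 m, T m & f = 'X_[m])) (MI P).
Proof.
move=> PT f; split.
  apply: ideal_span_min => [|_ [m Tm ->]].
    apply: MI_ideal => m m' /PT[m0 T0 le0]; apply/PT; exists m0 => //.
    exact: lepm_trans le0 (lem_addl _ _).
  by apply: MI_X; apply/PT; exists m; rewrite ?lepm_refl.
have [K0 KD KM] := ideal_span_ideal (fun f => exists2 m, T m & f = 'X_[R, m]).
move: f; apply: MI_ind => // c m /PT[m0 T0 le0].
rewrite -(submK le0) mpolyXD -mul_mpolyC mulrA; apply: KM.
by apply: ideal_span_gen; exists m0.
Qed.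

End MonomialIdeals.

(** * Powers of the lex-segment ideals *)

Lemma mnm_sub_mdeg n (m : 'X_{1..n}) j : (j <= mdeg m)%N ->
  exists2 m', (m' <= m)%MM & mdeg m' = j.
Proof.
elim: j => [_|j IH jm]; first by exists 0%MM; rewrite ?mdeg0 //; apply/mnm_lepP => i; rewrite mnm0E.
have [m' le_m' dm'] := IH (ltnW jm).
have [i lti] : exists i, (m' i < m i)%N.
  apply/existsP; apply: contraTT jm; rewrite negb_exists -leqNgt -dm' => /forallP H.
  by rewrite !mdegE; apply: leq_sum => i _; rewrite leqNgt.
exists (m' + U_(i))%MM; last by rewrite mdegD mdeg1 dm' addn1.
apply/mnm_lepP => l; rewrite mnmDE mnm1E; case: eqP => [<-|_]; first by rewrite addn1.
by rewrite addn0; apply/mnm_lepP.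
Qed.

Section Weights.

Variables (d g om : nat).

Definition var_weight (i : 'I_d) : nat := if (i < g.-1)%N then om else (i < g)%N.
Local Notation wgt := var_weight.

Definition mnm_weight (m : 'X_{1..d}) : nat := (\sum_i m i * wgt i)%N.
Local Notation wt := mnm_weight.

Lemma wt0 : wt 0%MM = 0%N.
Proof. by rewrite /wt big1 // => i _; rewrite mnm0E. Qed.

Lemma wtD m1 m2 : wt (m1 + m2)%MM = (wt m1 + wt m2)%N.
Proof. by rewrite /wt -big_split; apply: eq_bigr => i _ /=; rewrite mnmDE mulnDl. Qed.

Lemma wt1 i : wt U_(i)%MM = wgt i.
Proof.
rewrite /wt (bigD1 i) //= mnm1E eqxx mul1n big1 ?addn0 // => j ji.
by rewrite mnm1E eq_sym (negbTE ji).
Qed.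

Lemma wtMn m j : wt (m *+ j)%MM = (wt m * j)%N.
Proof. by rewrite /wt big_distrl; apply: eq_bigr => i _ /=; rewrite mulmnE; lia. Qed.

Lemma wt_le m1 m2 : (m1 <= m2)%MM -> (wt m1 <= wt m2)%N.
Proof. by move/submK <-; rewrite wtD leq_addl. Qed.

Lemma wgt_y (i : 'I_d) : (g <= i)%N -> wgt i = 0%N.
Proof. by rewrite /wgt => gi; rewrite ltnNge (leq_trans (leq_pred g) gi) /= ltnNge gi. Qed.

Lemma wgt_x (i : 'I_d) : (0 < om)%N -> (i < g)%N -> (0 < wgt i)%N.
Proof. by rewrite /wgt => om0 ->; case: ifP. Qed.

Lemma wgt_le (i : 'I_d) : (0 < om)%N -> (wgt i <= om)%N.
Proof. by rewrite /wgt => om0; case: ifP => // _; case: ltnP. Qed.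

Lemma wt_le_mdeg m : (0 < om)%N -> (wt m <= om * mdeg m)%N.
Proof.
move=> om0; rewrite mdegE big_distrr /=; apply: leq_sum => i _.
by rewrite mulnC leq_mul2r wgt_le ?orbT.
Qed.

End Weights.

Section LexSegment.

Variables (d g delta om : nat).
Hypotheses (g_ge2 : (2 <= g)%N) (g_le_d : (g <= d)%N) (delta_ge2 : (2 <= delta)%N)
  (om_case : om = 1%N \/ om = delta).

Local Notation wt := (@mnm_weight d g om).
Local Notation wgt := (@var_weight d g om).

(* These monomials span the p-th power of the ideal of case (1) for [om = delta],
   of case (2) for [om = 1]. *)
Definition lex_mnm (p : nat) (m : 'X_{1..d}) : Prop :=
  (p * delta <= mdeg m)%N && (p * om <= wt m)%N.
Local Notation PP := lex_mnm.

Lemma om_gt0 : (0 < om)%N. Proof. by clear g_ge2 g_le_d; case: om_case => ->; lia. Qed.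
Lemma om_le : (om <= delta)%N. Proof. by clear g_ge2 g_le_d; case: om_case => ->; lia. Qed.

Lemma PP_upc p : upc (PP p).
Proof.
clear; move=> m m' /andP[h1 h2]; rewrite /PP mdegD wtD.
by apply/andP; split; lia.
Qed.

Lemma PP_add p p' m m' : PP p m -> PP p' m' -> PP (p + p')%N (m + m')%MM.
Proof.
clear; by move=> /andP[h1 h2] /andP[h3 h4]; rewrite /PP mdegD wtD; apply/andP; split; lia.
Qed.

Let xpart (m : 'X_{1..d}) : 'X_{1..d} := [multinom if (i < g)%N then m i else 0%N | i < d].
Let ypart (m : 'X_{1..d}) : 'X_{1..d} := [multinom if (i < g)%N then 0%N else m i | i < d].

Let xyE m : (xpart m + ypart m)%MM = m.
Proof. by apply/mnmP => i; rewrite mnmDE !mnmE; case: ifP => _; lia. Qed.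

Let wt_y m : wt (ypart m) = 0%N.
Proof.
rewrite /wt big1 // => i _; rewrite mnmE; case: (ltnP i g) => // gi.
by rewrite wgt_y ?muln0.
Qed.

Let wt_x m m' : (m' <= xpart m)%MM -> (mdeg m' <= wt m')%N.
Proof.
move=> /mnm_lepP le; rewrite mdegE; apply: leq_sum => i _.
have := le i; rewrite mnmE; case: ifP => [ig _|_]; last by rewrite leqn0 => /eqP->.
by rewrite leq_pmulr // wgt_x // om_gt0.
Qed.

(** The reason why [lex_mnm p] describes the p-th power: a generator of degree exactly [delta] can
    be split off so that degree and weight of the cofactor stay large enough. *)
Lemma PP_split p m : PP p.+1 m ->
  exists m1 m2, [/\ PP 1 m1, PP p m2, mdeg m1 = delta & m = m1 + m2]%MM.
Proof.
move=> /andP[h1 h2]; have := om_gt0; have := om_le => le_om om0.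
have [/existsP[i /andP[/eqP wi mi]]|/existsPn none] :=
  boolP [exists i : 'I_d, (wgt i == om) && (0 < m i)%N].
  have ig : (i < g)%N by rewrite ltnNge; apply/negP => /(wgt_y om) wi'; lia.
  have dm : mdeg m = (mdeg (xpart m) + mdeg (ypart m))%N by rewrite -mdegD xyE.
  (* With enough variables of weight 0, the factor x_i y' spends exactly [om] of the weight and
     [delta] of the degree. *)
  have [c_ge|c_lt] := leqP delta.-1 (mdeg (ypart m)).
    have [y' le_y dy] := mnm_sub_mdeg c_ge.
    have le_m1 : (U_(i) + y' <= m)%MM.
      apply/mnm_lepP => l; rewrite mnmDE mnm1E; move/mnm_lepP: le_y => /(_ l).
      rewrite mnmE; case: (eqVneq i l) => [<-|_]; first by rewrite ig; lia.
      by case: ifP => _; lia.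
    have wy' : wt y' = 0%N.
      by apply/eqP; rewrite -leqn0 -(wt_y m) wt_le.
    have wtm : wt m = (wt (m - (U_(i) + y')) + om)%N.
      by rewrite -{1}(submK le_m1) wtD wtD wt1 wi wy'; lia.
    have dgm : mdeg m = (mdeg (m - (U_(i) + y')) + delta)%N.
      by rewrite -{1}(submK le_m1) mdegD mdegD mdeg1 dy; lia.
    exists (U_(i) + y')%MM, (m - (U_(i) + y'))%MM; split.
    - by rewrite /PP mdegD wtD wt1 mdeg1 wi dy; lia.
    - by rewrite /PP; lia.
    - by rewrite mdegD mdeg1 dy; lia.
    - by rewrite addmC submK.
  (* Otherwise all variables of weight 0 go into the first factor. The cofactor has only variables
     of positive weight, so its weight is at least its degree, hence at least p om. *)
  have ux : (U_(i) <= xpart m)%MM.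
    by apply/mnm_lepP => l; rewrite mnm1E mnmE; case: eqP => [<-|//]; rewrite ig.
  have dx : mdeg (xpart m) = (mdeg (xpart m - U_(i)) + 1)%N.
    by rewrite -{1}(submK ux) mdegD mdeg1.
  have [|x' le_x dx'] := @mnm_sub_mdeg _ (xpart m - U_(i))%MM (delta.-1 - mdeg (ypart m))%N.
    by move: h1; rewrite mulSn; lia.
  have le_x2 : (U_(i) + x' <= xpart m)%MM.
    rewrite -(submK ux) addmC; apply/mnm_lepP => l; rewrite !mnmDE leq_add2r.
    by move/mnm_lepP: le_x.
  have mE : m = (U_(i) + ypart m + x' + (xpart m - (U_(i) + x')))%MM.
    rewrite -{1}(xyE m) -{1}(submK le_x2); apply/mnmP => l; rewrite !mnmDE; lia.
  exists (U_(i) + ypart m + x')%MM, (xpart m - (U_(i) + x'))%MM.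
  have dg1 : mdeg (U_(i) + ypart m + x')%MM = delta.
    by rewrite !mdegD mdeg1 dx'; lia.
  split=> //.
  - by rewrite /PP dg1 !wtD wt1 wi; lia.
  - have dg2 : (p * delta <= mdeg (xpart m - (U_(i) + x')))%N.
      by move: h1; rewrite {1}mE mdegD dg1 mulSn; lia.
    rewrite /PP dg2 /=; apply: leq_trans (wt_x (lem_subr _ _)).
    by apply: leq_trans dg2; rewrite leq_mul2l le_om orbT.
(* No variable of weight [om] divides m. The weight then comes from x_g alone, which rules out
   [om = 1] and leaves x_g^delta to be split off. *)
have g1d : (g.-1 < d)%N by lia.
pose e := Ordinal g1d.
have wtm : wt m = m e.
  rewrite /wt (bigD1 e) //= big1 ?addn0 => [|i ie].
    by rewrite /wgt /= ltnn (_ : g.-1 < g)%N ?muln1 //; lia.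
  have := none i; rewrite negb_and -leqNgt leqn0 => /orP[|/eqP-> //].
  rewrite /wgt; case: ifP => [_|ig]; first by rewrite eqxx.
  case: (ltnP i g) => // ig'; last by rewrite muln0.
  by move: ie; rewrite (_ : i = e) ?eqxx //; apply/val_inj => /=; lia.
case: om_case => omE.
  have := none e; rewrite /wgt /= ltnn (_ : g.-1 < g)%N; last by lia.
  by move: h2; rewrite wtm omE eqxx /=; lia.
have le_e : (U_(e) *+ delta <= m)%MM.
  apply/mnm_lepP => l; rewrite mulmnE mnm1E; case: eqP => [<-|_]; last by rewrite mul0n.
  by rewrite mul1n -wtm; apply: leq_trans h2; rewrite omE mulSn leq_addr.
have we : wgt e = 1%N by rewrite /wgt /= ltnn (_ : g.-1 < g)%N //; lia.
exists (U_(e) *+ delta)%MM, (m - U_(e) *+ delta)%MM; split.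
- by rewrite /PP mdegMn mdeg1 wtMn wt1 we omE; lia.
- have : m = (U_(e) *+ delta + (m - U_(e) *+ delta))%MM by rewrite addmC submK.
  move: h1 h2 => h1 h2 E; move: h1 h2; rewrite {1 2}E mdegD wtD mdegMn mdeg1 wtMn wt1 we.
  by rewrite /PP omE; lia.
- by rewrite mdegMn mdeg1 mul1n.
- by rewrite addmC submK.
Qed.

End LexSegment.

Section LexIdealsMonomial.

Variables (k : fieldType) (d g delta : nat).
Hypotheses (g_ge2 : (2 <= g)%N) (g_le_d : (g <= d)%N) (delta_ge2 : (2 <= delta)%N).

Lemma span_cond_eq (A : comNzRingType) (S S' : A -> Prop) :
  (forall f, S f <-> S' f) -> ideal_eq (ideal_span S) (ideal_span S').
Proof.
move=> SS' f; split=> -[m [r [s [Ss ->]]]]; exists m, r, s; split=> // i.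
  by apply/SS'.
by apply/SS'.
Qed.

Lemma var_ideal_MI r : ideal_eq (var_ideal k d r)
  (MI (fun m => exists2 i : 'I_d, (i < r)%N & m i != 0%N)).
Proof.
apply: ideal_eq_trans (@span_X _ _ _ (fun m => exists2 i : 'I_d, (i < r)%N & m = U_(i)%MM) _).
  by apply: span_cond_eq => f; split=> [[i ir ->]|[_ [i ir ->] ->]]; [exists U_(i)%MM => //|]; exists i.
move=> m; split=> [[i ir mi]|[_ [i ir ->]]].
  by exists U_(i)%MM; [exists i | rewrite lep1mP].
by rewrite lep1mP => mi; exists i.
Qed.

Lemma max_exp_MI p : ideal_eq (ideal_exp (max_ideal k d) p)
  (MI (fun m => (p <= mdeg m)%N)).
Proof.
elim: p => [|p IH] /=; first by move=> f; split.
have H := ideal_mul_eq (var_ideal_MI d) IH.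
apply: ideal_eq_trans H _.
apply: ideal_eq_trans (@MI_mul _ _ _ _ _) _.
  by move=> m m' /= h; rewrite mdegD; lia.
apply: MI_eq => m; split=> [[m1 [m2 [[i _ mi] h ->]]]|h].
  by rewrite mdegD mdegE (bigD1 i) //=; lia.
have /existsP[i mi] : [exists i, m i != 0%N].
  apply: contraLR h => /existsPn H; rewrite mdegE big1 // => i _.
  by apply/eqP; rewrite -[_ == _]negbK H.
exists U_(i)%MM, (m - U_(i))%MM; split.
- by exists i => //; rewrite mnm1E eqxx.
- by move: h; rewrite -{1}(@submK _ U_(i)%MM m) ?lep1mP // mdegD mdeg1 addn1.
- by rewrite addmC submK ?lep1mP.
Qed.

Lemma var_pow_MI j p : ideal_eq (var_pow_ideal k d j p)
  (MI (fun m => exists2 i : 'I_d, i.+1 = j & (p <= m i)%N)).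
Proof.
apply: ideal_eq_trans (@span_X _ _ _ (fun m => exists2 i : 'I_d, i.+1 = j & m = (U_(i) *+ p)%MM) _).
  apply: span_cond_eq => f; split=> [[i ir ->]|[_ [i ir ->] ->]].
    by exists (U_(i) *+ p)%MM; [exists i | rewrite mpolyXn].
  by exists i; rewrite ?mpolyXn.
move=> m; split=> [[i ir mi]|[_ [i ir ->]] /mnm_lepP le].
  exists (U_(i) *+ p)%MM; first by exists i.
  by apply/mnm_lepP => l; rewrite mulmnE mnm1E; case: eqP => [<-|//]; rewrite mul1n.
by exists i => //; have := le i; rewrite mulmnE mnm1E eqxx mul1n.
Qed.

(** Decidability of [P] lets an element be cut in two by [mpart]. *)
Lemma MI_add n (R : comNzRingType) (P Q : 'X_{1..n} -> Prop) (Pd : pred 'X_{1..n}) :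
  (forall m, reflect (P m) (Pd m)) ->
  ideal_eq (ideal_add (@MI n R P) (@MI n R Q)) (MI (fun m => P m \/ Q m)).
Proof.
move=> PdP f; split=> [[a [b [Pa Qb ->]]]|PQ].
  by apply: MI_D; [apply: MI_S Pa | apply: MI_S Qb] => m; [left | right].
exists (mpart Pd f), (f - mpart Pd f); split; last by rewrite addrC subrK.
  by move=> m; rewrite mcoeff_mpart; case: PdP; rewrite ?eqxx.
move=> m; rewrite mcoeffB mcoeff_mpart; case: PdP; rewrite ?subrr ?eqxx // => nP.
by rewrite subr0 => /PQ[].
Qed.

Lemma PP1_wt om m : om = 1%N \/ om = delta ->
  @lex_mnm d g delta om 1 m <-> (delta <= mdeg m)%N /\
    ((exists2 i : 'I_d, var_weight g om i = om & m i != 0%N) \/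
     om = delta /\ exists2 i : 'I_d, i.+1 = g & (delta <= m i)%N).
Proof.
move=> om_case; have om0 := om_gt0 delta_ge2 om_case; have le_om := om_le delta_ge2 om_case.
split.
  rewrite /lex_mnm !mul1n => /andP[h1 h2]; split=> //.
  have [/existsP[i /andP[/eqP wi mi]]|/existsPn none] :=
    boolP [exists i : 'I_d, (var_weight g om i == om) && (m i != 0)%N]; first by left; exists i.
  have g1d : (g.-1 < d)%N by lia.
  pose e := Ordinal g1d.
  have we : var_weight g om e = 1%N by rewrite /var_weight /= ltnn (_ : g.-1 < g)%N //; lia.
  have wtm : mnm_weight g om m = m e.
    rewrite /mnm_weight (bigD1 e) //= we muln1 big1 ?addn0 // => i ie.
    have := none i; rewrite negb_and negbK => /orP[|/eqP-> //].
    rewrite /var_weight; case: ifP => [_|ig]; first by rewrite eqxx.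
    case: (ltnP i g) => // ig'; last by rewrite muln0.
    by move: ie; rewrite (_ : i = e) ?eqxx //; apply/val_inj => /=; lia.
  right; case: om_case => omE.
    by have := none e; rewrite we omE eqxx /=; move: h2; rewrite wtm omE; case: (m e).
  by split=> //; exists e; [rewrite /=; lia | rewrite -wtm -omE].
case=> h1 h; rewrite /lex_mnm !mul1n h1 /=; case: h => [[i wi mi]|[omE [i ig mi]]].
  by rewrite /mnm_weight (bigD1 i) //= wi; apply: leq_trans (leq_addr _ _); rewrite leq_pmull // lt0n.
rewrite /mnm_weight (bigD1 i) //=; apply: leq_trans (leq_addr _ _); rewrite omE.
apply: leq_trans mi _; rewrite leq_pmulr // /var_weight -ig /= ltnn (_ : i < i.+1)%N //.
Qed.

Lemma lex_ideal1_MI :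
  ideal_eq (lex_ideal1 k d g delta) (MI (@lex_mnm d g delta delta 1)).
Proof.
pose P (m : 'X_{1..d}) := exists m1 m2 : 'X_{1..d},
  [/\ exists2 i : 'I_d, (i < g - 1)%N & m1 i != 0%N, (delta - 1 <= mdeg m2)%N & m = m1 + m2]%MM.
have PE m : reflect (P m) ((delta <= mdeg m)%N && [exists i : 'I_d, (i < g - 1)%N && (m i != 0)%N]).
  apply: (iffP andP).
    case=> h /existsP[i /andP[ig mi]].
    have le1 : (U_(i) <= m)%MM by rewrite lep1mP.
    exists U_(i)%MM, (m - U_(i))%MM; split; last by rewrite addmC submK.
      by exists i; rewrite ?mnm1E ?eqxx.
    by move: h; rewrite -{1}(submK le1) mdegD mdeg1; lia.
  case=> m1 [m2 [[i ig mi] h ->]]; split.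
    by rewrite mdegD mdegE (bigD1 i) //=; lia.
  by apply/existsP; exists i; rewrite ig mnmDE; lia.
have H1 := ideal_mul_eq (var_ideal_MI (g - 1)) (max_exp_MI (delta - 1)).
have H2 := @MI_mul _ k (fun m => exists2 i : 'I_d, (i < g - 1)%N & m i != 0%N)
  (fun m : 'X_{1..d} => (delta - 1 <= mdeg m)%N).
have {H2} H2 := ideal_eq_trans H1 (H2 (fun m m' h => leq_trans h _)).
have H3 : forall f, lex_ideal1 k d g delta f <->
    ideal_add (MI P) (MI (fun m => exists2 i : 'I_d, i.+1 = g & (delta <= m i)%N)) f.
  move=> f; split=> -[a [b [ha hb ->]]]; exists a, b; split=> //.
  - by apply/H2 => // m m'; rewrite mdegD leq_addl.
  - exact/var_pow_MI.
  - by apply/H2 => // m m'; rewrite mdegD leq_addl.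
  - exact/var_pow_MI.
apply: ideal_eq_trans H3 _; apply: ideal_eq_trans (MI_add _ PE) _.
apply: MI_eq => m; rewrite PP1_wt; last by right.
split=> [[/PE/andP[h /existsP[i /andP[ig mi]]]|[i ig mi]]|[h [[i wi mi]|[_ ?]]]].
- by split=> //; left; exists i => //; rewrite /var_weight (_ : (i < g.-1)%N) //; lia.
- split; last by right; split=> //; exists i.
  by rewrite mdegE (bigD1 i) //= (leq_trans mi) // leq_addr.
- left; apply/PE; rewrite h; apply/existsP; exists i; rewrite mi andbT.
  by move: wi; rewrite /var_weight; case: ifP; case: ltnP; lia.
- by right.
Qed.

Lemma lex_ideal2_MI :
  ideal_eq (lex_ideal2 k d g delta) (MI (@lex_mnm d g delta 1 1)).
Proof.
apply: ideal_eq_trans (ideal_mul_eq (var_ideal_MI g) (max_exp_MI (delta - 1))) _.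
apply: ideal_eq_trans (@MI_mul _ _ _ _ _) _.
  by move=> m m' /= h; rewrite mdegD; lia.
apply: MI_eq => m; rewrite PP1_wt; last by left.
have wE (i : 'I_d) : var_weight g 1 i = 1%N <-> (i < g)%N.
  by rewrite /var_weight; case: ifP; case: ltnP; lia.
split=> [[m1 [m2 [[i ig mi] h ->]]]|[h [[i /wE ig mi]|[?]]]].
- split; first by rewrite mdegD mdegE (bigD1 i) //=; lia.
  by left; exists i; rewrite ?mnmDE; [apply/wE | lia].
- have le1 : (U_(i) <= m)%MM by rewrite lep1mP.
  exists U_(i)%MM, (m - U_(i))%MM; split; last by rewrite addmC submK.
    by exists i; rewrite ?mnm1E ?eqxx.
  by move: h; rewrite -{1}(submK le1) mdegD mdeg1; lia.
- lia.
Qed.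

Variable om : nat.
Hypothesis om_case : om = 1%N \/ om = delta.
Local Notation PP := (@lex_mnm d g delta om).

Lemma exp_PP p : ideal_eq (ideal_exp (@MI d k (PP 1)) p) (MI (PP p)).
Proof.
elim: p => [|p IH] /=.
  by move=> f; split=> // _ m _; rewrite /lex_mnm !mul0n.
apply: ideal_eq_trans (ideal_mul_eq _ IH) _; first by move=> f; split; exact: id.
apply: ideal_eq_trans (@MI_mul _ _ _ _ (@PP_upc _ _ _ _ _)) _.
apply: MI_eq => m; split=> [[m1 [m2 [h1 h2 ->]]]|h].
  by rewrite -add1n; apply: PP_add.
by have [m1 [m2 [? ? _ ?]]] := PP_split g_ge2 g_le_d delta_ge2 om_case h; exists m1, m2.
Qed.

Lemma mul_PP_max N : ideal_eq (ideal_mul (@MI d k (PP 1)) (ideal_exp (max_ideal k d) N))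
  (MI (fun m => (N + delta <= mdeg m)%N && (om <= mnm_weight g om m)%N)).
Proof.
apply: ideal_eq_trans (ideal_mul_eq _ (max_exp_MI N)) _; first by move=> f; split; exact: id.
apply: ideal_eq_trans (@MI_mul _ _ _ _ _) _.
  by move=> m m' /= h; rewrite mdegD; lia.
apply: MI_eq => m; split=> [[m1 [m2 [/andP[h1 h2] h3 ->]]]|/andP[h1 h2]].
  by rewrite mdegD wtD; move: h1 h2; rewrite !mul1n; lia.
(* With p = 0 the splitting yields a divisor in L of degree exactly [delta], so that all other
   degree is available for the power of the maximal ideal. *)
have [|m1 [m2 [h3 h4 h5 mE]]] := PP_split (p := 0) g_ge2 g_le_d delta_ge2 om_case (m := m).
  by rewrite /lex_mnm !mul1n h2 andbT; lia.
by exists m1, m2; split=> //; move: h1; rewrite mE mdegD h5; lia.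
Qed.

End LexIdealsMonomial.

(** * The residue functional *)

Lemma MI_prod_le n (R : comNzRingType) (mf : 'X_{1..n} -> nat) (I : Type) (r : seq I)
    (A : pred I) (c : I -> nat) (F : I -> {mpoly R[n]}) :
  mf 0%MM = 0%N -> {morph mf : m1 m2 / (m1 + m2)%MM >-> (m1 + m2)%N} ->
  (forall i, A i -> MI (fun m => (mf m <= c i)%N) (F i)) ->
  MI (fun m => (mf m <= \sum_(i <- r | A i) c i)%N) (\prod_(i <- r | A i) F i).
Proof.
move=> mf0 mfD HF; elim/big_rec2: _ => [|i f s Ai IH].
  by move=> m; rewrite mcoeff1; case: (eqVneq m 0%MM) => [->|]; rewrite ?mf0 ?eqxx.
apply: MI_M (HF _ Ai) IH => m1 m2 h1 h2; rewrite mfD; lia.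
Qed.

Lemma ideal_prod_sub (A : comNzRingType) (K : A -> Prop) (I : Type) (r : seq I)
    (P : pred I) (F G : I -> A) : is_ideal K ->
  (forall i, P i -> K (F i - G i)) ->
  K (\prod_(i <- r | P i) F i - \prod_(i <- r | P i) G i).
Proof.
move=> Ki FG; elim/big_rec2: _ => [|i x y Pi IH].
  by rewrite subrr; case: Ki.
have [K0 KD KM] := Ki.
have -> : F i * y - G i * x = F i * (y - x) + x * (F i - G i) by ring.
by apply: KD; apply: KM => //; apply: FG.
Qed.

Lemma sum_ord_ltn n j : (j <= n)%N -> (\sum_(a < n) (a < j) = j)%N.
Proof.
move=> jn; rewrite -(big_mkord predT (fun a => (a < j)%N : nat)) (@big_cat_nat _ _ _ j) //=.
rewrite (@eq_big_nat _ _ _ 0 j _ (fun=> 1%N)) => [|i /andP[_ ->] //].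
rewrite (@eq_big_nat _ _ _ j n _ (fun=> 0%N)) => [|i /andP[qi _]]; last by rewrite ltnNge qi.
by rewrite !sum_nat_const_nat; lia.
Qed.

Section Telescope.

Variables (k : fieldType) (N : nat) (t t' : 'I_N) (D' : {mpoly k[N]}).
Hypothesis (tt' : t != t').

Lemma mcoeff_XM (i : 'I_N) (m : 'X_{1..N}) :
  ('X_i * D')@_m = if m i == 0%N then 0 else D'@_(m - U_(i)).
Proof.
case: ifPn => [/eqP mi|mi].
  apply/eqP; rewrite mcoeff_eq0 mulrC (perm_mem (msuppMX _ _)).
  by apply/mapP => -[m' _ mE]; move: mi; rewrite mE mnmDE mnm1E eqxx.
by rewrite mulrC -{1}(@submK _ U_(i)%MM m) ?lep1mP // addmC mcoeffMX.
Qed.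

(** The sum is a coefficient of the specialisation X_t' = X_t, which kills the product. *)
Lemma telescope_coef (e : 'X_{1..N}) kap : e t = 0%N -> e t' = 0%N ->
  \sum_(i < kap.+1) (('X_t - 'X_t') * D')@_(e + U_(t) *+ i + U_(t') *+ (kap - i)) = 0.
Proof.
move=> et et'.
pose E i j := (e + U_(t) *+ i + U_(t') *+ j)%MM.
have Et i j : E i j t = i by rewrite /E !mnmDE !mulmnE !mnm1E et eqxx eq_sym (negbTE tt'); lia.
have Et' i j : E i j t' = j by rewrite /E !mnmDE !mulmnE !mnm1E et' eqxx (negbTE tt'); lia.
have St i j : (E i.+1 j - U_(t))%MM = E i j.
  by apply/mnmP => l; rewrite /E mnmBE !mnmDE !mulmnE !mnm1E; lia.
have St' i j : (E i j.+1 - U_(t'))%MM = E i j.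
  by apply/mnmP => l; rewrite /E mnmBE !mnmDE !mulmnE !mnm1E; lia.
under eq_bigr => i _ do rewrite mulrBl mcoeffB !mcoeff_XM -/(E _ _) Et Et'.
rewrite sumrB big_ord_recl /= add0r [X in _ - X]big_ord_recr /= subnn eqxx addr0.
apply/eqP; rewrite subr_eq0; apply/eqP; apply: eq_bigr => i _.
rewrite /bump leq0n add1n St /=.
have -> : (kap - i == 0)%N = false by apply/negbTE; have := ltn_ord i; lia.
by rewrite -(subnSK (ltn_ord i)) St'.
Qed.

End Telescope.

Section Residue.

Variables (k : fieldType) (d g : nat).
Hypotheses (char0 : [pchar k] =i pred0) (g_gt0 : (0 < g)%N) (g_le_d : (g <= d)%N).

Local Notation q := (d - g)%N.
Local Notation N := (d.-1).

(** The first [g] variables and the other q+1 are read as the coefficients of two polynomials in one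
    parameter, and the rank is the exponent of the parameter. The forms of fixed total rank are then
    the coefficients of the product of the two polynomials. *)
Definition slot_rank (v : 'I_d.+1) : nat := if (v < g)%N then (v : nat) else (v - g)%N.

(* The cross resultant of the slots [< q] and [>= q]; the sums of its coefficients
   along antidiagonals in a slot of each kind vanish, since it vanishes when the two
   slot variables coincide. *)
Definition disc : {mpoly k[N]} :=
  \prod_(ab : 'I_N * 'I_N | (ab.1 < q)%N && (q <= ab.2)%N) ('X_ab.1 - 'X_ab.2).

Lemma card_slots :
  (\sum_(a < N) (a < q) = q)%N /\ (\sum_(a < N) (q <= a) = g.-1)%N.
Proof.
have cardlt : (\sum_(a < N) (a < q) = q)%N by apply: sum_ord_ltn; lia.
split=> //.
have : (\sum_(a < N) (a < q) + \sum_(a < N) (q <= a) = N)%N.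
  rewrite -big_split /= (eq_bigr (fun=> 1%N)) ?sum1_card ?card_ord // => a _.
  by case: ltnP.
by rewrite cardlt; lia.
Qed.

Lemma card_pairs (t : 'I_N) :
  (\sum_(ab : 'I_N * 'I_N | (ab.1 < q)%N && (q <= ab.2)%N) (ab.1 == t) = (t < q) * g.-1)%N /\
  (\sum_(ab : 'I_N * 'I_N | (ab.1 < q)%N && (q <= ab.2)%N) (ab.2 == t) = (q <= t) * q)%N.
Proof.
have [cardlt cardge] := card_slots.
have cA (P : pred 'I_N) : #|[pred a | P a]| = (\sum_(a < N) P a)%N.
  by rewrite -sum1_card big_mkcond /=; apply: eq_bigr => a _; rewrite inE; case: (P a).
have s1 (P : pred 'I_N) : (\sum_(a < N | P a) (a == t) = P t)%N.
  rewrite big_mkcond (bigD1 t) //= eqxx big1 ?addn0; first by case: ifP.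
  by move=> a /negbTE->; rewrite if_same.
rewrite -(pair_big_dep (fun a : 'I_N => (a < q)%N) (fun _ (b : 'I_N) => (q <= b)%N)
  (fun a _ => (a == t) : nat)) /=.
rewrite -(pair_big_dep (fun a : 'I_N => (a < q)%N) (fun _ (b : 'I_N) => (q <= b)%N)
  (fun _ b => (b == t) : nat)) /=.
under eq_bigr do rewrite sum_nat_const mulnC.
rewrite -big_distrl /= s1 s1 sum_nat_const !cA cardlt cardge; split=> //.
by rewrite mulnC.
Qed.

(** The bounds g-1 and q are the largest ranks in the two blocks of variables, so every exponent of
    [disc] is the rank of a variable. *)
Lemma disc_deg (t : 'I_N) : MI (fun m => (m t <= if (t < q)%N then g.-1 else q)%N) disc.
Proof.
apply: MI_S (@MI_prod_le N k (fun m => m t) _ _ _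
  (fun ab : 'I_N * 'I_N => (ab.1 == t) + (ab.2 == t))%N (fun ab => 'X_ab.1 - 'X_ab.2) _ _ _).
- move=> m le; apply: leq_trans le _; rewrite big_split /=.
  by have [-> ->] := card_pairs t; case: ltnP; lia.
- by rewrite mnm0E.
- by move=> m1 m2; rewrite mnmDE.
- move=> [a b] /= _; apply: MI_B; apply: MI_X; rewrite mnm1E; lia.
Qed.

Lemma disc_factor (t t' : 'I_N) : (t < q)%N -> (q <= t')%N ->
  exists D', disc = ('X_t - 'X_t') * D'.
Proof. by move=> tq qt'; rewrite /disc (bigD1 (t, t')) /= ?tq ?qt' //; eexists. Qed.

Lemma disc_sum (t t' : 'I_N) (e : 'X_{1..N}) kap : (t < q)%N -> (q <= t')%N ->
  e t = 0%N -> e t' = 0%N ->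
  \sum_(vw : 'I_d.+1 * 'I_d.+1 | [&& (vw.1 < g)%N, (g <= vw.2)%N & slot_rank vw.1 + slot_rank vw.2 == kap]%N)
     disc@_(e + U_(t) *+ slot_rank vw.1 + U_(t') *+ slot_rank vw.2) = 0.
Proof.
move=> tq qt' et et'.
have tt' : t != t' by apply: contraTneq tq => ->; rewrite -leqNgt.
have [D' DE] := disc_factor tq qt'.
rewrite -[RHS](telescope_coef D' tt' kap et et') -DE.
rewrite (partition_big (fun vw => inord (slot_rank vw.1) : 'I_kap.+1) predT) //=.
apply: eq_bigr => i _.
(* Splittings of [kap] that no pair of variables realises contribute zero by the degree bounds. *)
have [ig|ig] := boolP ((i < g)%N && (kap - i <= q)%N); last first.
  rewrite big1 => [|[v w] /=].
    apply/esym/eqP; apply: contraNT ig => nz; have /= h1 := disc_deg t nz.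
    have /= := disc_deg t' nz; move: h1.
    rewrite !mnmDE !mulmnE !mnm1E et et' !eqxx eq_sym (negbTE tt') tq ltnNge qt' /=.
    lia.
  case/andP => /and3P[vg gw /eqP rkE] /eqP iE.
  have iE' : i = slot_rank v :> nat by rewrite -iE inordK // ltnS -rkE leq_addr.
  have rv : slot_rank v = v by rewrite /slot_rank vg.
  have rw : slot_rank w = (w - g)%N by rewrite /slot_rank ltnNge gw.
  by case/negP: ig; have := ltn_ord w; move: iE' rkE; rewrite rv rw; lia.
case/andP: ig => ig iq.
have iltd : (i < d.+1)%N by lia.
have jltd : (g + (kap - i) < d.+1)%N by lia.
rewrite (big_pred1 (Ordinal iltd, Ordinal jltd)) /=.
  by rewrite /slot_rank /= ig ltnNge leq_addr /= addKn.
move=> [v w] /=; apply/idP/idP.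
  case/andP => /and3P[vg gw /eqP rkE] /eqP iE.
  have iE' : i = slot_rank v :> nat by rewrite -iE inordK // ltnS -rkE leq_addr.
  rewrite xpair_eqE; apply/andP; split; apply/eqP/val_inj => /=.
    by rewrite iE' /slot_rank vg.
  by move: rkE iE'; rewrite /slot_rank vg ltnNge gw /=; lia.
rewrite xpair_eqE => /andP[/eqP-> /eqP->] /=.
rewrite ig leq_addr /= /slot_rank /= ig ltnNge leq_addr /= addKn.
have -> : (i + (kap - i) = kap)%N by have := ltn_ord i; lia.
by rewrite eqxx inord_val /=.
Qed.

Definition slots (phi : {ffun 'I_N -> 'I_d.+1}) : bool :=
  [forall t : 'I_N, (t < q)%N == (phi t < g)%N].

Definition smon (phi : {ffun 'I_N -> 'I_d.+1}) : 'X_{1..d.+1} := (\sum_t U_(phi t))%MM.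

Definition sdisc (phi : {ffun 'I_N -> 'I_d.+1}) : k :=
  disc@_[multinom slot_rank (phi t) | t < N].

Definition mfac n (m : 'X_{1..n}) : nat := (\prod_i (m i)`!)%N.

Lemma mfac1 n (m : 'X_{1..n}) i : mfac (m + U_(i))%MM = (mfac m * (m i).+1)%N.
Proof.
rewrite /mfac (bigD1 i) //= [in RHS](bigD1 i) //= mnmDE mnm1E eqxx addn1 factS.
rewrite (eq_bigr (fun j => (m j)`!)); first by lia.
by move=> j ji; rewrite mnmDE mnm1E eq_sym (negbTE ji) addn0.
Qed.

(* Symmetrises [disc] over all ways of filling the slots with the variables of [c];
   it vanishes on the multiples of the forms [\sum_(rk v + rk w = kap) X_v X_w]. *)
Definition lam (c : 'X_{1..d.+1}) : k :=
  (mfac c)%:R * \sum_(phi | slots phi && (smon phi == c)) sdisc phi.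

Lemma smonE phi v : smon phi v = (\sum_t (phi t == v))%N.
Proof. by rewrite /smon mnm_sumE; apply: eq_bigr => t _; rewrite mnm1E. Qed.

(** With the other slots fixed, the contents of t and t' run through an antidiagonal, and [disc_sum]
    applies. *)
Lemma slots_sum (t t' : 'I_N) (mu : 'X_{1..d.+1}) kap : (t < q)%N -> (q <= t')%N ->
  \sum_(phi | slots phi && ((slot_rank (phi t) + slot_rank (phi t') == kap)%N &&
      (smon phi == mu + U_(phi t) + U_(phi t')))%MM) sdisc phi = 0.
Proof.
move=> tq qt'.
have tt' : t != t' by apply: contraTneq tq => ->; rewrite -leqNgt.
pose upd (phi : {ffun 'I_N -> 'I_d.+1}) (vw : 'I_d.+1 * 'I_d.+1) :=
  [ffun s => if s == t then vw.1 else if s == t' then vw.2 else phi s].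
(* Fillings are grouped by their contents outside t and t'; the representative has the first and the
   last variable there. *)
rewrite (partition_big (fun phi => upd phi (ord0, ord_max)) predT) //= big1 // => rho _.
have [rhoE|rhoE] := eqVneq (upd rho (ord0, ord_max)) rho; last first.
  apply: big1 => phi /andP[_ /eqP pE]; case/eqP: rhoE; rewrite -pE.
  by apply/ffunP => s; rewrite /upd !ffunE; case: (s == t) => //; case: (s == t').
have rt : rho t = ord0 by rewrite -rhoE ffunE eqxx.
have rt' : rho t' = ord_max by rewrite -rhoE ffunE eqxx eq_sym (negbTE tt').
pose rest := (\sum_(s | (s != t) && (s != t')) U_(rho s))%MM.
pose ok := [forall s, (s != t) && (s != t') ==> ((s < q)%N == (rho s < g)%N)] && (rest == mu).
pose e : 'X_{1..N} := [multinom if (s == t) || (s == t') then 0%N else slot_rank (rho s) | s < N].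
have updt vw : upd rho vw t = vw.1 by rewrite ffunE eqxx.
have updt' vw : upd rho vw t' = vw.2 by rewrite ffunE eq_sym (negbTE tt') eqxx.
rewrite (reindex_onto (upd rho) (fun phi => (phi t, phi t'))) /=; last first.
  move=> phi /andP[_ /eqP <-]; apply/ffunP => s; rewrite !ffunE /=.
  by have [->//|st] := eqVneq s t; have [->|st'] := eqVneq s t'.
have smonU vw : smon (upd rho vw) = (rest + U_(vw.1) + U_(vw.2))%MM.
  rewrite /smon (bigD1 t) //= (bigD1 t') /=; last by rewrite eq_sym.
  rewrite updt updt' addmA addmC addmA /rest; congr (_ + _ + _)%MM.
  by apply: eq_bigr => s /andP[st st']; rewrite ffunE (negbTE st) (negbTE st').
have slotsU vw : slots (upd rho vw) =
    [&& (vw.1 < g)%N, (g <= vw.2)%N &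
      [forall s, (s != t) && (s != t') ==> ((s < q)%N == (rho s < g)%N)]].
  apply/forallP/and3P => [H|[h1 h2 /forallP h3] s].
    split.
    - by have := H t; rewrite updt tq => /eqP <-.
    - have /eqP := H t'; rewrite updt' => h; rewrite leqNgt -h -leqNgt //.
    - apply/forallP => s; apply/implyP => /andP[st st'].
      by have := H s; rewrite ffunE (negbTE st) (negbTE st').
  rewrite ffunE; have [->|st] := eqVneq s t; first by rewrite tq h1.
  have [->|st'] := eqVneq s t'; first by rewrite ltnNge qt' ltnNge h2.
  by have := h3 s; rewrite st st'.
have [okT|okF] := boolP ok; last first.
  rewrite big1 // => vw /andP[/andP[/and3P[sU _ mU] _] _]; case/negP: okF.
  rewrite /ok; move: sU; rewrite slotsU => /and3P[_ _ ->] /=.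
  move: mU; rewrite smonU updt updt' => /eqP H.
  by apply/eqP; apply: (@addIm _ U_(vw.1)%MM); apply: (@addIm _ U_(vw.2)%MM).
rewrite -[RHS](@disc_sum t t' e kap tq qt'); last 2 first.
- by rewrite mnmE eqxx.
- by rewrite mnmE eqxx orbT.
case/andP: okT => ok1 /eqP ok2.
apply: eq_big => [vw|vw _].
  rewrite slotsU smonU updt updt' ok1 ok2 eqxx !andbT.
  case: (_ < g)%N; case: (g <= _)%N => //=; case: (_ == kap)%N => //=.
  apply/andP; split; apply/eqP; last by case: vw.
  rewrite -[RHS]rhoE /upd; apply/ffunP => s; rewrite !ffunE.
  by case: (s == t) => //; case: (s == t').
rewrite /sdisc; congr (_@__); apply/mnmP => s.
rewrite mnmE !mnmDE !mulmnE !mnm1E mnmE.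
have [->|st] := eqVneq s t; first by rewrite updt [t' == t]eq_sym (negbTE tt') /=; lia.
have [->|st'] := eqVneq s t'; first by rewrite updt' /=; lia.
by rewrite ffunE (negbTE st) (negbTE st') /=; lia.
Qed.

(** The factorials in [lam] turn a sum over fillings into a sum over fillings with a marked slot
    containing v and a marked slot containing w. For fixed marked slots this is [slots_sum]. *)
Lemma lam_sum (mu : 'X_{1..d.+1}) kap :
  \sum_(vw : 'I_d.+1 * 'I_d.+1 | [&& (vw.1 < g)%N, (g <= vw.2)%N & slot_rank vw.1 + slot_rank vw.2 == kap]%N)
     lam (mu + U_(vw.1) + U_(vw.2))%MM = 0.
Proof.
pose cond (vw : 'I_d.+1 * 'I_d.+1) := [&& (vw.1 < g)%N, (g <= vw.2)%N & slot_rank vw.1 + slot_rank vw.2 == kap]%N.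
pose G (vw : 'I_d.+1 * 'I_d.+1) (phi : {ffun 'I_N -> 'I_d.+1}) (t t' : 'I_N) : k :=
  if [&& cond vw, slots phi, (smon phi == mu + U_(vw.1) + U_(vw.2))%MM, phi t == vw.1 & phi t' == vw.2]
  then sdisc phi else 0.
have lamE vw : (if cond vw then lam (mu + U_(vw.1) + U_(vw.2))%MM else 0) =
    (mfac mu)%:R * \sum_phi \sum_t \sum_t' G vw phi t t'.
  rewrite /G; case: ifP => [/and3P[vg gw _]|_]; last first.
    by rewrite big1 ?mulr0 // => phi _; rewrite big1 // => t _; rewrite big1.
  have vw12 : vw.1 != vw.2 by apply: contraTneq vg => ->; rewrite -leqNgt.
  rewrite /lam !mfac1 !natrM -!mulrA; congr (_ * _).
  rewrite mulrA -natrM mulr_sumr big_mkcond /=; apply: eq_bigr => phi _.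
  case: (slots phi) => //=; last by rewrite big1 // => t _; rewrite big1.
  case: eqP => [sE|_] /=; last by rewrite big1 // => t _; rewrite big1.
  have -> : (mu vw.1).+1 = (\sum_t (phi t == vw.1))%N.
    by rewrite -smonE sE !mnmDE !mnm1E eqxx eq_sym (negbTE vw12); lia.
  have -> : ((mu + U_(vw.1))%MM vw.2).+1 = (\sum_t (phi t == vw.2))%N.
    by rewrite -smonE sE !mnmDE !mnm1E eqxx (negbTE vw12); lia.
  rewrite natrM !natr_sum mulr_suml mulr_suml; apply: eq_bigr => t _.
  rewrite mulr_sumr mulr_suml; apply: eq_bigr => t' _.
  by case: (phi t == _); case: (phi t' == _); rewrite /= ?mul0r ?mulr0 ?mul0r ?mul1r.
rewrite big_mkcond /= (eq_bigr _ (fun vw _ => lamE vw)) -mulr_sumr.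
suff -> : \sum_vw \sum_phi \sum_t \sum_t' G vw phi t t' = 0 by rewrite mulr0.
rewrite exchange_big /=; under eq_bigr => phi _ do rewrite exchange_big /=.
rewrite exchange_big /= big1 // => t _.
under eq_bigr => phi _ do rewrite exchange_big /=.
rewrite exchange_big /= big1 // => t' _.
have [/andP[tq qt']|ntt'] := boolP ((t < q) && (q <= t'))%N.
  rewrite -[RHS](@slots_sum t t' mu kap tq qt') [RHS]big_mkcond; apply: eq_bigr => phi _.
  rewrite (bigD1 (phi t, phi t')) //= big1 ?addr0 => [|[v w] /= nvw]; last first.
    rewrite /G /=; case: ifP => // /and5P[_ _ _ /eqP vE /eqP wE].
    by move: nvw; rewrite -vE -wE eqxx.
  rewrite /G /cond /= !eqxx !andbT; case: (boolP (slots phi)) => sl /=; last by rewrite andbF.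
  have /eqP <- := forallP sl t; have /eqP h := forallP sl t'.
  by rewrite tq [(g <= _)%N]leqNgt -h -leqNgt qt'.
rewrite big1 // => phi _; rewrite big1 // => -[v w] _; rewrite /G /cond /=.
case: ifP => // /and5P[/and3P[vg gw _] sl _ /eqP vE /eqP wE].
case/negP: ntt'; move: vg gw; rewrite -vE -wE.
have /eqP <- := forallP sl t; have /eqP h := forallP sl t'.
by rewrite [(g <= _)%N]leqNgt -h -leqNgt => -> ->.
Qed.

(** Modulo the variables of the first block only the product of the -X_b survives, so the
    coefficient is a sign. *)
Lemma disc_top : sdisc [ffun t : 'I_N => if (t < q)%N then ord0 else ord_max] != 0.
Proof.
rewrite /sdisc; set m0 := [multinom _ | t < N].
have m0E t : m0 t = if (t < q)%N then 0%N else q.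
  by rewrite mnmE ffunE; case: ifP => _; rewrite /slot_rank /= ?g_gt0 // ltnNge g_le_d.
pose P (m : 'X_{1..N}) := exists2 a : 'I_N, (a < q)%N & m a != 0%N.
have Pid : is_ideal (@MI N k P).
  by apply: MI_ideal => m m' [a aq ma]; exists a => //; rewrite mnmDE; lia.
have := @ideal_prod_sub _ _ _ (index_enum _)
  (fun ab : 'I_N * 'I_N => (ab.1 < q)%N && (q <= ab.2)%N) (fun ab => 'X_ab.1 - 'X_ab.2)
  (fun ab => - 'X_ab.2) Pid.
rewrite -/disc => H.
have -> : disc@_m0 = (\prod_(ab : 'I_N * 'I_N | (ab.1 < q)%N && (q <= ab.2)%N) (- 'X_ab.2 : {mpoly k[N]}))@_m0.
  apply/eqP; rewrite -subr_eq0 -mcoeffB; apply/negPn/negP => /H [].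
    move=> [a b] /= /andP[aq qb]; rewrite opprK subrK; apply: MI_X; exists a => //.
    by rewrite mnm1E eqxx.
  by move=> a aq; rewrite m0E aq.
rewrite prodrN /=; set j := (X in (-1) ^+ X).
have mE : (\sum_(ab : 'I_N * 'I_N | (ab.1 < q)%N && (q <= ab.2)%N) U_(ab.2))%MM = m0.
  apply/mnmP => t; rewrite m0E mnm_sumE.
  rewrite (eq_bigr (fun ab : 'I_N * 'I_N => (ab.2 == t) : nat)) => [|ab _]; last by rewrite mnm1E.
  by have [_ ->] := card_pairs t; case: ltnP; rewrite ?mul1n ?mul0n.
rewrite mprodXE mE -signr_odd; case: (odd j).
  by rewrite expr1 mulN1r mcoeffN mcoeffX eqxx oppr_eq0 oner_eq0.
by rewrite expr0 mul1r mcoeffX eqxx oner_eq0.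
Qed.

Definition topmon : 'X_{1..d.+1} := (U_(ord0) *+ q + U_(ord_max) *+ g.-1)%MM.

(** Exactly one filling produces this monomial. *)
Lemma lam_top : lam topmon != 0.
Proof.
have nd : (ord0 == ord_max :> 'I_d.+1) = false by apply/negbTE/eqP => /(congr1 val) /=; lia.
have nzn j : (0 < j)%N -> j%:R != 0 :> k.
  by move=> j0; rewrite (proj1 (pcharf0P k) char0) -lt0n.
rewrite /lam mulf_neq0 //; first by rewrite nzn // /mfac prodn_gt0 // => i; exact: fact_gt0.
pose phi0 := [ffun t : 'I_N => if (t < q)%N then ord0 else ord_max : 'I_d.+1].
rewrite (big_pred1 phi0) ?disc_top // => phi /=; apply/idP/eqP => [/andP[sl /eqP sE]|->].
  apply/ffunP => t; rewrite ffunE; have /eqP slt := forallP sl t.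
  have : smon phi (phi t) != 0%N.
    by rewrite smonE (bigD1 t) //= eqxx.
  rewrite sE /topmon !mnmDE !mulmnE !mnm1E; move: slt.
  have [<-|n1] := eqVneq ord0 (phi t); first by rewrite /= g_gt0 => ->.
  have [<-|n2] := eqVneq ord_max (phi t); last by rewrite !mul0n.
  by rewrite /= [(d < g)%N]ltnNge g_le_d => ->.
have [cardlt cardge] := card_slots.
apply/andP; split.
  apply/forallP => t; rewrite ffunE; case: ifP => _; rewrite /= ?g_gt0 //.
  by rewrite ltnNge g_le_d.
apply/eqP/mnmP => v; rewrite smonE /topmon !mnmDE !mulmnE !mnm1E.
have -> : (\sum_t (phi0 t == v) = (\sum_(t < N) (t < q)) * (ord0 == v) + (\sum_(t < N) (q <= t)) * (ord_max == v))%N.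
  rewrite !big_distrl -big_split; apply: eq_bigr => t _ /=; rewrite ffunE.
  by case: ltnP => _; rewrite ?mul1n ?mul0n ?addn0.
by rewrite cardlt cardge; lia.
Qed.

End Residue.

Section MonomialFunctional.

Variables (n : nat) (k : comNzRingType) (V : lmodType k) (l : 'X_{1..n} -> V).

Definition mlin (G : {mpoly k[n]}) : V := \sum_(m <- msupp G) G@_m *: l m.

Lemma mlinE G i : (msize G <= i)%N ->
  mlin G = \sum_(m : 'X_{1..n < i}) G@_m *: l m.
Proof.
move=> le_Gi; set I : subFinType _ := 'X_{1..n < i}.
rewrite /mlin (big_mksub I) ?msupp_uniq //=; first last.
  by move=> x /msize_mdeg_lt /leq_trans; apply.
by rewrite big_rmcond //= => j /memN_msupp_eq0 ->; rewrite scale0r.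
Qed.

Lemma mlin_is_linear : linear mlin.
Proof.
move=> c f h; pose i := maxn (msize (c *: f + h)) (maxn (msize f) (msize h)).
rewrite !(@mlinE _ i) ?leq_max ?leqnn ?orbT // scaler_sumr -big_split /=.
by apply: eq_bigr => m _; rewrite mcoeffD mcoeffZ scalerDl scalerA.
Qed.

HB.instance Definition _ :=
  GRing.isLinear.Build k {mpoly k[n]} V _ mlin mlin_is_linear.

Lemma mlinX m : mlin 'X_[m] = l m.
Proof. by rewrite /mlin msuppX big_seq1 mcoeffX eqxx scale1r. Qed.

Lemma mlin_eq0 (Q : {mpoly k[n]}) : (forall m, mlin (Q * 'X_[m]) = 0) ->
  forall G, mlin (Q * G) = 0.
Proof.
move=> H G; rewrite [G]mpolyE mulr_sumr raddf_sum big1 //= => m _.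
by rewrite -scalerAr linearZ /= H scaler0.
Qed.

End MonomialFunctional.

(** * Determinants: triangularity, Cramer's rule, independence of the transition matrix *)

Lemma det_rank_trig (R : comNzRingType) n (o : 'I_n -> nat) (A : 'M[R]_n) :
  injective o -> (forall i j, A i j != 0 -> (o i <= o j)%N) ->
  \det A = \prod_i A i i.
Proof.
move=> o_inj Ao; rewrite /determinant (bigD1 (1%g : 'S_n)) //= odd_perm1 expr0 mul1r.
rewrite [X in X + _](eq_bigr (fun i => A i i)) => [|i _]; last by rewrite perm1.
rewrite [X in _ + X]big1 ?addr0 // => s s1.
suff [i /eqP Ai] : exists i, A i (s i) == 0.
  by rewrite (bigD1 i) //= Ai mul0r mulr0.
apply/existsP; apply: contraR s1 => /existsPn nz; apply/eqP/permP => i.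
rewrite perm1.
(* A permutation with a nonzero term lowers no rank, and the total of the ranks is preserved; hence
   it is the identity. *)
have le j : (o j <= o (s j))%N by apply: Ao; apply: nz.
have sumE : (\sum_j o (s j) = \sum_j o j)%N.
  by rewrite [RHS](reindex_inj (@perm_inj _ s)).
apply: o_inj; apply/eqP; rewrite eqn_leq le andbT leqNgt; apply/negP => lti.
suff : (\sum_j o j < \sum_j o (s j))%N by rewrite sumE ltnn.
rewrite (bigD1 i) //= [ltnRHS](bigD1 i) //= -addSn leq_add //.
exact: leq_sum.
Qed.

Lemma det_replace_row (S : comNzRingType) n (M : 'M[S]_n) (H : 'I_n -> S) i :
  \det (\matrix_(a, l) if a == i then H l else M a l) = \sum_l H l * \adj M l i.
Proof.
rewrite (expand_det_row _ i); apply: eq_bigr => l _; rewrite !mxE eqxx; congr (_ * _).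
congr (_ * \det _); apply/matrixP => a b; rewrite !mxE.
by rewrite eq_sym (negbTE (neq_lift i a)).
Qed.

Lemma cramer_row (S : comNzRingType) n (M : 'M[S]_n) (H z F : 'I_n -> S) :
  (forall i, F i = \sum_l M i l * z l) ->
  (\sum_l H l * z l) * \det M =
    \sum_i \det (\matrix_(a, l) if a == i then H l else M a l) * F i.
Proof.
move=> FE; rewrite mulr_suml.
under [RHS]eq_bigr => i _ do rewrite det_replace_row mulr_suml.
rewrite exchange_big /=; apply: eq_bigr => l _; rewrite -mulrA.
under eq_bigr => i _ do rewrite -mulrA.
rewrite -mulr_sumr; congr (_ * _).
have /(congr1 (fun C => (C *m \col_j z j) l 0)) := mul_adj_mx M.
rewrite mul_scalar_mx -mulmxA [RHS]mxE mxE [in RHS]mxE mulrC => <-.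
apply: eq_bigr => i _; congr (_ * _); rewrite mxE FE; apply: eq_bigr => j _.
by rewrite !mxE.
Qed.

Section DetIndep.

Variables (S : comNzRingType) (n : nat) (zeta Q : 'I_n -> S) (K : S -> Prop).
Hypotheses (Kid : is_ideal K) (KQ : forall l, K (Q l)).

(** Cramer's rule for M with its i-th row replaced by the m-th unit vector: applied to [zeta] this
    matrix gives Q outside row i, and [zeta m] in row i. *)
Lemma cofactor_koszul (M : 'M[S]_n) i l m :
  (forall j, j != i -> \sum_h M j h * zeta h = Q j) ->
  K (zeta m * cofactor M i l - zeta l * cofactor M i m).
Proof.
move=> Mz; pose M' : 'M[S]_n := \matrix_(a, b) if a == i then (b == m)%:R else M a b.
have cofE b : cofactor M' i b = cofactor M i b.
  congr (_ * \det _); apply/matrixP => a c; rewrite !mxE.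
  by rewrite eq_sym (negbTE (neq_lift i a)).
have detM' : \det M' = cofactor M i m.
  rewrite (expand_det_row _ i) (bigD1 m) //= big1 ?addr0 => [|b bm].
    by rewrite mxE !eqxx mul1r cofE.
  by rewrite mxE eqxx (negbTE bm) mul0r.
have := mul_adj_mx M' => /(congr1 (fun B => (B *m \col_h zeta h) l 0)).
rewrite mul_scalar_mx -mulmxA [RHS]mxE mxE [in RHS]mxE detM' => E.
rewrite [zeta l * _]mulrC -E (bigD1 i) //= !mxE.
rewrite (bigD1 m) //= !mxE !eqxx mul1r big1 ?addr0 => [|b bm]; last first.
  by rewrite !mxE eqxx (negbTE bm) mul0r.
rewrite cofE mulrC opprD addrA subrr sub0r.
apply: ideal_opp => //; apply: ideal_sum => // j ji.
have [_ _ KM] := Kid; apply: KM; rewrite mxE.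
under eq_bigr => h _ do rewrite !mxE (negbTE ji).
by rewrite Mz.
Qed.

Hypothesis zeta_reg : forall l f (b : 'I_n -> S),
  zeta l * f = \sum_(m < n | (m < l)%N) b m * zeta m ->
  exists b', f = \sum_(m < n | (m < l)%N) b' m * zeta m.

(** Syzygies of a regular sequence are generated by the Koszul ones, and those are sent into K by
    assumption. The induction removes the last nonzero coefficient. *)
Lemma syzygy_mem (C gam : 'I_n -> S) :
  (forall l m, K (zeta m * C l - zeta l * C m)) ->
  \sum_l gam l * zeta l = 0 -> K (\sum_l gam l * C l).
Proof.
move=> KC gz; have [K0 KD KM] := Kid.
suff H r : forall gam : 'I_n -> S, (forall l : 'I_n, (r <= l)%N -> gam l = 0) ->
    \sum_l gam l * zeta l = 0 -> K (\sum_l gam l * C l).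
  by apply: (H n) => // l; rewrite leqNgt ltn_ord.
elim: r => [|r IH] {gam gz} gam g0 gz.
  by rewrite big1 // => l _; rewrite g0 ?mul0r.
have [rn|nr] := ltnP r n; last first.
  by apply: IH => // l rl; have := ltn_ord l; lia.
pose e := Ordinal rn.
have big_e (F : 'I_n -> S) : (forall l : 'I_n, (r < l)%N -> F l = 0) ->
    \sum_l F l = F e + \sum_(l < n | (l < e)%N) F l.
  move=> F0; rewrite (bigD1 e) //=; congr (_ + _).
  rewrite [LHS]big_mkcond [RHS]big_mkcond; apply: eq_bigr => l _.
  have [ll|ll|/val_inj ll] := ltngtP l e.
  - by rewrite (_ : l != e) //; apply: contraTneq ll => ->; rewrite ltnn.
  - by rewrite (F0 _ ll) if_same.
  - by rewrite ll eqxx.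
have [|b bE] := @zeta_reg e (gam e) (fun m => - gam m).
  move: gz; rewrite big_e => [|l rl]; last by rewrite g0 ?mul0r.
  rewrite mulrC => /eqP; rewrite addr_eq0 => /eqP ->; rewrite -sumrN.
  by apply: eq_bigr => l _; rewrite mulNr.
pose gam' (l : 'I_n) := if (l < e)%N then gam l + b l * zeta e else 0.
have g'0 (l : 'I_n) : (r <= l)%N -> gam' l = 0.
  by rewrite /gam' /= ltnNge => ->.
have sE (D : 'I_n -> S) : \sum_l gam l * D l = \sum_l gam' l * D l +
    \sum_(l < n | (l < e)%N) b l * (zeta l * D e - zeta e * D l).
  rewrite !big_e => [|l rl|l rl]; last 2 first.
  - by rewrite g'0 ?mul0r // ltnW.
  - by rewrite g0 ?mul0r.
  rewrite g'0 // mul0r add0r -big_split /= bE mulr_suml -big_split /=.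
  by apply: eq_bigr => l le; rewrite /gam' le; ring.
rewrite sE; apply: KD.
  apply: IH => //; move: gz; rewrite sE [X in _ + X]big1 ?addr0 // => l _.
  by rewrite [zeta l * _]mulrC subrr mulr0.
by apply: ideal_sum => // l _; apply: KM.
Qed.

(** Rows of A are exchanged for rows of B one at a time; the difference of two such rows is a syzygy
    of [zeta], paired with cofactors. *)
Lemma det_indep (A B : 'M[S]_n) :
  (forall j, \sum_h A j h * zeta h = Q j) ->
  (forall j, \sum_h B j h * zeta h = Q j) -> K (\det A - \det B).
Proof.
move=> Az Bz; have [K0 KD KM] := Kid.
pose M r : 'M[S]_n := \matrix_(i, j) if (i < r)%N then B i j else A i j.
have M0 : M 0%N = A by apply/matrixP => i j; rewrite mxE.
have Mn : M n = B by apply/matrixP => i j; rewrite mxE ltn_ord.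
suff H r : (r <= n)%N -> K (\det A - \det (M r)) by rewrite -Mn; apply: H.
elim: r => [_|r IH rn]; first by rewrite M0 subrr.
have -> : \det A - \det (M r.+1) = (\det A - \det (M r)) + (\det (M r) - \det (M r.+1)) by ring.
apply: KD; first by apply: IH; apply: ltnW.
pose i := Ordinal rn.
have Mz s j : \sum_h M s j h * zeta h = Q j.
  by case js: (j < s)%N; under eq_bigr => h _ do rewrite mxE js.
rewrite (expand_det_row (M r) i) (expand_det_row (M r.+1) i).
have cofE h : cofactor (M r.+1) i h = cofactor (M r) i h.
  congr (_ * \det _); apply/matrixP => a c; rewrite !mxE.
  have /negbTE := neq_lift i a; rewrite -val_eqE /= => ia.
  by rewrite ltnS leq_eqVlt eq_sym ia.
under [X in _ - X]eq_bigr => h _ do rewrite cofE.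
rewrite -sumrB; under eq_bigr => h _ do rewrite -mulrBl.
apply: syzygy_mem.
  by move=> l m; apply: cofactor_koszul => j _; apply: Mz.
under eq_bigr => h _ do rewrite mulrBl.
by rewrite sumrB !Mz subrr.
Qed.

End DetIndep.

Section ResidueFunctional.

Variables (k : fieldType) (d g : nat).
Hypotheses (char0 : [pchar k] =i pred0) (g_gt0 : (0 < g)%N) (g_le_d : (g <= d)%N).

Local Notation q := (d - g)%N.
Local Notation S := {mpoly k[d.+1]}.
Local Notation rk := (@slot_rank d g).
Local Notation xv := (widen_ord (leqnSn d)).

(** The additional factor at l = 0 anticipates the lift from R. For the column weights to add up to
    om (q+1), the first column takes one unit of weight, which leaves x_1 with a surplus of one. *)
Definition zmon (l : 'I_d) : 'X_{1..d.+1} :=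
  if l == 0%N :> nat then (U_(xv l) + U_(ord_max))%MM else U_(xv l)%MM.

Definition zeta (l : 'I_d) : S := 'X_[zmon l].

(** Assigns an antidiagonal to each row such that the transition matrix [Psi0] is triangular. *)
Definition kap (l : nat) : nat := if (l < g)%N then (q + l)%N else (l - g)%N.

Lemma kap_inj (l l' : 'I_d) : kap l = kap l' -> l = l'.
Proof.
move=> E; apply/ord_inj; have ll := ltn_ord l; have ll' := ltn_ord l'.
by move: E; rewrite /kap; case: (ltnP l g); case: (ltnP l' g); lia.
Qed.

Lemma zmon_disj (l m : 'I_d) v : (m < l)%N -> zmon m v != 0%N -> zmon l v = 0%N.
Proof.
move=> ml; rewrite /zmon; have -> : (l == 0%N :> nat) = false by apply/negbTE; rewrite -lt0n; lia.
have dm j : (ord_max == xv j) = false by apply/negbTE; rewrite -val_eqE /= neq_ltn ltn_ord orbT.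
rewrite !mnm1E; have [<-|//] := eqVneq (xv l) v; case: ifP => _.
  by rewrite mnmDE !mnm1E dm addn0 -val_eqE /= (ltn_eqF ml).
by rewrite mnm1E -val_eqE /= (ltn_eqF ml).
Qed.

Lemma zeta_reg l (f : S) (b : 'I_d -> S) :
  zeta l * f = \sum_(m < d | (m < l)%N) b m * zeta m ->
  exists b', f = \sum_(m < d | (m < l)%N) b' m * zeta m.
Proof.
move=> E; pose P (mu : 'X_{1..d.+1}) := exists2 m : 'I_d, (m < l)%N & (zmon m <= mu)%MM.
have Pf : MI P (zeta l * f).
  rewrite E; apply: MI_sum => m ml.
  have uP : upc P.
    by move=> m1 m2 [a al le]; exists a => //; apply: lepm_trans le (lem_addl _ _).
  have [_ _ PM] := @MI_ideal d.+1 k P uP; apply: PM.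
  by apply: MI_X; exists m => //; apply: lepm_refl.
have {}Pf : MI P f.
  move=> mu nz; have [|m ml /mnm_lepP le] := Pf (zmon l + mu)%MM.
    by rewrite mulrC mcoeffMX.
  exists m => //; apply/mnm_lepP => v; have := le v; rewrite mnmDE.
  by have [-> //|/(zmon_disj ml)->] := eqVneq (zmon m v) 0%N.
move: f {E} Pf; apply: MI_ind.
- by exists (fun=> 0); rewrite big1 // => m _; rewrite mul0r.
- move=> f h [b1 ->] [b2 ->]; exists (fun m => b1 m + b2 m).
  by rewrite -big_split; apply: eq_bigr => m _; rewrite mulrDl.
- move=> c mu [m ml le]; exists (fun m' => if m' == m then c *: 'X_[mu - zmon m] else 0).
  rewrite (bigD1 m) //= eqxx big1 => [|m' /andP[_ /negbTE ->]]; last by rewrite mul0r.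
  by rewrite addr0 -scalerAl -mpolyXD submK.
Qed.

Section Power.

Variable c : nat.
Hypothesis c_gt0 : (0 < c)%N.

(** The functional [lam] after the substitution of c-th powers. S is free over the polynomials in
    c-th powers, and only the top basis element, with all exponents c-1, is seen. *)
Definition lamc (nu : 'X_{1..d.+1}) : k^o :=
  if [forall i, (nu i %% c == c.-1)%N] then lam k g [multinom (nu i %/ c)%N | i < d.+1]
  else 0.

Definition cpow (nu : 'X_{1..d.+1}) : 'X_{1..d.+1} := [multinom (nu i * c + c.-1)%N | i < d.+1].

Lemma lamc_cpow nu : lamc (cpow nu) = lam k g nu.
Proof.
rewrite /lamc; case: ifPn => [_|/negP[]].
  congr lam; apply/mnmP => i; rewrite !mnmE divnMDl //.
  by rewrite divn_small ?addn0 //; lia.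
by apply/forallP => i; rewrite mnmE modnMDl modn_small //; lia.
Qed.

Definition T0 : 'I_d.+1 := ord0.
Definition pairs (l : nat) (vw : 'I_d.+1 * 'I_d.+1) : bool :=
  [&& (vw.1 < g)%N, (g <= vw.2)%N & rk vw.1 + rk vw.2 == l]%N.

Definition Qc (l : 'I_d) : S :=
  \sum_(vw | pairs (kap l) vw) 'X_(vw.1) ^+ c * 'X_(vw.2) ^+ c.

Lemma mlin_Qc l (h : S) : mlin lamc (Qc l * h) = 0.
Proof.
apply: mlin_eq0 => mu; rewrite /Qc mulr_suml raddf_sum /=.
under eq_bigr => vw _ do rewrite !mpolyXn -!mpolyXD mlinX.
have [/forallP H|H] := boolP [forall i, (mu i %% c == c.-1)%N]; last first.
  rewrite big1 // => vw _; rewrite /lamc; case: ifP => // /forallP H'.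
  case/negP: H; apply/forallP => i; have := H' i; rewrite !mnmDE !mulmnE.
  by rewrite -addnA modnMDl modnMDl.
pose mu' : 'X_{1..d.+1} := [multinom (mu i %/ c)%N | i < d.+1].
rewrite -[RHS](lam_sum k g_gt0 g_le_d mu' (kap l)); apply: eq_bigr => vw _.
rewrite -lamc_cpow; congr lamc; apply/mnmP => i.
rewrite !mnmDE !mulmnE [RHS]mnmE !mnmDE /mu' mnmE; have /eqP E := H i.
by rewrite {1}(divn_eq (mu i) c) E !mulnDl; lia.
Qed.

(** A product X_v^c X_w^c is divided by X_v if v > 0. For v = 0 it is divided by X_w, or by X_0 X_w
    when w is the extra variable. *)
Definition Psi0 : 'M[S]_d := \matrix_(l, l')
  if l' == 0%N :> nat then (l == 0%N :> nat)%:R * ('X_(xv l') ^+ c.-1 * 'X_ord_max ^+ c.-1)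
  else if (l' < g)%N then
    \sum_(w : 'I_d.+1 | (g <= w)%N && (l' + rk w == kap l)%N) 'X_(xv l') ^+ c.-1 * 'X_w ^+ c
  else (l == l')%:R * ('X_T0 ^+ c * 'X_(xv l') ^+ c.-1).

Lemma Psi0_zeta l : \sum_l' Psi0 l l' * zeta l' = Qc l.
Proof.
have dm j : (ord_max == xv j) = false by apply/negbTE; rewrite -val_eqE /= neq_ltn ltn_ord orbT.
have d0 : (0 < d)%N by lia.
have T0E (j : 'I_d) : j = 0%N :> nat -> xv j = T0 by move=> j0; apply/val_inj.
have cE (v : 'I_d.+1) : 'X_v ^+ c.-1 * 'X_v = 'X_v ^+ c :> S by rewrite -exprSr prednK.
rewrite /Qc -(pair_big_dep (fun v : 'I_d.+1 => (v < g)%N)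
  (fun v w : 'I_d.+1 => (g <= w)%N && (rk v + rk w == kap l)%N)
  (fun v w => 'X_v ^+ c * 'X_w ^+ c)) /=.
rewrite [RHS]big_mkcond /= big_ord_recr /= [(d < g)%N]ltnNge g_le_d /= addr0.
have rkT (j : 'I_d) : (j < g)%N -> rk (xv j) = j by rewrite /slot_rank /= => ->.
pose e := Ordinal d0.
have xe : xv e = T0 by apply/val_inj.
have z0 : Psi0 l e * zeta e = (l == 0%N :> nat)%:R * ('X_T0 ^+ c * 'X_ord_max ^+ c).
  rewrite mxE /zeta /zmon /= xe mpolyXD -!mulrA; congr (_ * _).
  by rewrite -(cE T0) -(cE ord_max) !mulrA; congr (_ * _); rewrite mulrAC.
have zT (j : 'I_d) : j != e -> (j < g)%N -> Psi0 l j * zeta j =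
    \sum_(w : 'I_d.+1 | (g <= w)%N && (rk (xv j) + rk w == kap l)%N) 'X_(xv j) ^+ c * 'X_w ^+ c.
  move=> je jg; have j0 : (j == 0%N :> nat) = false by apply: contraNF je => /eqP j0; apply/eqP/ord_inj.
  rewrite mxE j0 jg /zeta /zmon j0 mulr_suml rkT //; apply: eq_bigr => w _.
  by rewrite mulrAC cE.
have zY (j : 'I_d) : (g <= j)%N -> Psi0 l j * zeta j =
    (l == j)%:R * ('X_T0 ^+ c * 'X_(xv j) ^+ c).
  move=> gj; have j0 : (j == 0%N :> nat) = false by apply/negbTE; rewrite -lt0n; lia.
  by rewrite mxE j0 ltnNge gj /zeta /zmon j0 -!mulrA cE.
have rkz (w : 'I_d.+1) : (g <= w)%N -> rk w = (w - g)%N by rewrite /slot_rank leqNgt => /negbTE->.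
have L : \sum_j Psi0 l j * zeta j = (l == 0%N :> nat)%:R * ('X_T0 ^+ c * 'X_ord_max ^+ c) +
   \sum_(j < d | (j < g)%N && (j != e)) \sum_(w : 'I_d.+1 | (g <= w)%N && (rk (xv j) + rk w == kap l)%N)
        'X_(xv j) ^+ c * 'X_w ^+ c
   + \sum_(j < d | ~~ (j < g)%N) (l == j)%:R * ('X_T0 ^+ c * 'X_(xv j) ^+ c).
  rewrite (bigID (fun j : 'I_d => (j < g)%N)) (bigD1 e) //= z0; congr (_ + _ + _).
    by apply: eq_bigr => j /andP[jg je]; apply: zT.
  by apply: eq_bigr => j; rewrite -leqNgt => /zY.
rewrite L -big_mkcond [RHS](bigD1 e) //= addrAC; congr (_ + _).
rewrite xe (_ : rk T0 = 0%N); last by rewrite /slot_rank /= g_gt0.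
have [lg|gl] := ltnP l g.
  rewrite [X in _ + X]big1 ?addr0 => [|j]; last first.
    by rewrite -leqNgt => gj; rewrite (_ : (l == j) = false) ?mul0r //; apply/negbTE/eqP => /(congr1 val) /=; lia.
  have [l0|l0] := eqVneq (l : nat) 0%N; rewrite ?mul1r ?mul0r.
    rewrite (big_pred1 ord_max) //= => w; rewrite add0n /kap lg l0 addn0.
    have [gw|] := leqP g w; last first.
      by move=> wg /=; apply/esym/negbTE/eqP => wE; move: wg; rewrite wE /=; lia.
    by rewrite rkz //= -val_eqE /=; have := ltn_ord w; lia.
  rewrite big1 // => w /andP[gw]; rewrite rkz // /kap lg add0n => /eqP.
  by have := ltn_ord w; lia.
rewrite (_ : (l == 0%N :> nat) = false) ?mul0r ?add0r; last by apply/negbTE; rewrite -lt0n; lia.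
rewrite (bigD1 l) /=; last by rewrite -leqNgt.
rewrite eqxx mul1r big1 ?addr0 => [|j /andP[_ /negbTE]]; last by rewrite eq_sym => ->; rewrite mul0r.
rewrite (big_pred1 (xv l)) //= => w; rewrite add0n /kap ltnNge gl /=.
have [gw|wg] := leqP g w; first by rewrite rkz //= -val_eqE /=; lia.
by apply/esym/negbTE/eqP => wE; move: wg; rewrite wE /=; lia.
Qed.

Lemma det_Psi0 : \det Psi0 = 'X_[cpow (topmon d g)].
Proof.
have rkz (w : 'I_d.+1) : (g <= w)%N -> rk w = (w - g)%N by rewrite /slot_rank leqNgt => /negbTE->.
rewrite (@det_rank_trig _ _ (fun l : 'I_d => kap l)); first last.
- move=> l l'; rewrite mxE; case: ifP => [l'0|_].
    have [/eqP l0|_] := boolP (l == 0%N :> nat); last by rewrite mul0r eqxx.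
    by rewrite l0 (eqP l'0).
  case: ifP => [lg|_].
    apply: contraNT => kk; rewrite big1 // => w /andP[gw]; rewrite rkz // => /eqP.
    by move: kk; rewrite /kap lg; have := ltn_ord w; lia.
  by have [->//|_] := eqVneq l l'; rewrite mul0r eqxx.
- exact: kap_inj.
have d0 : (0 < d)%N by lia.
pose e := Ordinal d0.
pose E (l : 'I_d) : 'X_{1..d.+1} := (U_(xv l) *+ c.-1 + (if l == e then U_(ord_max) *+ c.-1 else
  if (l < g)%N then U_(ord_max) *+ c else U_(T0) *+ c))%MM.
rewrite (eq_bigr (fun l => 'X_[E l])) => [|l _].
  rewrite mprodXE; congr 'X_[_]; apply/mnmP => v.
  rewrite mnm_sumE /cpow mnmE /topmon !mnmDE !mulmnE !mnm1E.
  have -> : (\sum_l E l v = (\sum_(l < d) (xv l == v)) * c.-1 +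
      (\sum_(l < d) (l == e)) * ((ord_max == v) * c.-1) +
      (\sum_(l < d) ((l != e) && (l < g)%N)) * ((ord_max == v) * c) +
      (\sum_(l < d) ~~ (l < g)%N) * ((T0 == v) * c))%N.
    rewrite !big_distrl -!big_split; apply: eq_bigr => l _ /=; rewrite /E mnmDE mulmnE mnm1E.
    have [->|le] := eqVneq l e; first by rewrite /= g_gt0 mulmnE mnm1E /=; lia.
    by case: (l < g)%N; rewrite !mulmnE !mnm1E /=; lia.
  have cg := sum_ord_ltn g_le_d.
  have -> : (\sum_(l < d) ~~ (l < g)%N = q)%N.
    have : (\sum_(l < d) (l < g) + \sum_(l < d) ~~ (l < g)%N = d)%N.
      rewrite -big_split /= (eq_bigr (fun=> 1%N)) ?sum1_card ?card_ord // => a _.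
      by case: (a < g)%N.
    by rewrite cg; lia.
  have ce : (\sum_(l < d) (l == e) = 1)%N.
    by rewrite (bigD1 e) //= big1 // => l /negbTE ->.
  have -> : (\sum_(l < d) ((l != e) && (l < g)%N) = g.-1)%N.
    have : (\sum_(l < d) (l == e) + \sum_(l < d) ((l != e) && (l < g)%N) = g)%N.
      rewrite -{2}cg -big_split /=; apply: eq_bigr => l _.
      by have [->|] := eqVneq l e; rewrite //= g_gt0.
    by rewrite ce; lia.
  have -> : (\sum_(l < d) (xv l == v) = (ord_max != v))%N.
    have : (\sum_(l < d.+1) (l == v) = 1)%N.
      by rewrite (bigD1 v) //= eq_refl big1 // => l /negbTE ->.
    rewrite big_ord_recr /=; case: (ord_max == v); rewrite /= ?addn0 //.
    by rewrite addn1 => -[].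
  rewrite ce /T0; case: (ord_max == v); case: (ord0 == v); rewrite /=; lia.
rewrite mxE /E (_ : (l == e) = (l == 0%N :> nat)) //.
case: ifP => [l0|l0]; first by rewrite l0 /= mulr1n mul1r mpolyXD !mpolyXn.
case: ifP => lg.
  rewrite (big_pred1 ord_max) => [|w]; first by rewrite mpolyXD !mpolyXn.
  rewrite /kap lg; have [gw|wg] := leqP g w.
    by rewrite rkz //= -val_eqE /=; have := ltn_ord w; lia.
  by apply/esym/negbTE/eqP => wE; move: wg; rewrite wE /=; lia.
by rewrite eqxx mul1r mpolyXD !mpolyXn mulrC.
Qed.

End Power.

(** Transformation law: with Q = Am F, the functional of F is that of Q after multiplication by det
    Am. It kills the multiples of F by Cramer's rule. On a transition determinant of F it takes the
    value of det [Psi0], by [det_indep] for [Am *m A] and [Psi0]. *)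
Lemma residue_exists (F : 'I_d -> S) c : (0 < c)%N ->
  (forall v w : 'I_d.+1, (v < g)%N -> (g <= w)%N ->
     exists b : 'I_d -> S, 'X_v ^+ c * 'X_w ^+ c = \sum_i b i * F i) ->
  exists psi : S -> k, [/\ linear_for *%R psi,
    (forall i h, psi (F i * h) = 0) &
    (forall A : 'M[S]_d, (forall l, F l = \sum_j A l j * zeta j) -> psi (\det A) != 0)].
Proof.
move=> c0 TzF; pose b0 : 'I_d -> S := fun=> 0.
have [a aE] : exists a : 'I_d -> 'I_d -> S, forall l, Qc c l = \sum_i a l i * F i.
  apply: (@fin_all_exists _ _ (fun l (b : 'I_d -> S) => Qc c l = \sum_i b i * F i)) => l.
  pose I (f : S) := exists b : 'I_d -> S, f = \sum_i b i * F i.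
  have K : is_ideal I.
    split.
    - by exists b0; rewrite big1 // => i _; rewrite mul0r.
    - move=> f h [b1 ->] [b2 ->]; exists (fun i => b1 i + b2 i).
      by rewrite -big_split; apply: eq_bigr => i _; rewrite mulrDl.
    - move=> r f [b ->]; exists (fun i => r * b i).
      by rewrite mulr_sumr; apply: eq_bigr => i _; rewrite mulrA.
  by apply: (@ideal_sum _ I) => // -[v w] /and3P[vg gw _]; apply: TzF.
pose Am : 'M[S]_d := \matrix_(l, i) a l i.
have K : is_ideal (fun f : S => forall h, mlin (lamc c) (f * h) = 0).
  split=> [h|f1 f2 H1 H2 h|r f H h]; first by rewrite mul0r raddf0.
    by rewrite mulrDl raddfD /= H1 H2 addr0.
  by rewrite [r * f]mulrC -mulrA.
have QK l h : mlin (lamc c) (Qc c l * h) = 0 by apply: mlin_Qc.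
exists (fun G => mlin (lamc c) (\det Am * G)); split.
- by move=> x f h /=; rewrite mulrDr -scalerAr linearP.
- move=> i h; have -> : \det Am * (F i * h) = \sum_l (\adj Am i l * h) * Qc c l.
    have /(congr1 (fun B => (B *m \col_i F i) i 0)) := mul_adj_mx Am.
    rewrite mul_scalar_mx -mulmxA [RHS]mxE mxE [in RHS]mxE => E.
    rewrite mulrA -E mulr_suml; apply: eq_bigr => l _; rewrite !mxE aE mulrAC; congr (_ * _).
    by apply: eq_bigr => j _; rewrite !mxE.
  by rewrite raddf_sum big1 //= => l _; rewrite mulrC QK.
- move=> A AF; rewrite -det_mulmx.
  have [K0 KD KM] := K.
  have AAz j : \sum_h (Am *m A) j h * zeta h = Qc c j.
    under eq_bigr => h _ do rewrite mxE mulr_suml.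
    rewrite exchange_big /= aE; apply: eq_bigr => i _; rewrite AF mulr_sumr.
    by apply: eq_bigr => h _; rewrite mxE mulrA.
  have := @det_indep _ _ _ _ _ K QK zeta_reg _ _ AAz (fun j => Psi0_zeta c0 j).
  move=> /(_ 1); rewrite mulr1 raddfB => /eqP; rewrite subr_eq0 => /eqP /= ->.
  by rewrite det_Psi0 // mlinX lamc_cpow // lam_top.
Qed.

End ResidueFunctional.

(** * Lifting weighted polynomials to the ring with one more variable *)

Section Lift.

Variables (k : fieldType) (d g om : nat).

Local Notation R := {mpoly k[d]}.
Local Notation S := {mpoly k[d.+1]}.
Local Notation wt := (@mnm_weight d g om).

(* Trades the weight exceeding [K] for powers of one extra variable. *)
Definition liftm K (m : 'X_{1..d}) : 'X_{1..d.+1} :=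
  (mnmwiden m + U_(ord_max) *+ (wt m - K))%MM.

Definition Theta K : R -> S := mlin (fun m => 'X_[liftm K m]).

Lemma mnmwidenMn (m : 'X_{1..d}) j : mnmwiden (m *+ j) = (mnmwiden m *+ j)%MM.
Proof. by elim: j => [|j IH]; rewrite ?mulm0n ?mnmwiden0 // !mulmS mnmwidenD IH. Qed.

Lemma liftmD K K' m m' : (K <= wt m)%N -> (K' <= wt m')%N ->
  liftm (K + K') (m + m') = (liftm K m + liftm K' m')%MM.
Proof.
move=> h h'; rewrite /liftm mnmwidenD wtD; apply/mnmP => i.
rewrite !mnmDE !mulmnE; case: (U_(ord_max)%MM i) => [|j]; first by lia.
have -> : (wt m + wt m' - (K + K') = (wt m - K) + (wt m' - K'))%N by lia.
by rewrite mulnDr; lia.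
Qed.

Lemma ThetaX K m : Theta K 'X_[m] = 'X_[liftm K m].
Proof. exact: mlinX. Qed.

Lemma Theta_linear K : linear (Theta K).
Proof. exact: mlin_is_linear. Qed.

HB.instance Definition _ K :=
  GRing.isLinear.Build k R S _ (Theta K) (Theta_linear K).

Lemma ThetaM K K' f h : MI (fun m => (K <= wt m)%N) f -> MI (fun m => (K' <= wt m)%N) h ->
  Theta (K + K') (f * h) = Theta K f * Theta K' h.
Proof.
move=> Kf; move: h; apply: MI_ind => [|h1 h2 E1 E2|c' m' K'm']; first by rewrite mulr0 !raddf0 mulr0.
  by rewrite mulrDr !raddfD /= E1 E2 mulrDr.
move: f Kf; apply: MI_ind => [|f1 f2 E1 E2|c m Km]; first by rewrite mul0r !raddf0 mul0r.
  by rewrite mulrDl !raddfD /= E1 E2 mulrDl.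
rewrite -scalerAl -scalerAr scalerA -mpolyXD linearZ /= !linearZ /= !ThetaX liftmD //.
by rewrite mpolyXD -scalerAl -scalerAr scalerA.
Qed.

Lemma MI_wtM K K' (f h : R) : MI (fun m => (K <= wt m)%N) f -> MI (fun m => (K' <= wt m)%N) h ->
  MI (fun m => (K + K' <= wt m)%N) (f * h).
Proof. by apply: MI_M => m m' h1 h2; rewrite wtD leq_add. Qed.

Lemma Theta_prod (I : Type) (r : seq I) (P : pred I) (c : I -> nat) (F : I -> R) :
  (forall i, P i -> MI (fun m => (c i <= wt m)%N) (F i)) ->
  Theta (\sum_(i <- r | P i) c i) (\prod_(i <- r | P i) F i) =
    \prod_(i <- r | P i) Theta (c i) (F i).
Proof.
move=> cF.
suff [] : MI (fun m => (\sum_(i <- r | P i) c i <= wt m)%N) (\prod_(i <- r | P i) F i) /\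
   Theta (\sum_(i <- r | P i) c i) (\prod_(i <- r | P i) F i) =
    \prod_(i <- r | P i) Theta (c i) (F i) by [].
elim: r => [|i r [IH1 IH2]].
  rewrite !big_nil; split=> [m|] //; rewrite -mpolyX0 ThetaX /liftm wt0 subn0 mulm0n addm0.
  by rewrite mnmwiden0 !mpolyX0.
rewrite !big_cons; case: ifP => // Pi; split; first by apply: MI_wtM => //; apply: cF.
by rewrite ThetaM ?IH2 //; apply: cF.
Qed.

(** Each term of the expansion takes one entry from every column, so it is lifted with the sum of
    the column weights. *)
Lemma Theta_det (nu : 'I_d -> nat) (A : 'M[R]_d) :
  (forall l j, MI (fun m => (nu j <= wt m)%N) (A l j)) ->
  Theta (\sum_j nu j) (\det A) = \det (\matrix_(l, j) Theta (nu j) (A l j)).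
Proof.
move=> nuA; rewrite /determinant raddf_sum; apply: eq_bigr => s _ /=.
have sgE (T : comNzRingType) (x : T) : (-1) ^+ s * x = if odd_perm s then - x else x.
  by case: (odd_perm s); rewrite ?expr1 ?mulN1r ?expr0 ?mul1r.
have -> : \prod_i (\matrix_(l, j) Theta (nu j) (A l j)) i (s i) =
    \prod_i Theta (nu (s i)) (A i (s i)) by apply: eq_bigr => i _; rewrite mxE.
rewrite !sgE (reindex_inj (@perm_inj _ s)) /=.
by case: ifP => _; rewrite ?raddfN /= (Theta_prod _ (c := fun i => nu (s i))).
Qed.

End Lift.

Section ResidueOnR.

Variables (k : fieldType) (d g delta om : nat).
Hypotheses (char0 : [pchar k] =i pred0) (g_ge2 : (2 <= g)%N) (g_le_d : (g <= d)%N)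
  (delta_ge2 : (2 <= delta)%N) (om_case : om = 1%N \/ om = delta).

Local Notation q := (d - g)%N.
Local Notation R := {mpoly k[d]}.
Local Notation S := {mpoly k[d.+1]}.
Local Notation wt := (@mnm_weight d g om).
Local Notation wgt := (@var_weight d g om).
Local Notation PP := (@lex_mnm d g delta om).
Local Notation xv := (widen_ord (leqnSn d)).

(* That (f) is a reduction of the ideal L spanned by the monomials [lex_mnm 1],
   read off in the powers of L. *)
Definition red n (f : 'I_n -> R) : Prop :=
  (forall i, MI (fun m => mdeg m = delta /\ PP 1 m) (f i)) /\
  exists p, forall h, MI (PP p.+1) h ->
    exists b : 'I_n -> R, (forall i, MI (PP p) (b i)) /\ h = \sum_i b i * f i.

(** The weight that remains when a monomial of degree [delta] and weight at least [om] loses its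
    last variable, the one of column l. In column 0 the monomial is a power of x_1 and keeps at
    least one unit. *)
Definition nup (l : 'I_d) : nat :=
  if l == 0%N :> nat then 1%N else if (l < g.-1)%N then 0%N
  else if (l < g)%N then om.-1 else om.

Lemma sum_nup : (\sum_j nup j = om * q.+1)%N.
Proof.
have om0 := om_gt0 delta_ge2 om_case.
have g1d : (g.-1 < d)%N by lia.
have d0 : (0 < d)%N by lia.
pose e0 := Ordinal d0; pose e1 := Ordinal g1d.
have cg := sum_ord_ltn g_le_d.
have cq : (\sum_(l < d) ~~ (l < g)%N = q)%N.
  have : (\sum_(l < d) (l < g) + \sum_(l < d) ~~ (l < g)%N = d)%N.
    rewrite -big_split /= (eq_bigr (fun=> 1%N)) ?sum1_card ?card_ord // => a _.
    by case: (a < g)%N.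
  by rewrite cg; lia.
have c1 (e : 'I_d) : (\sum_(l < d) (l == e) = 1)%N.
  by rewrite (bigD1 e) //= eqxx big1 // => l /negbTE ->.
transitivity (\sum_(l < d) ((l == e0) + (l == e1) * om.-1 + (~~ (l < g)%N) * om))%N.
  apply: eq_bigr => l _; rewrite /nup -!val_eqE /=.
  case: (ltngtP l g.-1) => [lg|lg|->].
  - by rewrite (_ : (l < g)%N) ?mul0n ?addn0; [case: eqP | lia].
  - by rewrite (_ : (l < g)%N = false); [case: eqP; lia | lia].
  - by rewrite (_ : (g.-1 < g)%N); [case: eqP; lia | lia].
by rewrite !big_split /= -!big_distrl /= !c1 cq; lia.
Qed.

Lemma nup_zeta (j : 'I_d) : (nup j <= om)%N /\
  MI (fun m => (om - nup j <= wt m)%N) ('X_j : R) /\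
  Theta g om (om - nup j) ('X_j : R) = zeta k j.
Proof.
have om0 := om_gt0 delta_ge2 om_case.
have wj : (om - nup j <= wgt j)%N /\ (wgt j - (om - nup j) = (j == 0%N :> nat))%N /\ (nup j <= om)%N.
  rewrite /nup /var_weight; have [->|j0] := eqVneq (j : nat) 0%N.
    by rewrite (_ : (0 < g.-1)%N) /=; [split; [lia|split; lia] | lia].
  by case: (ltnP j g.-1) => h1; case: (ltnP j g) => h2; rewrite /=; split; lia.
have [h1 [h2 h3]] := wj; split=> //; split; first by apply: MI_X; rewrite wt1.
rewrite ThetaX /liftm wt1 h2 /zeta /zmon mnmwiden1; congr 'X_[_].
by case: eqP => _; rewrite ?mulm1n // mulm0n addm0.
Qed.

Lemma residue_R (f : 'I_d -> R) : red f -> exists phi : R -> k,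
  [/\ linear_for *%R phi,
   (forall i r, MI (fun m => (q * om <= wt m)%N) r -> phi (f i * r) = 0) &
   (forall A : 'M[R]_d, (forall l j, MI (fun m => (nup j <= wt m)%N) (A l j)) ->
      (forall l, f l = \sum_j A l j * 'X_j) -> phi (\det A) != 0)].
Proof.
case=> fW [p fp].
have om0 := om_gt0 delta_ge2 om_case; have le_om := om_le delta_ge2 om_case.
have fw i : MI (fun m => (om <= wt m)%N) (f i).
  by apply: MI_S (fW i) => m [_ /andP[_]]; rewrite mul1n.
pose F i := Theta g om om (f i).
(* Large enough to dominate every exponent, that of the extra variable included, in the monomials of
   L^(p+1) lifted below. *)
pose c := (delta * delta * p.+1)%N.
have mono (m : 'X_{1..d}) (u : 'X_{1..d.+1}) : PP p.+1 m -> (liftm g om (p.+1 * om) m <= u)%MM ->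
    exists b : 'I_d -> S, 'X_[u] = \sum_i b i * F i.
  move=> Pm le; have [b [bP E]] := fp 'X_[m] (MI_X Pm).
  exists (fun i => 'X_[u - liftm g om (p.+1 * om) m] * Theta g om (p * om) (b i)).
  rewrite -{1}(submK le) mpolyXD -ThetaX E raddf_sum /= mulr_sumr; apply: eq_bigr => i _.
  rewrite -mulrA mulSn addnC ThetaM //.
  by apply: MI_S (bP i) => m' /andP[].
have [|v w vg gw|psi [psi_lin psi0 psiD]] := @residue_exists k d g char0 (ltnW g_ge2) g_le_d F c.
- by rewrite /c !muln_gt0; lia.
- rewrite !mpolyXn -mpolyXD.
  have vd : (v < d)%N by lia.
  pose i := Ordinal vd; have vi : v = xv i by apply/val_inj.
  have wi := wgt_x om0 (vg : (i < g)%N); have wi' := wgt_le g i om0.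
  have dm j : (ord_max == xv j) = false.
    by apply/negbTE; rewrite -val_eqE /= neq_ltn ltn_ord orbT.
  have cE1 : (p.+1 <= c)%N by rewrite /c -{1}[p.+1]mul1n leq_mul2r; nia.
  have cE2 : (delta * p.+1 <= c)%N by rewrite /c -mulnA leq_mul2l; nia.
  have [wd|wd] := ltnP w d.
    pose j := Ordinal wd; have wj : w = xv j by apply/val_inj.
    have wj0 : wgt j = 0%N by apply: wgt_y.
    have ij : i != j by rewrite -val_eqE /= neq_ltn (leq_trans vg gw).
    (* If x_i has weight [om], then (x_i y_j^(delta-1))^(p+1) lies in L^(p+1) with no surplus
       weight; otherwise x_i is x_g and x_g^(delta (p+1)) does the same. *)
    have [wiE|wiE] := eqVneq (wgt i) om.
      apply: (mono ((U_(i) + U_(j) *+ delta.-1) *+ p.+1)%MM).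
        rewrite /lex_mnm mdegMn wtMn mdegD wtD mdegMn wtMn !mdeg1 !wt1 wiE wj0.
        by apply/andP; split; nia.
      rewrite /liftm wtMn wtD wtMn !wt1 wiE wj0 (_ : (_ - _ = 0)%N); last by nia.
      rewrite mulm0n addm0 mnmwidenMn mnmwidenD mnmwidenMn !mnmwiden1 -vi -wj.
      apply/mnm_lepP => u; rewrite !(mulmnE, mnmDE, mnm1E).
      have cE3 : (delta.-1 * p.+1 <= c)%N by apply: leq_trans cE2; rewrite leq_mul2r leq_pred orbT.
      by case: (v == u); case: (w == u); rewrite ?mul1n ?mul0n ?addn0 ?add0n //; lia.
    have omE : om = delta by case: om_case => // om1; move: wiE wi wi'; rewrite om1; lia.
    have wi1 : wgt i = 1%N by move: wiE; rewrite /var_weight; case: ifP; rewrite ?eqxx ?vg.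
    apply: (mono (U_(i) *+ (delta * p.+1))%MM).
      rewrite /lex_mnm mdegMn wtMn mdeg1 wt1 wi1 omE.
      by apply/andP; split; nia.
    rewrite /liftm wtMn wt1 wi1 omE (_ : (_ - _ = 0)%N); last by nia.
    rewrite mulm0n addm0 mnmwidenMn !mnmwiden1 -vi.
    apply/mnm_lepP => u; rewrite !(mulmnE, mnmDE, mnm1E).
    by case: (v == u); rewrite ?mul1n ?mul0n //; lia.
  (* For the extra variable, x_i^(delta (p+1)) lies in L^(p+1) and its surplus weight is at most
     delta^2 (p+1). *)
  have wE : w = ord_max by apply/val_inj => /=; have := ltn_ord w; lia.
  apply: (mono (U_(i) *+ (delta * p.+1))%MM).
    rewrite /lex_mnm mdegMn wtMn mdeg1 wt1.
    by apply/andP; split; nia.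
  rewrite /liftm wtMn wt1 mnmwidenMn !mnmwiden1 -vi -wE.
  apply/mnm_lepP => u; rewrite !(mulmnE, mnmDE, mnm1E).
  have cE4 : (wgt i * (delta * p.+1) - p.+1 * om <= c)%N.
    apply: leq_trans (leq_subr _ _) _; rewrite /c mulnA leq_mul2r leq_mul2r.
    by rewrite (leq_trans wi' le_om) !orbT.
  by case: (v == u); case: (w == u); rewrite ?mul1n ?mul0n ?addn0 ?add0n //; lia.
exists (fun G => psi (Theta g om (om * q.+1) G)); split.
- by move=> x f1 f2 /=; rewrite linearP psi_lin.
- move=> i r rq; rewrite mulnS [(om * q)%N]mulnC ThetaM //; exact: psi0.
- move=> A nuA AE; rewrite -sum_nup Theta_det //; apply: psiD => l.
  rewrite /F AE raddf_sum; apply: eq_bigr => j _ /=.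
  have [h1 [h2 h3]] := nup_zeta j.
  by rewrite mxE -h3 -ThetaM ?subnKC.
Qed.

End ResidueOnR.

(** * Morley forms *)

Section TwoSets.

Variables (k : fieldType) (n : nat).
Local Notation R := {mpoly k[n]}.
Local Notation B := {mpoly R[n]}.
Implicit Types (P Q : 'X_{1..n} -> 'X_{1..n} -> Prop) (c e : B).

(** Elements of B are polynomials in x with coefficients in x': the outer monomial is in x, the
    inner one in x'. Accordingly [iota f] is f(x) and [f%:MP] is f(x'). *)
Definition MI2 P c : Prop := forall m, MI (P m) c@_m.

Lemma MI2_S P Q c : (forall m m', P m m' -> Q m m') -> MI2 P c -> MI2 Q c.
Proof. by move=> PQ Pc m; apply: MI_S (Pc m); apply: PQ. Qed.

Lemma MI2_0 P : MI2 P 0.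
Proof. by move=> m; rewrite mcoeff0; apply: MI_0. Qed.

Lemma MI2_D P c e : MI2 P c -> MI2 P e -> MI2 P (c + e).
Proof. by move=> Pc Pe m; rewrite mcoeffD; apply: MI_D. Qed.

Lemma MI2_sum P (I : Type) (r : seq I) (A : pred I) (F : I -> B) :
  (forall i, A i -> MI2 P (F i)) -> MI2 P (\sum_(i <- r | A i) F i).
Proof. by move=> PF; elim/big_ind: _ => //; [apply: MI2_0 | apply: MI2_D]. Qed.

Lemma MI2_M P Q T c e :
  (forall m1 m2 m1' m2', P m1 m1' -> Q m2 m2' -> T (m1 + m2)%MM (m1' + m2')%MM) ->
  MI2 P c -> MI2 Q e -> MI2 T (c * e).
Proof.
move=> PQT Pc Qe m; rewrite mcoeffM; apply: MI_sum => -[m1 m2] /= /eqP mE.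
by apply: MI_M (Pc m1) (Qe m2) => m1' m2' h1 h2; rewrite mE; apply: PQT.
Qed.

Lemma MI2_sign P (b : bool) c : MI2 P c -> MI2 P ((-1) ^+ b * c).
Proof.
case: b => Pc; rewrite ?expr1 ?mulN1r ?expr0 ?mul1r //.
by move=> m; rewrite mcoeffN; apply: MI_N.
Qed.

(** Both bounds are needed together, because weights are controlled by columns and degrees by
    rows. *)
Lemma MI2_det (mu1 mu2 : 'X_{1..n} -> 'X_{1..n} -> nat) (rho nu : 'I_n -> nat) (A : 'M[B]_n) :
  mu1 0%MM 0%MM = 0%N -> mu2 0%MM 0%MM = 0%N ->
  (forall m1 m2 m1' m2', mu1 (m1 + m2)%MM (m1' + m2')%MM = mu1 m1 m1' + mu1 m2 m2')%N ->
  (forall m1 m2 m1' m2', mu2 (m1 + m2)%MM (m1' + m2')%MM = mu2 m1 m1' + mu2 m2 m2')%N ->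
  (forall i l, MI2 (fun m m' => (nu l <= mu1 m m')%N && (mu2 m m' <= rho i)%N) (A i l)) ->
  MI2 (fun m m' => (\sum_l nu l <= mu1 m m')%N && (mu2 m m' <= \sum_i rho i)%N) (\det A).
Proof.
move=> mu10 mu20 mu1D mu2D HA; apply: MI2_sum => s _; apply: MI2_sign.
rewrite (reindex_inj (@perm_inj _ s)) /=.
elim/big_rec3: _ => [m|i r a b _ IH].
  rewrite mcoeff1; have [->|_] := eqVneq m 0%MM; last exact: MI_0.
  by rewrite -mpolyX0; apply: MI_X; rewrite mu10 mu20.
apply: MI2_M (HA i (s i)) IH => m1 m2 m1' m2' /andP[h1 h2] /andP[h3 h4].
by rewrite mu1D mu2D !leq_add.
Qed.

(* The monomials x^m x'^m' occurring in the j-th difference quotient of x^a when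
   the variables are replaced one at a time, the last one first. *)
Definition dq (a : 'X_{1..n}) (j : 'I_n) (m m' : 'X_{1..n}) : Prop :=
  [/\ (mdeg m + mdeg m').+1 = mdeg a, forall i : 'I_n, (i < j)%N -> m' i = a i, (0 < a j)%N &
    m = 0%MM -> (m' + U_(j))%MM = a /\ forall i : 'I_n, (j < i)%N -> a i = 0%N].

Local Notation iota := (map_mpoly (@mpolyC n k)).

Lemma diff_quot_X (a : 'X_{1..n}) : exists D : 'I_n -> B,
  'X_[a] - ('X_[a])%:MP = \sum_l D l * ('X_l - ('X_l)%:MP) /\ forall j, MI2 (dq a j) (D j).
Proof.
move: {2}(mdeg a) (leqnn (mdeg a)) => N; elim: N a => [|N IH] a aN.
  move: aN; rewrite leqn0 mdeg_eq0 => /eqP ->; exists (fun=> 0); split; last by move=> j; apply: MI2_0.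
  by rewrite !mpolyX0 mpolyC1 subrr big1 // => l _; rewrite mul0r.
have [->|a0] := eqVneq a 0%MM.
  exists (fun=> 0); split; last by move=> j; apply: MI2_0.
  by rewrite !mpolyX0 mpolyC1 subrr big1 // => l _; rewrite mul0r.
have [i0 ai0] : exists i0, a i0 != 0%N.
  by apply/existsP; apply: contraR a0 => /existsPn H; apply/eqP/mnmP => i; rewrite mnm0E; apply/eqP/negPn.
(* The last variable is replaced first: x^a - x'^a = x_l (x^b - x'^b) + x'^b (x_l - x'_l). Only x'^b
   is free of x, which gives the last clause of [dq]. *)
pose l := [arg max_(i > i0 | a i != 0%N) (i : nat)].
have [al lmax] : a l != 0%N /\ forall i, a i != 0%N -> (i <= l)%N.
  by rewrite /l; case: arg_maxnP.
have le1 : (U_(l) <= a)%MM by rewrite lep1mP.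
pose b := (a - U_(l))%MM; have aE : a = (b + U_(l))%MM by rewrite submK.
have da : mdeg a = (mdeg b).+1 by rewrite aE mdegD mdeg1 addn1.
have [|D [DE Dd]] := IH b; first by lia.
exists (fun j => 'X_l * D j + if j == l then ('X_[b])%:MP else 0); split.
  under eq_bigr => j _ do rewrite mulrDl -mulrA.
  rewrite big_split /= -mulr_sumr -DE (bigD1 l) //= eqxx big1 => [|j /negbTE ->]; last by rewrite mul0r.
  rewrite addr0 aE !mpolyXD mpolyCM; ring.
move=> j; apply: MI2_D.
  have X1 : MI2 (fun m m' => m = U_(l)%MM /\ m' = 0%MM) ('X_l : B).
    move=> m; rewrite mcoeffX; have [<-|_] := eqVneq U_(l)%MM m; last exact: MI_0.
    by rewrite /= mulr1n -mpolyX0; apply: MI_X.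
  apply: MI2_M X1 (Dd j) => m1 m2 m1' m2' [-> ->] [h1 h2 h3 h4]; rewrite add0m.
  have jl : (j <= l)%N by apply: lmax; rewrite aE mnmDE; lia.
  split.
  - by rewrite mdegD mdeg1 da -h1; lia.
  - move=> i ij; rewrite h2 // aE mnmDE mnm1E.
    by rewrite (_ : (l == i) = false) ?addn0 //; apply/eqP => li; move: ij jl; rewrite -li; lia.
  - by rewrite aE mnmDE; lia.
  - by move/eqP; rewrite mnmD_eq0 mnm1_eq0.
case: eqP => [->|_]; last exact: MI2_0.
move=> m; rewrite mcoeffC; have [->|_] := eqVneq m 0%MM; last by rewrite mulr0; apply: MI_0.
rewrite mulr1; apply: MI_X; split.
- by rewrite mdeg0 da.
- by move=> i il; rewrite aE mnmDE mnm1E (_ : (l == i) = false) ?addn0 // -val_eqE /= gtn_eqF.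
- by rewrite lt0n.
- move=> _; split=> // i li; apply/eqP; apply: contraTT li => /lmax; by rewrite -leqNgt.
Qed.

Lemma diff_quot (P : 'X_{1..n} -> Prop) (f : R) : MI P f -> exists D : 'I_n -> B,
  iota f - f%:MP = \sum_l D l * ('X_l - ('X_l)%:MP) /\
  forall j, MI2 (fun m m' => exists2 a, P a & dq a j m m') (D j).
Proof.
move: f; apply: MI_ind => [|f h [D1 [E1 d1]] [D2 [E2 d2]]|c a Pa].
- exists (fun=> 0); split; last by move=> j; apply: MI2_0.
  by rewrite raddf0 mpolyC0 subrr big1 // => l _; rewrite mul0r.
- exists (fun l => D1 l + D2 l); split; last by move=> j; apply: MI2_D.
  under eq_bigr do rewrite mulrDl.
  by rewrite big_split /= -E1 -E2 raddfD /= mpolyCD opprD addrACA.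
- have [D [DE Dd]] := diff_quot_X a.
  exists (fun l => (c%:MP)%:MP * D l); split.
    under eq_bigr do rewrite -mulrA.
    by rewrite -mulr_sumr -DE -mul_mpolyC rmorphM /= map_mpolyC map_mpolyX mpolyCM mulrBr.
  move=> j m; rewrite mcoeffCM mul_mpolyC; apply: MI_Z.
  by apply: MI_S (Dd j m) => m' h; exists a.
Qed.

End TwoSets.

Lemma mpart_mul_homog n (A : comNzRingType) (f c : {mpoly A[n]}) a b :
  MI (fun m => mdeg m = a) f ->
  mpart (fun m => mdeg m == (a + b)%N) (f * c) = f * mpart (fun m => mdeg m == b) c.
Proof.
move=> fa; rewrite [c]mpolyE; elim/big_ind: _ => [|c1 c2 E1 E2|m _].
- by rewrite mulr0 !raddf0 mulr0.
- by rewrite mulrDr !raddfD /= E1 E2 mulrDr.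
rewrite -scalerAr !linearZ /= -scalerAr; congr (_ *: _).
move: f fa; apply: MI_ind => [|f h E1 E2|r m' m'a].
- by rewrite mul0r raddf0 mul0r.
- by rewrite mulrDl raddfD /= E1 E2 mulrDl.
rewrite -scalerAl linearZ /= -scalerAl; congr (_ *: _); rewrite -mpolyXD.
apply/mpolyP => u; rewrite mcoeff_mpart mcoeffX.
have [mb|mb] := eqVneq (mdeg m) b.
  rewrite (@mpart_MI _ _ (fun u => u = m)) => [|_ ->|]; rewrite ?mb //; last exact: MI_X.
  rewrite -mpolyXD mcoeffX; case: (eqVneq (m' + m)%MM u) => [<-|_]; last by rewrite if_same.
  by rewrite mdegD m'a mb eqxx.
rewrite (@mpart_MI0 _ _ (fun u => u = m)) => [|_ ->|]; rewrite ?mb //; last exact: MI_X.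
rewrite mulr0 mcoeff0; case: (eqVneq (m' + m)%MM u) => [<-|_]; last by rewrite if_same.
by rewrite mdegD m'a eqn_add2l (negbTE mb).
Qed.

Section CoefFunctional.

Variables (k : fieldType) (n : nat) (l : 'X_{1..n} -> k^o).
Local Notation R := {mpoly k[n]}.
Local Notation B := {mpoly R[n]}.
Local Notation iota := (map_mpoly (@mpolyC n k)).

(** The functional acts on the coefficients, that is on x', and leaves x alone. *)
Definition cmlin (c : B) : R := \sum_(m <- msupp c) (mlin l c@_m : k) *: 'X_[m].

Lemma mcoeff_cmlin c m : (cmlin c)@_m = mlin l c@_m.
Proof.
rewrite /cmlin raddf_sum /=; under eq_bigr do rewrite mcoeffZ mcoeffX.
have [mc|mc] := boolP (m \in msupp c); last first.
  rewrite (memN_msupp_eq0 mc) raddf0 big_seq big1 // => i ic.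
  by rewrite (_ : (i == m) = false) ?mulr0 //; apply: contraNF mc => /eqP <-.
rewrite (bigD1_seq m) ?msupp_uniq //= eqxx mulr1 big1 ?addr0 // => i /negbTE ->.
by rewrite mulr0.
Qed.

Lemma cmlin_additive : additive cmlin.
Proof.
by move=> c1 c2; apply/mpolyP => m; rewrite mcoeffB !mcoeff_cmlin mcoeffB raddfB.
Qed.

HB.instance Definition _ := GRing.isAdditive.Build B R cmlin cmlin_additive.

Lemma cmlin_iota (c : B) (f : R) : cmlin (iota f * c) = f * cmlin c.
Proof.
have cD x y : cmlin (x + y) = cmlin x + cmlin y by exact: raddfD.
have iD x y : iota (x + y) = iota x + iota y by exact: raddfD.
have i0 : iota 0 = 0 := raddf0 _.
have c0 : cmlin 0 = 0 := raddf0 _.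
have iM x y : iota (x * y) = iota x * iota y by exact: rmorphM.
elim/mpolyind: f => [|a m f _ _ IH].
  by rewrite i0 [X in cmlin X]mul0r [RHS]mul0r c0.
rewrite iD.
rewrite mulrDl.
rewrite cD.
rewrite [X in _ + X]IH.
rewrite [RHS]mulrDl.
congr (_ + _).
rewrite -mul_mpolyC iM map_mpolyC map_mpolyX.
rewrite -[RHS]mulrA -[X in cmlin X]mulrA !mul_mpolyC.
apply/mpolyP => u; rewrite mcoeff_cmlin !mcoeffZ mul_mpolyC linearZ /=; congr (_ * _).
have [/submK uE|nle] := boolP (m <= u)%MM.
  by rewrite -uE addmC ![_ * cmlin _]mulrC ![_ * c]mulrC !mcoeffMX mcoeff_cmlin.
have Xz (A : comNzRingType) (e : {mpoly A[n]}) : ('X_[m] * e)@_u = 0.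
  apply/eqP; rewrite mcoeff_eq0 mulrC (perm_mem (msuppMX _ _)).
  by apply: contra nle => /mapP[v _ ->]; apply: lem_addr.
by rewrite !Xz raddf0.
Qed.

End CoefFunctional.

Section Morley.

Variables (k : fieldType) (d g delta om : nat).
Hypotheses (char0 : [pchar k] =i pred0) (g_ge2 : (2 <= g)%N) (g_le_d : (g <= d)%N)
  (delta_ge2 : (2 <= delta)%N) (om_case : om = 1%N \/ om = delta).

Local Notation q := (d - g)%N.
Local Notation R := {mpoly k[d]}.
Local Notation B := {mpoly R[d]}.
Local Notation wt := (@mnm_weight d g om).
Local Notation wgt := (@var_weight d g om).
Local Notation PP := (@lex_mnm d g delta om).
Local Notation iota := (map_mpoly (@mpolyC d k)).

Let nuy (l : 'I_d) : nat := if (l < g)%N then 0%N else om.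

(** In the quotient for a variable of weight 0, all variables of positive weight come earlier and
    are primed, so the whole weight lies in x'. *)
Lemma wt_prefix (a m' : 'X_{1..d}) (j : 'I_d) : (g <= j)%N ->
  (forall i : 'I_d, (i < j)%N -> m' i = a i) -> (wt a <= wt m')%N.
Proof.
move=> gj H; apply: leq_sum => i _; have [ig|gi] := ltnP i g.
  by rewrite H // (leq_trans ig gj).
by rewrite (wgt_y om gi) !muln0.
Qed.

Lemma sum_nuy : (\sum_l nuy l = q * om)%N.
Proof.
have : (\sum_(l < d) (l < g) + \sum_(l < d) ~~ (l < g)%N = d)%N.
  rewrite -big_split /= (eq_bigr (fun=> 1%N)) ?sum1_card ?card_ord // => a _.
  by case: (a < g)%N.
rewrite sum_ord_ltn // => H; have -> : q = (\sum_(l < d) ~~ (l < g)%N)%N by lia.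
rewrite big_distrl /=; apply: eq_bigr => l _; rewrite /nuy.
by case: (l < g)%N; rewrite ?mul0n ?mul1n.
Qed.

Lemma morley (f : 'I_d -> R) (h : R) (e : nat) : red g delta om f ->
  (d * (delta - 2) + g < e)%N -> MI (fun m => mdeg m = e /\ (om <= wt m)%N) h ->
  exists r : 'I_d -> R, (forall i, MI (fun m => mdeg m = (e - delta)%N) (r i)) /\
    h = \sum_i r i * f i.
Proof.
move=> fred e_big hP; have om0 := om_gt0 delta_ge2 om_case.
have le_om := om_le delta_ge2 om_case.
have [fP _] := fred.
have e_delta : (delta <= e)%N by nia.
have /fin_all_exists [D] := fun i => diff_quot (fP i).
move=> /(all_and2)[DE Dd].
have [H [HE Hd]] := diff_quot hP.
pose M : 'M[B]_d := \matrix_(i, l) D i l.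
pose Mh i : 'M[B]_d := \matrix_(a, l) if a == i then H l else M a l.
pose c i := \det (Mh i).
have nuyD N (P : 'X_{1..d} -> Prop) (G : B) l :
    (forall a, P a -> (om <= wt a)%N /\ (mdeg a = N)%N) ->
    MI2 (fun m m' => exists2 a, P a & dq a l m m') G ->
    MI2 (fun m m' => (nuy l <= wt m')%N && (mdeg m + mdeg m' <= N.-1)%N) G.
  move=> Pw; apply: MI2_S => m m' [a Pa [H0 H1 _ _]].
  have [wa dga] := Pw _ Pa; apply/andP; split; last by rewrite -dga -H0.
  rewrite /nuy; case: ltnP => // gl.
  by apply: leq_trans wa _; apply: wt_prefix gl H1.
have fw a : mdeg a = delta /\ PP 1 a -> (om <= wt a)%N /\ mdeg a = delta.
  by case=> -> /andP[_]; rewrite mul1n.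
have hw a : mdeg a = e /\ (om <= wt a)%N -> (om <= wt a)%N /\ mdeg a = e by case.
have detW (rho : 'I_d -> nat) (A : 'M[B]_d) :
    (forall i l, MI2 (fun m m' => (nuy l <= wt m')%N && (mdeg m + mdeg m' <= rho i)%N) (A i l)) ->
    MI2 (fun m m' => (q * om <= wt m')%N && (mdeg m + mdeg m' <= \sum_i rho i)%N) (\det A).
  move=> HA; rewrite -sum_nuy.
  apply: (@MI2_det _ _ (fun _ m' => wt m') (fun m m' => (mdeg m + mdeg m')%N) rho nuy) => //.
  - exact: wt0.
  - by rewrite mdeg0.
  - by move=> *; rewrite wtD.
  - by move=> *; rewrite !mdegD addnACA.
have MW : MI2 (fun m m' => (q * om <= wt m')%N && (mdeg m + mdeg m' <= d * delta.-1)%N) (\det M).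
  have := detW (fun=> delta.-1) M; rewrite sum_nat_const card_ord; apply=> i l.
  by rewrite mxE; apply: nuyD fw (Dd i l).
have cW i : MI2 (fun m m' => (q * om <= wt m')%N) (c i).
  apply: MI2_S (detW (fun a => if a == i then e.-1 else delta.-1) (Mh i) _) => [m m' /andP[]//|a l].
  rewrite mxE; case: ifP => _; first exact: nuyD hw (Hd l).
  by rewrite mxE; exact: nuyD fw (Dd a l).
(* Cramer's rule. On both sides phi is then applied in x', and the component of degree e in x is
   compared. *)
have key : (iota h - h%:MP) * \det M = \sum_i c i * (iota (f i) - (f i)%:MP).
  have FE i : iota (f i) - (f i)%:MP = \sum_l M i l * ('X_l - ('X_l)%:MP).
    by rewrite DE; apply: eq_bigr => l _; rewrite mxE.
  have K := @cramer_row B d M H _ _ FE.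
  rewrite -HE in K.
  exact: K.
have [phi [phi_lin phi0 phiD]] := residue_R char0 g_ge2 g_le_d delta_ge2 om_case fred.
have phi00 : phi 0 = 0.
  by have := phi_lin (-1) 0 0; rewrite scaler0 addr0 mulN1r addNr.
pose l : 'X_{1..d} -> k^o := fun m => phi 'X_[m].
have phE G : phi G = mlin l G.
  elim/mpolyind: G => [|a m G _ _ IH]; first by rewrite phi00 raddf0.
  by rewrite phi_lin IH [RHS]linearP /= mlinX.
have hd : MI (fun m => mdeg m = e) h by apply: MI_S hP => m [].
have ihd (b : R) a : MI (fun m => mdeg m = a) b -> MI (fun m => mdeg m = a) (iota b).
  move=> ba m; rewrite mcoeff_map_mpoly /= mpolyC_eq0; exact: ba.
have fd i : MI (fun m => mdeg m = delta) (f i) by apply: MI_S (fP i) => m [].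
pose r i := cmlin l (mpart (fun m => mdeg m == (e - delta)%N) (c i)).
have rd i : MI (fun m => mdeg m = (e - delta)%N) (r i).
  move=> m; rewrite mcoeff_cmlin mcoeff_mpart; case: ifP => [/eqP //|_].
  by rewrite raddf0 eqxx.
pose pe (x : B) := cmlin l (mpart (fun m => mdeg m == e) x).
have peB x y : pe (x - y) = pe x - pe y.
  by rewrite /pe; have -> : mpart (fun m => mdeg m == e) (x - y) = _ - _ := raddfB _ x y; exact: raddfB.
have peS (F : 'I_d -> B) : pe (\sum_i F i) = \sum_i pe (F i).
  rewrite /pe; have -> : mpart (fun m => mdeg m == e) (\sum_i F i) = _ := raddf_sum _ _ _ _.
  exact: raddf_sum.
have pe_iota (b : R) a x : MI (fun m => mdeg m = a) b -> (a <= e)%N ->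
    pe (iota b * x) = b * cmlin l (mpart (fun m => mdeg m == (e - a)%N) x).
  move=> ba ae; rewrite -cmlin_iota -(mpart_mul_homog x (e - a) (ihd _ _ ba)).
  by rewrite subnKC.
have pe_const (b : R) x : (forall m, mdeg m = e -> phi (b * x@_m) = 0) -> pe (b%:MP * x) = 0.
  move=> H0; apply/mpolyP => m; rewrite mcoeff_cmlin mcoeff_mpart mcoeff0.
  by case: eqP => [me|_]; rewrite ?raddf0 // mcoeffCM -phE H0.
have E := congr1 pe key; rewrite mulrBl peB in E.
rewrite [X in X - _](pe_iota _ _ _ hd (leqnn e)) subnn in E.
(* The term with h(x') has no component of degree e in x: weight q om forces degree at least q in
   x', so [\det M] has degree at most d (delta-1) - q = d (delta-2) + g in x. *)
rewrite [X in _ - X]pe_const ?subr0 in E; last first.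
  move=> m me; rewrite (_ : (\det M)@_m = 0) ?mulr0 //.
  apply/mpolyP => m'; rewrite mcoeff0; apply/eqP/negPn/negP => /MW /andP[h1 h2].
  have := wt_le_mdeg g m' om0; rewrite me in h2; move: e_big h1 h2; nia.
rewrite peS in E.
have D0 : cmlin l (mpart (fun m => mdeg m == 0%N) (\det M)) = (phi (\det M)@_0)%:MP.
  apply/mpolyP => m; rewrite mcoeff_cmlin mcoeff_mpart mcoeffC mdeg_eq0.
  by case: eqP => [->|_]; rewrite ?mulr1 ?mulr0 ?raddf0 // phE.
rewrite D0 in E.
(* The terms with f_i(x') are killed by phi, because [c i] has weight at least q om in x'. *)
have Ei i : pe (c i * (iota (f i) - (f i)%:MP)) = f i * r i.
  rewrite mulrBr peB mulrC (pe_iota _ _ _ (fd i) e_delta) [X in _ - X](_ : _ = 0) ?subr0 //.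
  rewrite mulrC; apply: pe_const => m _; apply: phi0; exact: cW.
(* At x = 0 the difference quotients express f(x') through x', and their column weights are those
   required by [residue_R]. *)
have nz : phi (\det M)@_0 != 0.
  have <- : \det (map_mx (mcoeff 0%MM) M) = (\det M)@_0 by exact: det_map_mx.
  apply: phiD => [i j|i].
    rewrite mxE mxE => m' /(Dd i j 0%MM) [a [da Pa] [_ _ aj /(_ erefl) [aE alt]]].
    have [wa _] := fw a (conj da Pa).
    have wj : wt a = (wt m' + wgt j)%N by rewrite -aE wtD wt1.
    rewrite /nup; have [j0|j0] := eqVneq (j : nat) 0%N.
      have wt_m : (mdeg m' <= wt m')%N.
        rewrite mdegE; apply: leq_sum => i' _.
        have [/ord_inj i'j|i'j] := eqVneq (i' : nat) j.
          by rewrite leq_pmulr // wgt_x // i'j j0; lia.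
        have ji' : (j < i')%N by rewrite j0 lt0n -j0.
        by have /eqP := alt i' ji'; rewrite -aE mnmDE addn_eq0 => /andP[/eqP -> _].
      by move: da; rewrite -aE mdegD mdeg1; lia.
    move: wj; rewrite /var_weight; case: ifP => [//|_]; case: ifP => _; lia.
  have := congr1 (mcoeff 0%MM) (DE i).
  have f0 : (f i)@_0 = 0.
    apply/eqP/negPn/negP => /(fd i); rewrite mdeg0; lia.
  have i0 : (iota (f i))@_0 = 0 by rewrite mcoeff_map_mpoly f0 raddf0.
  rewrite mcoeffB i0 mcoeffC eqxx mulr1 sub0r => /(congr1 -%R); rewrite opprK => ->.
  have -> : (\sum_l0 D i l0 * ('X_l0 - ('X_l0)%:MP))@_0 = \sum_l0 (D i l0 * ('X_l0 - ('X_l0)%:MP))@_0 := raddf_sum _ _ _ _.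
  rewrite -sumrN; apply: eq_bigr => j _; rewrite !mxE.
  have -> : (D i j * ('X_j - ('X_j)%:MP))@_0 = (D i j)@_0 * ('X_j - ('X_j)%:MP)@_0 := rmorphM (mcoeff 0%MM) _ _.
  by rewrite mcoeffB mcoeffX mcoeffC eqxx mnm1_eq0 mulr1 sub0r mulrN opprK.
exists (fun i => (phi (\det M)@_0)^-1 *: r i); split=> [i|]; first exact: MI_Z.
have E2 : phi (\det M)@_0 *: h = \sum_i pe (c i * (iota (f i) - (f i)%:MP)).
  by rewrite -mul_mpolyC mulrC E.
rewrite -[LHS]scale1r -(mulVf nz) -scalerA E2 scaler_sumr.
by apply: eq_bigr => i _; rewrite Ei -scalerAl mulrC.
Qed.

End Morley.

(** * Noether normalisation *)

Section GradedSpan.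

Variables (k : fieldType) (d g delta om : nat).
Local Notation R := {mpoly k[d]}.
Local Notation PP := (@lex_mnm d g delta om).

Definition gspan n (f : 'I_n -> R) (p : nat) (h : R) : Prop :=
  exists b : 'I_n -> R, (forall i, MI (PP p) (b i)) /\ h = \sum_i b i * f i.

Lemma gspan_0 n (f : 'I_n -> R) p : gspan f p 0.
Proof.
exists (fun=> 0); split=> [i|]; first exact: MI_0.
by rewrite big1 // => i _; rewrite mul0r.
Qed.

Lemma gspan_D n (f : 'I_n -> R) p h h' : gspan f p h -> gspan f p h' -> gspan f p (h + h').
Proof.
move=> [b [bP ->]] [b' [bP' ->]]; exists (fun i => b i + b' i); split=> [i|].
  exact: MI_D.
by rewrite -big_split; apply: eq_bigr => i _; rewrite mulrDl.
Qed.

Lemma gspan_M n (f : 'I_n -> R) p q a h : MI (PP q) a -> gspan f p h -> gspan f (q + p) (a * h).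
Proof.
move=> aP [b [bP ->]]; exists (fun i => a * b i); split=> [i|].
  by apply: MI_M aP (bP i); apply: PP_add.
by rewrite mulr_sumr; apply: eq_bigr => i _; rewrite mulrA.
Qed.

Lemma gspan_Z n (f : 'I_n -> R) p c h : gspan f p h -> gspan f p (c *: h).
Proof.
rewrite -mul_mpolyC => /(@gspan_M _ _ _ 0); apply=> m _.
by rewrite /PP !mul0n.
Qed.

Lemma gspan_N n (f : 'I_n -> R) p h : gspan f p h -> gspan f p (- h).
Proof. by rewrite -scaleN1r; apply: gspan_Z. Qed.

Lemma gspan_sum n (f : 'I_n -> R) p (I : Type) (r : seq I) (A : pred I) F :
  (forall i, A i -> gspan f p (F i)) -> gspan f p (\sum_(i <- r | A i) F i).
Proof. by move=> H; elim/big_ind: _ => //; [apply: gspan_0 | apply: gspan_D]. Qed.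

Lemma gspan_gen n (f : 'I_n -> R) p b i : MI (PP p) b -> gspan f p (b * f i).
Proof.
move=> bP; exists (fun l => if l == i then b else 0); split=> [l|].
  by case: (l == i) => //; apply: MI_0.
rewrite (bigD1 i) //= eqxx big1 ?addr0 // => l /negbTE ->; exact: mul0r.
Qed.

Lemma MI_PP_M p q (a b : R) : MI (PP p) a -> MI (PP q) b -> MI (PP (p + q)) (a * b).
Proof. by apply: MI_M; apply: PP_add. Qed.

Lemma MI_PP0 (a : R) : MI (PP 0) a.
Proof. by move=> m _; rewrite /lex_mnm !mul0n. Qed.

Lemma MI_PP_X p (a : R) e : MI (PP p) a -> MI (PP (p * e)) (a ^+ e).
Proof.
move=> aP; elim: e => [|e IH]; first by rewrite muln0; apply: MI_PP0.
by rewrite exprS mulnS; apply: MI_PP_M.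
Qed.

Lemma MI_PP_mmap1 n (f : 'I_n -> R) (m : 'X_{1..n}) : (forall i, MI (PP 1) (f i)) ->
  MI (PP (mdeg m)) (mmap1 f m).
Proof.
move=> fP; rewrite mdegE /mmap1; elim/big_rec2: _ => [|i y p _ IH]; first exact: MI_PP0.
by apply: MI_PP_M IH; have := @MI_PP_X 1 _ (m i) (fP i); rewrite mul1n.
Qed.

(** Factors are replaced one at a time; each replacement trades one factor from L for a multiple of
    f. *)
Lemma mmap1_subst n (f v w : 'I_n -> R) (m : 'X_{1..n}) p :
  (forall i, MI (PP 1) (v i)) -> (forall i, MI (PP 1) (w i)) ->
  (forall i, gspan f 0 (v i - w i)) -> mdeg m = p.+1 ->
  gspan f p (mmap1 v m - mmap1 w m).
Proof.
move=> vP wP vw; elim: p m => [|p IH] m dm.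
  have /eqP := dm; rewrite mdeg_eq1 => /existsP[i /eqP ->].
  by rewrite !mmap1U; apply: vw.
have [i mi] : exists i, m i != 0%N.
  apply/existsP; rewrite -[X in is_true X]negbK; apply/negP => /existsPn H; move: dm.
  by rewrite mdegE big1 // => i _; apply/eqP; rewrite -[_ == _]negbK; apply: H.
have mE : m = (U_(i) + (m - U_(i)))%MM by rewrite addmC submK ?lep1mP.
have dm' : mdeg (m - U_(i))%MM = p.+1 by move: dm; rewrite {1}mE mdegD mdeg1 => -[].
rewrite mE !commr_mmap1_M ?mmap1U; try by move=> *; exact: mulrC.
set a := mmap1 v _; set b := mmap1 w _.
have -> : v i * a - w i * b = v i * (a - b) + b * (v i - w i) by ring.
apply: gspan_D; first by rewrite -add1n; apply: gspan_M (vP i) (IH _ dm').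
by rewrite -[p.+1]addn0; apply: gspan_M (vw i); rewrite -dm'; apply: MI_PP_mmap1.
Qed.

End GradedSpan.

Lemma digits_inj n B (a b : nat -> nat) :
  (forall i, (i < n)%N -> (a i < B)%N) -> (forall i, (i < n)%N -> (b i < B)%N) ->
  (\sum_(i < n) a i * B ^ i = \sum_(i < n) b i * B ^ i)%N ->
  forall i, (i < n)%N -> a i = b i.
Proof.
have lt c m : (forall i, (i < m)%N -> (c i < B)%N) -> (\sum_(i < m) c i * B ^ i < B ^ m)%N.
  elim: m => [|m IH] H; first by rewrite big_ord0 expn0.
  rewrite big_ord_recr expnS /=; have := IH (fun i im => H i (ltnW im)).
  move=> lt; apply: leq_trans (_ : (c m).+1 * B ^ m <= _)%N; first by rewrite mulSn ltn_add2r.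
  by rewrite leq_mul2r H ?orbT.
elim: n => [//|n IH] Ha Hb; rewrite !big_ord_recr /= => E.
have la := lt _ _ (fun i (im : (i < n)%N) => Ha i (ltnW im)).
have lb := lt _ _ (fun i (im : (i < n)%N) => Hb i (ltnW im)).
have Bn : (0 < B ^ n)%N by case: (B ^ n)%N la.
have En : a n = b n.
  have := congr1 (fun x => x %/ B ^ n)%N E.
  by rewrite ![(_ + _ * _)%N]addnC !divnMDl // !(divn_small la, divn_small lb) !addn0.
move=> i; rewrite ltnS leq_eqVlt => /orP[/eqP->//|lin].
by apply: IH => // [j jn|j jn|]; [apply: Ha; apply: ltnW|apply: Hb; apply: ltnW|move: E; rewrite En => /addIn].
Qed.

(** * Points off a hypersurface and algebraic dependence *)

Section Field.

Variables (k : fieldType).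
Hypotheses (char0 : [pchar k] =i pred0).

Lemma poly_nonroot (Q : {poly k}) : Q != 0 -> exists2 t, t != 0 & Q.[t] != 0.
Proof.
(* The factor 'X forces the non-root to be nonzero. *)
move=> Q0; pose Q' := Q * 'X; have Q'0 : Q' != 0 by rewrite mulf_neq0 ?polyX_eq0.
pose rs := [seq (i%:R : k) | i <- iota 0 (size Q')].
have rs_uniq : uniq rs.
  rewrite map_inj_uniq ?iota_uniq // => i j /eqP.
  wlog le_ij : i j / (i <= j)%N.
    by case: (leqP i j) => [|/ltnW] le H E; [|apply/esym]; apply: H => //; rewrite eq_sym.
  rewrite eq_sym -subr_eq0 -natrB // (proj1 (pcharf0P k) char0); lia.
have /allPn[t _] : ~~ all (root Q') rs.
  by apply/negP => /(max_poly_roots Q'0) /(_ rs_uniq); rewrite size_map size_iota ltnn.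
by rewrite /root /Q' hornerMX mulf_eq0 negb_or => /andP[nQ nt]; exists t.
Qed.

(* Kronecker substitution [x_i |-> t ^ (B ^ i)]. *)
Lemma mpoly_nonroot n (P : {mpoly k[n]}) : P != 0 ->
  exists lam : 'I_n -> k, (forall i, lam i != 0) /\ P.@[lam] != 0.
Proof.
move=> P0; pose B := msize P.
pose enc (m : 'X_{1..n}) := (\sum_(i < n) m i * B ^ i)%N.
have enc_inj m m' : m \in msupp P -> m' \in msupp P -> enc m = enc m' -> m = m'.
  have small u (i : 'I_n) : u \in msupp P -> (u i < B)%N.
    by move=> /msize_mdeg_lt; apply: leq_trans; rewrite ltnS mdegE (bigD1 i) //= leq_addr.
  move=> mP mP' E; apply/mnmP => i.
  pose a (u : 'X_{1..n}) j := if insub j is Some i then u i else 0%N.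
  have aE u (j : 'I_n) : a u j = u j by rewrite /a valK.
  rewrite -!aE; apply: (@digits_inj n B (a m) (a m')) => //.
  - by move=> j jn; rewrite (aE m (Ordinal jn)); apply: small.
  - by move=> j jn; rewrite (aE m' (Ordinal jn)); apply: small.
  - rewrite /enc in E; rewrite (eq_bigr (fun i : 'I_n => m i * B ^ i)%N) => [|j _]; last by rewrite aE.
    by rewrite E; apply: eq_bigr => j _; rewrite aE.
pose Q : {poly k} := \sum_(m <- msupp P) P@_m *: 'X^(enc m).
have [m0 m0P] : exists m0, m0 \in msupp P.
  move: P0; rewrite -msupp_eq0; case: (msupp P) => [//|m0 s] _.
  by exists m0; rewrite inE eqxx.
have [|t t0 Qt] := @poly_nonroot Q.
  apply/negP => /eqP /(congr1 (fun q : {poly k} => q`_(enc m0))).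
  rewrite coef0 /Q coef_sum (bigD1_seq m0) //= big1_seq; last first.
    move=> m /andP[mm0 mP]; rewrite coefZ coefXn; case: eqP => [/enc_inj E|]; last by rewrite mulr0.
    by case/eqP: mm0; rewrite E.
  by rewrite addr0 coefZ coefXn eqxx mulr1 => /eqP; rewrite mcoeff_eq0 m0P.
exists (fun i => t ^+ (B ^ i)); split=> [i|]; first by rewrite expf_neq0.
suff -> : P.@[fun i : 'I_n => t ^+ (B ^ i)] = Q.[t] by [].
rewrite /meval /mmap /Q horner_sum; apply: eq_bigr => m _.
rewrite hornerZ hornerXn /=; congr (_ * _); rewrite /mmap1 /enc -prodrXr.
by apply: eq_bigr => i _; rewrite -exprM mulnC.
Qed.

(** Counting dimensions: the N^n monomials in f with exponents below N involve at most (C' N)^d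
    monomials, and N = C'^d + 1 makes N^n larger than C'^d N^d. *)
Lemma algebraic_dependence d n C (f : 'I_n -> {mpoly k[d]}) : (d < n)%N ->
  (forall i, MI (fun m => (mdeg m <= C)%N) (f i)) ->
  exists2 P : {mpoly k[n]}, P != 0 & mmap (@mpolyC d k) f P = 0.
Proof.
move=> dn fC.
pose C' := (C * n).+1; pose N := (C' ^ d).+1.
pose I : finType := {ffun 'I_n -> 'I_N}.
pose J : finType := {ffun 'I_d -> 'I_(C' * N)}.
pose mI (i : I) : 'X_{1..n} := [multinom (i l : nat) | l < n].
pose mJ (j : J) : 'X_{1..d} := [multinom (j l : nat) | l < d].
pose A : 'M[k]_(#|I|, #|J|) :=
  \matrix_(i, j) (mmap1 f (mI (enum_val i)))@_(mJ (enum_val j)).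
have cIJ : (#|J| < #|I|)%N.
  rewrite !card_ffun !card_ord expnMn.
  apply: leq_trans (_ : N ^ d.+1 <= _)%N; last by rewrite leq_exp2l // /N ltnS expn_gt0.
  by rewrite expnS ltn_mul2r expn_gt0 /= ltnSn.
have : kermx A != 0.
  by rewrite -mxrank_eq0 mxrank_ker; have := rank_leq_col A; lia.
case/rowV0Pn => u /sub_kermxP uA u0.
have [i0 ui0] : exists i, u 0 i != 0.
  apply/existsP; rewrite -[X in is_true X]negbK; apply/negP => /existsPn H.
  by case/eqP: u0; apply/rowP => i; rewrite mxE; apply/eqP/negPn; apply: H.
pose P : {mpoly k[n]} := \sum_i u 0 i *: 'X_[mI (enum_val i)].
exists P.
  apply/negP => /eqP /(congr1 (mcoeff (mI (enum_val i0)))); rewrite mcoeff0 /P raddf_sum /=.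
  rewrite (bigD1 i0) //= mcoeffZ mcoeffX eqxx mulr1 big1 ?addr0 => [/eqP|i ii0].
    by rewrite (negbTE ui0).
  rewrite mcoeffZ mcoeffX; case: eqP => [E|]; last by rewrite mulr0.
  case/eqP: ii0; apply: enum_val_inj; apply/ffunP => l; apply/val_inj.
  by move/mnmP: E => /(_ l); rewrite !mnmE.
rewrite /P raddf_sum /= (eq_bigr (fun i => u 0 i *: mmap1 f (mI (enum_val i)))) => [|i _]; last first.
  by rewrite mmapZ mmapX mul_mpolyC.
apply/mpolyP => m; rewrite mcoeff0 raddf_sum /=.
have [/forallP small|] := boolP [forall l, (m l < C' * N)%N].
  pose j : J := [ffun l => Ordinal (small l)].
  have -> : m = mJ (enum_val (enum_rank j)).
    by rewrite enum_rankK; apply/mnmP => l; rewrite mnmE ffunE.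
  have := congr1 (fun M : 'rV_#|J| => M 0 (enum_rank j)) uA.
  rewrite !mxE => uA'; apply: etrans uA'; apply: eq_bigr => i _; rewrite mxE mcoeffZ //.
case/forallPn => l; rewrite -leqNgt => big; rewrite big1 // => i _; rewrite mcoeffZ.
have [->|] := eqVneq (mmap1 f (mI (enum_val i)))@_m 0; first by rewrite mulr0.
have H : MI (fun m => (mdeg m <= \sum_(l < n) C * N)%N) (mmap1 f (mI (enum_val i))).
  apply: (@MI_prod_le d k (@mdeg d) _ _ _ (fun=> C * N)%N (fun l => f l ^+ mI (enum_val i) l)).
  - exact: mdeg0.
  - exact: mdegD.
  move=> l' _; rewrite -[mI _ l']subn0 -prodr_const_nat.
  apply: MI_S (@MI_prod_le d k (@mdeg d) _ _ _ (fun=> C) (fun=> f l') _ _ _) => //; last 2 first.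
  - exact: mdeg0.
  - exact: mdegD.
  move=> u' /leq_trans; apply; rewrite sum_nat_const_nat subn0 mnmE mulnC leq_mul2l.
  by rewrite (ltnW (ltn_ord _)) orbT.
move=> /H; rewrite sum_nat_const card_ord => le.
have lem : (m l <= mdeg m)%N by rewrite mdegE (bigD1 l) //= leq_addr.
have C'N : (C' * N <= mdeg m)%N := leq_trans big lem.
suff : (n * (C * N) < C' * N)%N by move: le C'N; clear; lia.
by rewrite mulnA [(n * C)%N]mulnC /C' ltn_mul2r ltnSn andbT.
Qed.

End Field.

Section Noether.

Variables (k : fieldType) (d g delta om : nat).
Hypotheses (char0 : [pchar k] =i pred0) (g_ge2 : (2 <= g)%N) (g_le_d : (g <= d)%N)
  (delta_ge2 : (2 <= delta)%N) (om_case : om = 1%N \/ om = delta).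
Local Notation R := {mpoly k[d]}.
Local Notation PP := (@lex_mnm d g delta om).
Local Notation gspan := (@gspan k d g delta om _).
Local Notation red := (@red k d g delta om _).

Lemma red_ge n (f : 'I_n -> R) : red f ->
  exists p0, forall p h, (p0 <= p)%N -> MI (PP p.+1) h -> gspan f p h.
Proof.
case=> _ [p0 Hp0]; exists p0 => p h /subnK <-; elim: (p - p0)%N h => [|j IH] h.
  exact: Hp0.
move: h; apply: MI_ind => [|h h'|c m]; [exact: gspan_0 | exact: gspan_D |].
case/(PP_split g_ge2 g_le_d delta_ge2 om_case) => m1 [m2 [P1 P2 _ ->]].
apply: gspan_Z; rewrite mpolyXD addSn -add1n.
by apply: gspan_M; [exact: MI_X | apply: IH; apply: MI_X].
Qed.

(** With a homogeneous relation Q(f) = 0 of degree e and a point lam where Q does not vanish, the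
    last f becomes nilpotent of order e modulo the forms f_i - mu_i f_last, where mu is lam divided
    by its last coordinate. Those forms therefore suffice. *)
Lemma noether_step n (f : 'I_n.+1 -> R) : (d < n.+1)%N -> red f ->
  exists c : 'I_n -> 'I_n.+1 -> k, red (fun j => \sum_i c j i *: f i).
Proof.
move=> dn fred; have [fP _] := fred; have [p0 Hp0] := red_ge fred.
have fPP i : MI (PP 1) (f i) by apply: MI_S (fP i) => m [].
have [|P P0 Pf] := @algebraic_dependence k d n.+1 delta f dn.
  by move=> i; apply: MI_S (fP i) => m [->].
have [m0 m0P] : exists m0, m0 \in msupp P.
  move: P0; rewrite -msupp_eq0; case: (msupp P) => [//|m0 s] _.
  by exists m0; rewrite inE eqxx.
pose e := mdeg m0; pose Q := mpart (fun m => mdeg m == e) P.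
have Qe : MI (fun m => mdeg m = e) Q.
  by move=> m; rewrite mcoeff_mpart; case: (eqVneq (mdeg m) e) => //; rewrite eqxx.
have Q0 : Q != 0.
  apply/negP => /eqP /(congr1 (mcoeff m0)); rewrite mcoeff_mpart eqxx mcoeff0 => /eqP.
  by rewrite mcoeff_eq0 m0P.
have fmon (m : 'X_{1..n.+1}) : MI (fun u => mdeg u = (mdeg m * delta)%N) (mmap1 f m).
  rewrite mdegE big_distrl /mmap1 /=; elim/big_rec2: _ => [|i y s _ IH].
    by move=> u; rewrite mcoeff1; case: (eqVneq u 0%MM) => [->|]; rewrite ?mdeg0 ?eqxx.
  apply: (MI_M (P := fun u => mdeg u = (m i * delta)%N) _ _ IH).
    by move=> u v; rewrite mdegD => -> ->.
  elim: (m i) => [|a IHa]; first by move=> u; rewrite expr0 mcoeff1; case: (eqVneq u 0%MM) => [->|]; rewrite ?mdeg0 ?eqxx.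
  rewrite exprS mulSn; apply: (MI_M (P := fun u => mdeg u = delta) _ _ IHa).
    by move=> u v; rewrite mdegD => -> ->.
  by apply: MI_S (fP i) => u [->].
(* The f_i are homogeneous of the same degree, so each homogeneous part of a relation is a
   relation. *)
have Qf : mmap (@mpolyC d k) f Q = 0.
  transitivity (mpart (fun u => mdeg u == (e * delta)%N) (mmap (@mpolyC d k) f P)); last first.
    by rewrite Pf raddf0.
  rewrite /Q /mpart raddf_sum /= -/(mpart _ _) [mmap _ _ P]/mmap raddf_sum /= big_mkcond /=.
  apply: eq_bigr => m _; rewrite mul_mpolyC linearZ /= mmapZ mmapX mul_mpolyC.
  have [em|em] := eqVneq (mdeg m) e.
    have H : forall u : 'X_{1..d}, mdeg u = (mdeg m * delta)%N -> mdeg u == (e * delta)%N.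
      by move=> u ->; rewrite em.
    by rewrite (mpart_MI H (fmon m)).
  have H : forall u : 'X_{1..d}, mdeg u = (mdeg m * delta)%N -> ~~ (mdeg u == e * delta)%N.
    by move=> u ->; rewrite eqn_pmul2r // (ltn_trans _ delta_ge2).
  by rewrite (mpart_MI0 H (fmon m)) scaler0.
have [lam [lam0 Qlam]] := mpoly_nonroot char0 Q0.
pose mu i := lam i / lam ord_max.
pose v i := f i - mu i *: f ord_max.
have e_gt0 : (0 < e)%N.
  rewrite lt0n; apply/negP => /eqP e0; move: Qf Q0.
  have -> : Q = (Q@_0)%:MP.
    apply/mpolyP => m; rewrite mcoeffC; case: (eqVneq m 0%MM) => [->|m0n]; first by rewrite mulr1.
    rewrite mulr0; apply/eqP/negPn/negP => /Qe; rewrite e0 => /eqP.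
    by rewrite mdeg_eq0 (negbTE m0n).
  by rewrite mmapC => /eqP; rewrite !mpolyC_eq0 => /eqP ->; rewrite eqxx.
have vspan i : gspan v 0 (f i - mu i *: f ord_max).
  by have := @gspan_gen k d g delta om _ v 0 1 i (@MI_PP0 _ _ _ _ _ 1); rewrite mul1r.
have wPP i : MI (PP 1) (mu i *: f ord_max) by apply: MI_Z.
have Emon m : mmap1 (fun i => mu i *: f ord_max) m = mmap1 mu m *: f ord_max ^+ mdeg m.
  rewrite /mmap1 mdegE -prodrXr -scaler_prod; apply: eq_bigr => i _; by rewrite exprZn.
have Elam m : mmap1 mu m * lam ord_max ^+ mdeg m = mmap1 lam m.
  rewrite /mmap1 mdegE -prodrXr -big_split; apply: eq_bigr => i _ /=.
  by rewrite -exprMn divfK.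
(* Replacing f_i by mu_i f_last in Q(f) = 0 leaves Q(mu) f_last^e, and Q(mu) differs from Q(lam) by
   a power of the last coordinate. *)
have top : gspan v e.-1 (f ord_max ^+ e).
  have : gspan v e.-1 (\sum_(m <- msupp Q) Q@_m *: (mmap1 f m - mmap1 (fun i => mu i *: f ord_max) m)).
    rewrite big_seq; apply: gspan_sum => m; rewrite mcoeff_msupp => /Qe dm.
    by apply/gspan_Z/mmap1_subst => //; rewrite dm prednK.
  under eq_bigr do rewrite scalerBr.
  rewrite sumrB [X in gspan _ _ (X - _)](_ : _ = 0); last first.
    by rewrite -[RHS]Qf /mmap; apply: eq_bigr => m _; rewrite mul_mpolyC.
  rewrite sub0r => /gspan_N; rewrite opprK.
  rewrite big_seq (eq_bigr (fun m => (Q@_m * mmap1 mu m) *: f ord_max ^+ e)); last first.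
    by move=> m; rewrite mcoeff_msupp => /Qe dm; rewrite Emon dm scalerA.
  rewrite -scaler_suml -big_seq => H.
  have nz : \sum_(m <- msupp Q) Q@_m * mmap1 mu m != 0.
    apply: contraNneq Qlam => Z; rewrite /meval /mmap big_seq.
    rewrite (eq_bigr (fun m => Q@_m * mmap1 mu m * lam ord_max ^+ e)); last first.
      by move=> m; rewrite mcoeff_msupp => /Qe dm; rewrite -Elam dm mulrA.
    by rewrite -mulr_suml -big_seq Z mul0r.
  by rewrite -[_ ^+ e]scale1r -(mulVf nz) -scalerA; apply: gspan_Z.
have all_mon m : mdeg m = e -> gspan v e.-1 (mmap1 f m).
  move=> dm; rewrite -[mmap1 f m](subrK (mmap1 (fun i => mu i *: f ord_max) m)).
  apply: gspan_D; first by apply: mmap1_subst => //; rewrite dm prednK.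
  by rewrite Emon dm; apply: gspan_Z.
(* Factors f_i are pulled out of h, r in number, until the monomial in f has degree e. *)
have step r m h : (mdeg m + r = e)%N -> MI (PP (p0 + r)) h ->
    gspan v (p0 + e.-1) (h * mmap1 f m).
  elim: r m h => [|r IH] m h dm hP.
    by rewrite !addn0 in dm hP; exact: gspan_M hP (all_mon _ dm).
  have [|b [bP ->]] := Hp0 (p0 + r)%N h (leq_addr _ _); first by rewrite -addnS.
  rewrite mulr_suml; apply: gspan_sum => i _; rewrite -mulrA -{1}(mmap1U f i).
  rewrite -commr_mmap1_M; last by move=> *; exact: mulrC.
  by apply: IH => //; rewrite mdegD mdeg1 -dm; lia.
pose xw := widen_ord (leqnSn n).
exists (fun j i => (i == xw j)%:R - mu (xw j) * (i == ord_max)%:R).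
have vE j : \sum_i ((i == xw j)%:R - mu (xw j) * (i == ord_max)%:R) *: f i = v (xw j).
  under eq_bigr do rewrite scalerBl -scalerA.
  rewrite sumrB -scaler_sumr /v; congr (_ - _ *: _).
    by rewrite (bigD1 (xw j)) //= eqxx scale1r big1 ?addr0 // => i /negbTE ->; rewrite scale0r.
  by rewrite (bigD1 ord_max) //= eqxx scale1r big1 ?addr0 // => i /negbTE ->; rewrite scale0r.
split=> [j|].
  by rewrite vE; apply: MI_B; [apply: fP | apply: MI_Z; apply: fP].
exists (p0 + e.-1)%N => h hP; have := step e 0%MM h.
rewrite mdeg0 mmap11 mulr1 => /(_ erefl) [].
  by rewrite -(prednK e_gt0) addnS.
move=> b [bP ->]; exists (fun j => b (xw j)); split=> [j|]; first exact: bP.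
(* The last form is zero by the choice of mu, so one generator fewer remains. *)
by rewrite big_ord_recr /= {2}/v /mu divff // scale1r subrr mulr0 addr0; apply: eq_bigr => j _; rewrite vE.
Qed.

Lemma red_ext n (f f' : 'I_n -> R) : f =1 f' -> red f -> red f'.
Proof.
move=> ff' [fP [p Hp]]; split=> [i|]; first by rewrite -ff'.
exists p => h /Hp [b [bP ->]]; exists b; split=> //.
by apply: eq_bigr => i _; rewrite ff'.
Qed.

Lemma noether n (f : 'I_n -> R) : red f ->
  exists c : 'I_d -> 'I_n -> k, red (fun j => \sum_i c j i *: f i).
Proof.
elim: n f => [|n IH] f fred; last have [nd|dn] := leqP n.+1 d; first 1 last.
(* At most d elements: the family is padded with zeros. *)
- move: fred => [fP [p Hp]]; pose c (j : 'I_d) (i : 'I_n.+1) : k := (i == j :> nat)%:R.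
  exists c; have fE (i : 'I_n.+1) : \sum_l c (widen_ord nd i) l *: f l = f i.
    rewrite (bigD1 i) //= /c eqxx scale1r big1 ?addr0 // => l li.
    by rewrite (_ : (l == _ :> nat) = false) ?scale0r //; apply: negbTE.
  split=> [j|]; first by apply: MI_sum => i _; apply: MI_Z; exact: fP.
  exists p => h /Hp [b [bP ->]]; apply: gspan_sum => i _; rewrite -{1}(fE i).
  have := @gspan_gen k d g delta om d (fun j => \sum_i c j i *: f i) p (b i) (widen_ord nd i) (bP i).
  by [].
- have [c /IH [c' Hc]] := noether_step dn fred.
  exists (fun l i => \sum_j c' l j * c j i); apply: red_ext Hc => l.
  under eq_bigr do rewrite scaler_sumr.
  rewrite exchange_big; apply: eq_bigr => i _; rewrite scaler_suml.
  by apply: eq_bigr => j _; rewrite scalerA.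
- exists (fun=> fun=> 0); case: fred => _ [p Hp]; split=> [j|].
    by rewrite big_ord0; apply: MI_0.
  exists p => h /Hp [b [_ ->]]; rewrite big_ord0; apply: gspan_0.
Qed.

End Noether.

Lemma mpart_lead n (A : comNzRingType) (mf : 'X_{1..n} -> nat) a b (f h : {mpoly A[n]}) :
  {morph mf : m1 m2 / (m1 + m2)%MM >-> (m1 + m2)%N} ->
  MI (fun m => (a <= mf m)%N) f -> MI (fun m => (b <= mf m)%N) h ->
  mpart (fun m => mf m == (a + b)%N) (f * h) =
    mpart (fun m => mf m == a) f * mpart (fun m => mf m == b) h.
Proof.
move=> mfD fa; move: h; apply: MI_ind => [|h1 h2 E1 E2|c m bm].
- by rewrite mulr0 !raddf0 mulr0.
- by rewrite mulrDr !raddfD /= E1 E2 mulrDr.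
move: f fa; apply: MI_ind => [|f1 f2 E1 E2|c' m' am'].
- by rewrite mul0r !raddf0 mul0r.
- by rewrite mulrDl !raddfD /= E1 E2 mulrDl.
have XE (p : pred 'X_{1..n}) u : mpart p 'X_[u] = if p u then 'X_[A, u] else 0.
  apply/mpolyP => v; rewrite mcoeff_mpart mcoeffX.
  case: (eqVneq u v) => [->|uv]; first by case: ifP; rewrite ?mcoeffX ?mcoeff0 ?eqxx.
  by rewrite if_same; case: ifP; rewrite ?mcoeffX ?mcoeff0 ?(negbTE uv).
rewrite -scalerAl -scalerAr !linearZ /= -mpolyXD !XE mfD -scalerAl -scalerAr; congr (_ *: (_ *: _)).
have -> : (mf m' + mf m == a + b)%N = (mf m' == a) && (mf m == b).
  by apply/eqP/andP => [E|[/eqP-> /eqP->] //]; split; apply/eqP; lia.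
by case: (mf m' == a); case: (mf m == b); rewrite ?mulr0 ?mul0r ?mpolyXD.
Qed.

Section ReductionGenerators.

Variables (k : fieldType) (d g delta om : nat).
Hypotheses (char0 : [pchar k] =i pred0) (g_ge2 : (2 <= g)%N) (g_le_d : (g <= d)%N)
  (delta_ge2 : (2 <= delta)%N) (om_case : om = 1%N \/ om = delta).
Local Notation R := {mpoly k[d]}.
Local Notation PP := (@lex_mnm d g delta om).
Local Notation gspan := (@gspan k d g delta om _).
Local Notation red := (@red k d g delta om _).
Local Notation hpart e := (mpart (fun m => mdeg m == e%N)).

Lemma PP_min p m : PP p m ->
  exists m1 m2, [/\ PP p m1, mdeg m1 = (p * delta)%N & m = (m1 + m2)%MM].
Proof.
elim: p m => [|p IH] m; first by exists 0%MM, m; split; rewrite ?mdeg0 ?add0m // /lex_mnm !mul0n.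
case/(PP_split g_ge2 g_le_d delta_ge2 om_case) => m1 [m2 [P1 /IH [m3 [m4 [P3 d3 ->]]] d1 ->]].
exists (m1 + m3)%MM, m4; split; last by rewrite addmA.
  by rewrite -add1n; apply: PP_add.
by rewrite mdegD d1 d3 mulSn.
Qed.

Lemma gspan_incl n n' (f : 'I_n -> R) (f' : 'I_n' -> R) p h :
  (forall i, exists j, f i = f' j) -> gspan f p h -> gspan f' p h.
Proof.
move=> ff' [b [bP ->]]; apply: gspan_sum => i _.
by have [j ->] := ff' i; apply: gspan_gen.
Qed.

(** Comparing lowest degrees in L^(p+1) = J L^p shows that the parts of degree [delta] of elements
    of J reduce L already. Finitely many suffice, one batch for each monomial of degree (p+1) delta,
    and Noether normalisation brings them down to d. *)
Lemma reduction_red J L : ideal_eq L (MI (PP 1)) -> is_reduction J L ->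
  exists a : 'I_d -> R, (forall i, J (a i)) /\ red (fun i => hpart delta (a i)).
Proof.
move=> LE [Ji JL [p redJ]]; have [J0 JD JM] := Ji.
have JP a : J a -> MI (PP 1) a by move=> /JL /LE.
have LP q h : ideal_exp L q h <-> MI (PP q) h.
  by rewrite (ideal_exp_eq q LE h); have := exp_PP g_ge2 g_le_d delta_ge2 om_case q h; exact.
have hJP a : J a -> MI (fun m => mdeg m = delta /\ PP 1 m) (hpart delta a).
  by move=> /JP aP; apply: MI_S (MI_mpart aP) => m [? /eqP].
have one mu : PP p.+1 mu -> mdeg mu = (p.+1 * delta)%N ->
    exists n (a : 'I_n -> R), (forall i, J (a i)) /\ gspan (fun i => hpart delta (a i)) p 'X_[mu].
  move=> Pmu dmu.
  have : ideal_exp L p.+1 'X_[mu].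
    by apply/LP; apply: MI_X.
  move/(redJ p (leqnn p)) => [n [r [s [/fin_all_exists [a /fin_all_exists [b sE]] XE]]]].
  exists n, a; split=> [i|]; first by have [] := sE i.
  have bP i : MI (PP p) (r i * b i).
    have [_ Lb _] := sE i; have [_ _] := MI_ideal k (@PP_upc d g delta om p); apply.
    by apply/LP.
  have aP i : MI (PP 1) (a i) by apply: JP; have [] := sE i.
  have -> : 'X_[mu] = \sum_i hpart (p * delta) (r i * b i) * hpart delta (a i) :> R.
    have -> : 'X_[mu] = hpart (p * delta + delta) 'X_[mu] :> R.
      have muP : MI (fun u => u = mu) ('X_[mu] : R) by exact: MI_X.
      by rewrite (mpart_MI _ muP) // => u ->; rewrite dmu mulSn addnC.
    rewrite XE raddf_sum; apply: eq_bigr => i _; have [_ _ ->] := sE i.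
    rewrite /= mulrA [r i * a i * b i]mulrAC (mpart_lead (@mdegD d)) //.
      by apply: MI_S (bP i) => u /andP[].
    by apply: MI_S (aP i) => u /andP[]; rewrite mul1n.
  apply: gspan_sum => i _; apply: (@gspan_gen _ _ _ _ _ _ (fun i => hpart delta (a i))).
  by apply: MI_S (MI_mpart (bP i)) => u [].
have many (s : seq 'X_{1..d}) : exists n (a : 'I_n -> R), (forall i, J (a i)) /\
    forall mu, mu \in s -> PP p.+1 mu -> mdeg mu = (p.+1 * delta)%N ->
      gspan (fun i => hpart delta (a i)) p 'X_[mu].
  elim: s => [|mu s [n [a [aJ aP]]]]; first by exists 0%N, (fun=> 0); split.
  have [/andP[Pmu /eqP dmu]|nmu] := 
    boolP ((p.+1 * delta <= mdeg mu) && (p.+1 * om <= mnm_weight g om mu) && (mdeg mu == p.+1 * delta))%N; last first.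
    exists n, a; split=> // mu'; rewrite inE => /orP[/eqP->|]; last exact: aP.
    by move=> Pmu dmu; case/negP: nmu; rewrite {2}dmu eqxx andbT.
  have [n' [a' [aJ' aP']]] := one mu Pmu dmu.
  pose c (i : 'I_(n + n')) := match split i with inl j => a j | inr j => a' j end.
  have cl i : c (lshift n' i) = a i by rewrite /c (unsplitK (inl i)).
  have cr i : c (rshift n i) = a' i by rewrite /c (unsplitK (inr i)).
  exists (n + n')%N, c; split=> [i|mu']; first by rewrite /c; case: (split i).
  rewrite inE => /orP[/eqP-> _ _|mus Pmu' dmu'].
    by apply: gspan_incl aP' => i; exists (rshift n i); rewrite cr.
  by apply: gspan_incl (aP mu' mus Pmu' dmu') => i; exists (lshift n' i); rewrite cl.
pose D := (p.+1 * delta).+1.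
have [n [a [aJ aP]]] := many [seq val mu | mu : 'X_{1..d < D}].
have ared : red (fun i => hpart delta (a i)).
  split=> [i|]; first exact: hJP.
  exists p; apply: MI_ind => [|h h'|c mu]; [exact: gspan_0 | exact: gspan_D |].
  case/PP_min => m1 [m2 [P1 d1 ->]]; rewrite addmC mpolyXD.
  apply: gspan_Z; rewrite -[p]add0n; apply: gspan_M; first exact: MI_PP0.
  apply: aP => //; have m1D : (mdeg m1 < D)%N by rewrite d1.
  by apply/mapP; exists (BMultinom m1D); rewrite ?mem_enum.
have [c cred] := noether char0 g_ge2 g_le_d delta_ge2 om_case ared.
exists (fun j => \sum_i c j i *: a i); split=> [j|].
  by apply: ideal_sum => // i _; rewrite -mul_mpolyC; apply: JM.
by apply: red_ext cred => j; rewrite raddf_sum /=; apply: eq_bigr => i _; rewrite linearZ.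
Qed.

End ReductionGenerators.

(** * Every reduction contains the large monomials *)

Definition ideal_adj (A : comNzRingType) (K : A -> Prop) (x : A) : A -> Prop :=
  fun f => exists c, K (f + c * x).

Lemma ideal_adj_ideal (A : comNzRingType) (K : A -> Prop) x : is_ideal K -> is_ideal (ideal_adj K x).
Proof.
move=> [K0 KD KM]; split; first by exists 0; rewrite mul0r addr0.
  move=> a b [c Kc] [c' Kc']; exists (c + c').
  by rewrite mulrDl addrACA; apply: KD.
by move=> r a [c Kc]; exists (r * c); rewrite -mulrA -mulrDr; apply: KM.
Qed.

(* Division-free Gaussian elimination on the linear forms [\sum_j u_j T_j] with
   [\sum_j u_j xi_j] in [K]: the hypothesis says that, once y is inverted, these forms
   have no common zero besides the origin at any point of any base. *)
Lemma ideal_elimination (A : comNzRingType) r (xi : 'I_r -> A) (y : A) N (K : A -> Prop) :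
  is_ideal K ->
  (forall (lam : 'I_r -> A) i, exists a u,
     \sum_j u j * lam j = y ^+ a * lam i ^+ N /\ K (\sum_j u j * xi j)) ->
  exists T, forall i, K (y ^+ T * xi i).
Proof.
suff main s : (s <= r)%N -> forall K' : A -> Prop, is_ideal K' ->
    (forall f, K f -> K' f) -> (forall i : 'I_r, (s <= i)%N -> K' (xi i)) ->
    (forall (lam : 'I_r -> A) i, exists a u,
      \sum_j u j * lam j = y ^+ a * lam i ^+ N /\ K (\sum_j u j * xi j)) ->
    exists T, forall i, K' (y ^+ T * xi i).
  by move=> Ki H; apply: (main r) => // i; rewrite leqNgt ltn_ord.
elim: s => [_|s IH sr] K' Ki KK' Kxi H.
  by exists 0%N => i; rewrite expr0 mul1r; apply: Kxi.
have [K0 KD KM] := Ki.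
pose i0 := Ordinal sr.
have [T /fin_all_exists [c cP]] : exists T, forall i, ideal_adj K' (xi i0) (y ^+ T * xi i).
  apply: (IH (ltnW sr)) => //; first exact: ideal_adj_ideal.
    by move=> f /KK' Kf; exists 0; rewrite mul0r addr0.
  move=> i; rewrite leq_eqVlt => /orP[/eqP si|/Kxi Ki'].
    by exists (-1); rewrite (_ : i = i0) ?mulN1r ?subrr //; apply/val_inj.
  by exists 0; rewrite mul0r addr0.
(* Modulo K', the vector y^T xi is xi_s times this vector. A form in K with value y^(a + T N) at it
   yields y^(a + T N) xi_s in K'. *)
pose lam i := if i == i0 then y ^+ T else - c i.
have [a [u [uE /KK' Ku]]] := H lam i0.
have top : K' (y ^+ (a + T * N) * xi i0).
  have -> : y ^+ (a + T * N) * xi i0 = y ^+ T * (\sum_j u j * xi j)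
      - \sum_(j | j != i0) u j * (y ^+ T * xi j + c j * xi i0).
    have lam0 : lam i0 = y ^+ T by rewrite /lam eqxx.
    rewrite exprD exprM -{1}lam0 -uE (bigD1 i0) //= [in RHS](bigD1 i0) //= lam0.
    rewrite !mulrDl mulrDr -addrA; congr (_ + _); first by ring.
    rewrite mulr_suml mulr_sumr -sumrB; apply: eq_bigr => j /negbTE ji.
    by rewrite /lam ji; ring.
  apply: ideal_sub => //; first exact: KM.
  by apply: ideal_sum => // j _; apply: KM.
exists (T + (a + T * N))%N => i.
have -> : y ^+ (T + (a + T * N)) * xi i = y ^+ (a + T * N) * (y ^+ T * xi i + c i * xi i0)
    - c i * (y ^+ (a + T * N) * xi i0) by rewrite exprD; ring.
by apply: ideal_sub => //; apply: KM.
Qed.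

(** * Agreement of J and L after inverting a variable *)

Section Globalisation.

Variables (k : fieldType) (d g delta om : nat).
Hypotheses (g_ge2 : (2 <= g)%N) (g_le_d : (g <= d)%N)
  (delta_ge2 : (2 <= delta)%N) (om_case : om = 1%N \/ om = delta).
Local Notation R := {mpoly k[d]}.
Local Notation wt := (@mnm_weight d g om).
Local Notation wgt := (@var_weight d g om).
Local Notation PP := (@lex_mnm d g delta om).

(* The variables to the power [cofac] all have weight [om]. *)
Definition cofac (i : 'I_d) : nat := (om %/ wgt i)%N.

Lemma cofacE (i : 'I_d) : (i < g)%N ->
  (wgt i * cofac i = om)%N /\ (cofac i = 1%N \/ i = g.-1 :> nat).
Proof.
move=> ig; have om0 := om_gt0 delta_ge2 om_case.
rewrite /cofac /var_weight; case: (ltnP i g.-1) => i1; first by rewrite divnn om0 muln1; auto.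
by rewrite ig divn1 mul1n; split=> //; right; lia.
Qed.

Lemma cofac_gt0 (i : 'I_d) : (i < g)%N -> (0 < cofac i)%N.
Proof.
move=> ig; have om0 := om_gt0 delta_ge2 om_case; have [] := cofacE ig.
by case: (cofac i) => // E _; move: om0; rewrite -E muln0.
Qed.

Lemma wt_ge_om m : (om <= wt m)%N -> exists2 i : 'I_d, (i < g)%N & (cofac i <= m i)%N.
Proof.
move=> h; have om0 := om_gt0 delta_ge2 om_case.
have g1d : (g.-1 < d)%N by lia.
pose e := Ordinal g1d.
have [/existsP[i /andP[ig mi]]|/existsPn none] := boolP [exists i : 'I_d, (i < g.-1)%N && (0 < m i)%N].
  exists i; first by lia.
  by have [_ [-> //|]] := @cofacE i (ltac:(lia)); lia.
exists e; first by rewrite /=; lia.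
have we : wgt e = 1%N by rewrite /var_weight /= ltnn (_ : g.-1 < g)%N //; lia.
have <- : wt m = m e.
  rewrite /mnm_weight (bigD1 e) //= we muln1 big1 ?addn0 // => i ie.
  have := none i; rewrite negb_and -leqNgt -eqn0Ngt => /orP[|/eqP-> //].
  rewrite leq_eqVlt => /orP[/eqP ig|ig]; last by rewrite wgt_y ?muln0 //; lia.
  by move: ie; rewrite (_ : i = e) ?eqxx //; apply/val_inj.
by rewrite /cofac we divn1.
Qed.

Lemma cofac_dvd m (i : 'I_d) : (om %| wt m)%N -> (i < g)%N -> (cofac i %| m i)%N.
Proof.
move=> wm ig; have [wc [->|ig1]] := cofacE ig; first exact: dvd1n.
have wi : wgt i = 1%N by rewrite /var_weight ig1 ltnn (_ : g.-1 < g)%N //; lia.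
rewrite /cofac wi divn1; move: wm; rewrite /mnm_weight (bigD1 i) //= wi muln1 dvdn_addl //.
apply: dvdn_sum => l li; rewrite dvdn_mull // /var_weight; case: ifP => // lg.
case: ltnP => // lg'; have /eqP := li; case; apply/val_inj => /=; lia.
Qed.

Section Evaluation.

Variable lam : 'I_d -> R.

(* Substitutes [lam i] for ['X_i ^+ cofac i]; multiplicative on monomials whose
   weight is a multiple of [om]. *)
Definition evm (m : 'X_{1..d}) : R :=
  \prod_(i < d) (if (i < g)%N then lam i ^+ (m i %/ cofac i) else 'X_i ^+ m i).

Definition evl : R -> R := mlin evm.

Lemma evmD m m' : (om %| wt m)%N -> evm (m + m') = evm m * evm m'.
Proof.
move=> wm; rewrite -big_split; apply: eq_bigr => i _ /=; rewrite mnmDE.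
by case: ifP => ig; rewrite -exprD // divnDl // cofac_dvd.
Qed.

Lemma evm_y m : wt m = 0%N -> evm m = 'X_[m].
Proof.
move=> wm; rewrite -[RHS]mmap1_id; apply: eq_bigr => i _ /=; case: ifP => // ig.
have : (m i * wgt i <= wt m)%N by rewrite /mnm_weight (bigD1 i) //= leq_addr.
rewrite wm leqn0 muln_eq0 => /orP[/eqP->|/eqP wi]; first by rewrite div0n.
by have := wgt_x (om_gt0 delta_ge2 om_case) ig; rewrite wi.
Qed.

Lemma evm_cofac (i : 'I_d) N : (i < g)%N -> evm ((U_(i) *+ cofac i) *+ N) = lam i ^+ N.
Proof.
move=> ig; rewrite /evm (bigD1 i) //= ig big1 ?mulr1 => [|l li].
  by rewrite !mulmnE mnm1E eqxx mul1n mulKn // cofac_gt0.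
by rewrite !mulmnE mnm1E eq_sym (negbTE li) !mul0n div0n !expr0; case: ifP.
Qed.

Lemma evlM f h : MI (fun m => wt m = om) f -> evl (f * h) = evl f * evl h.
Proof.
move=> fw; rewrite [h]mpolyE; elim/big_ind: _ => [|h1 h2 E1 E2|m' _].
- by rewrite mulr0 /evl !raddf0 mulr0.
- by rewrite mulrDr /evl !raddfD /= -/evl E1 E2 mulrDr.
move: f fw; apply: MI_ind => [|f1 f2 E1 E2|c m wm].
- by rewrite mul0r /evl !raddf0 mul0r.
- by rewrite mulrDl /evl !raddfD /= -/evl E1 E2 mulrDl.
rewrite -scalerAl -scalerAr -mpolyXD /evl !linearZ /= !mlinX evmD ?wm //.
by rewrite -scalerAl -scalerAr.
Qed.

End Evaluation.

Let xi (i : 'I_d) : R := if (i < g)%N then 'X_i ^+ cofac i else 0.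

(** A monomial of weight exactly [om] is some [xi i] times a monomial of weight 0, and evaluation
    leaves the latter unchanged; so the same coefficients serve for both. *)
Lemma lead_decomp lam f : MI (fun m => wt m = om) f ->
  exists u : 'I_d -> R, f = \sum_i u i * xi i /\ evl lam f = \sum_i u i * lam i.
Proof.
move: f; apply: MI_ind => [|f h [u [-> uE]] [v [-> vE]]|c m wm].
- by exists (fun=> 0); split; rewrite /evl ?raddf0; rewrite big1 // => i _; rewrite mul0r.
- exists (fun i => u i + v i); split.
    by rewrite -big_split; apply: eq_bigr => i _; rewrite mulrDl.
  rewrite /evl raddfD /= -/(evl _) uE vE -big_split; by apply: eq_bigr => i _; rewrite mulrDl.
have [|i ig mi] := @wt_ge_om m; first by rewrite wm.
have [wc _] := cofacE ig.
have le_m : (U_(i) *+ cofac i <= m)%MM.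
  apply/mnm_lepP => l; rewrite mulmnE mnm1E; case: eqP => [<-|//]; by rewrite mul1n.
have wU : wt (U_(i) *+ cofac i)%MM = om by rewrite wtMn wt1.
have w0 : wt (m - U_(i) *+ cofac i)%MM = 0%N.
  by have := wm; rewrite -{1}(submK le_m) wtD wU; lia.
have mE : m = (U_(i) *+ cofac i + (m - U_(i) *+ cofac i))%MM by rewrite addmC submK.
exists (fun l => if l == i then c *: 'X_[m - U_(i) *+ cofac i] else 0); split.
  rewrite (bigD1 i) //= eqxx big1 ?addr0 => [|l /negbTE ->]; last by rewrite mul0r.
  by rewrite /xi ig mpolyXn -scalerAl -mpolyXD addmC -mE.
rewrite (bigD1 i) //= eqxx big1 ?addr0 => [|l /negbTE ->]; last by rewrite mul0r.
rewrite /evl linearZ /= mlinX {1}mE evmD ?wU // (evm_y _ w0).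
by have := @evm_cofac lam i 1 ig; rewrite mulm1n expr1 => ->; rewrite -scalerAl mulrC.
Qed.

Variables (J : R -> Prop) (p : nat).
Hypotheses (Ji : is_ideal J) (JPP : forall f, J f -> MI (PP 1) f)
  (Jp : forall h, MI (PP p.+1) h -> ideal_mul J (MI (PP p)) h).

Let JP h : MI (PP p.+1) h -> J h.
Proof.
have [J0 JD JM] := Ji.
move=> /Jp [n [r [s [Hs ->]]]]; apply: ideal_sum => // i _.
by have [a [b [Ja _ ->]]] := Hs i; apply: (JM); rewrite mulrC; apply: JM.
Qed.

Let K := ideal_add J (MI (fun m => (om < wt m)%N)).

Let wt_upc w : upc (fun m => (w <= wt m)%N).
Proof. by move=> m m' /= h; rewrite wtD; lia. Qed.

Lemma ideal_add_ideal (A : comNzRingType) (I I' : A -> Prop) :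
  is_ideal I -> is_ideal I' -> is_ideal (ideal_add I I').
Proof.
move=> [I0 ID IM] [I0' ID' IM']; split.
- by exists 0, 0; rewrite addr0.
- move=> _ _ [a [b [Ia Ib ->]]] [a' [b' [Ia' Ib' ->]]].
  exists (a + a'), (b + b'); split; [exact: ID|exact: ID'|by rewrite addrACA].
- move=> r _ [a [b [Ia Ib ->]]]; exists (r * a), (r * b).
  by split; [exact: IM|exact: IM'|rewrite mulrDr].
Qed.

Let Ki : is_ideal K.
Proof. by apply: ideal_add_ideal => //; apply/MI_ideal/wt_upc. Qed.

(** The hypothesis of [ideal_elimination]. The element y_j^a xi_i^(p+1) lies in L^(p+1) = J L^p, so
    by taking components of weight (p+1) om it is a combination of the weight-om components of
    elements of J; evaluation at lam gives the identity. *)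
Lemma lead_eval (j : 'I_d) : (g <= j)%N -> forall (lam : 'I_d -> R) i, exists a u,
  \sum_l u l * lam l = 'X_j ^+ a * lam i ^+ p.+1 /\ K (\sum_l u l * xi l).
Proof.
move=> gj lam i; have om0 := om_gt0 delta_ge2 om_case; have [K0 KD KM] := Ki.
have [gi|ig] := leqP g i.
  exists 0%N, (fun l => if l == i then lam i ^+ p else 0); split.
    rewrite (bigD1 i) //= eqxx big1 ?addr0 => [|l /negbTE ->]; last by rewrite mul0r.
    by rewrite mul1r exprSr.
  rewrite big1 // => l _; case: eqP => [->|_]; last by rewrite mul0r.
  by rewrite /xi ltnNge gi mulr0.
pose a := (delta * p.+1)%N.
pose mu := (U_(j) *+ a + (U_(i) *+ cofac i) *+ p.+1)%MM.
have [wc _] := cofacE ig.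
have wj : wt (U_(j) *+ a)%MM = 0%N by rewrite wtMn wt1 wgt_y.
have wmu : wt mu = (om + p * om)%N by rewrite wtD wj !wtMn wt1 wc mulnS mulnC.
have : MI (PP p.+1) ('X_[mu] : R).
  apply: MI_X; rewrite /lex_mnm wmu mulSn leqnn andbT /mu mdegD mdegMn mdeg1 mul1n.
  by apply: leq_trans (leq_addr _ _); rewrite -mulSn /a mulnC.
move=> /Jp [n [r [s [/fin_all_exists [b /fin_all_exists [c sE]] XE]]]].
pose f i := mpart (fun m => wt m == om) (b i).
pose h i := mpart (fun m => wt m == (p * om)%N) (r i * c i).
have fw i' : MI (fun m => wt m = om) (f i').
  by move=> m; rewrite mcoeff_mpart; case: (eqVneq (wt m) om); rewrite ?eqxx.
have bPP i' : MI (fun m => (om <= wt m)%N) (b i').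
  by have [/JPP bP _ _] := sE i'; apply: MI_S bP => m /andP[_]; rewrite mul1n.
have /fin_all_exists [u uE] := fun i' => lead_decomp lam (fw i').
exists a, (fun l => \sum_i' evl lam (h i') * u i' l); split.
  transitivity (evl lam 'X_[mu]).
    have -> : 'X_[mu] = \sum_i' f i' * h i' :> R.
      transitivity (mpart (fun m => wt m == (om + p * om)%N) ('X_[mu] : R)).
        have muP : MI (fun u => u = mu) ('X_[mu] : R) by exact: MI_X.
        by rewrite (mpart_MI _ muP) // => v ->; rewrite wmu.
      rewrite XE raddf_sum; apply: eq_bigr => i' _ /=; have [_ cP ->] := sE i'.
      rewrite mulrCA (mpart_lead (@wtD d g om)) //.
      by apply: (@MI_M _ _ (fun=> True) (PP p)) cP => // m1 m2 _ /andP[_]; rewrite wtD; lia.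
    rewrite /evl raddf_sum /= -/(evl _).
    under eq_bigr do rewrite mulr_suml.
    rewrite exchange_big; apply: eq_bigr => i' _ /=; have [_ uE'] := uE i'.
    rewrite -/(evl lam _) evlM // uE' mulrC mulr_sumr; by apply: eq_bigr => l _; rewrite mulrA.
  by rewrite /evl mlinX evmD ?wj ?dvdn0 // evm_y // evm_cofac // mpolyXn.
under eq_bigr do rewrite mulr_suml.
rewrite exchange_big; apply: ideal_sum => // i' _.
have -> : \sum_l evl lam (h i') * u i' l * xi l = evl lam (h i') * f i'.
  have [fE _] := uE i'; rewrite fE mulr_sumr; by apply: eq_bigr => l _; rewrite mulrA.
apply: KM; exists (b i'), (f i' - b i'); split; last by rewrite addrC subrK.
  by have [] := sE i'.
move=> m; rewrite mcoeffB mcoeff_mpart; have [->|wm] := eqVneq (wt m) om; first by rewrite subrr eqxx.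
by rewrite sub0r oppr_eq0 => /bPP; lia.
Qed.

Lemma power_mem (j : 'I_d) : exists T, forall m, (om <= wt m)%N -> (T <= m j)%N -> J 'X_[m].
Proof.
have om0 := om_gt0 delta_ge2 om_case; have le_om := om_le delta_ge2 om_case.
have [J0 JD JM] := Ji.
have deg_j (m : 'X_{1..d}) : (m j <= mdeg m)%N by rewrite mdegE (bigD1 j) //= leq_addr.
(* A large power of a variable of positive weight lies in L^(p+1), hence in J. *)
have [jg|gj] := ltnP j g.
  exists (delta * p.+1)%N => m _ mj; apply: JP; apply: MI_X; rewrite /lex_mnm mulnC.
  rewrite (leq_trans mj (deg_j m)) /=.
  apply: leq_trans (_ : m j * wgt j <= _)%N; last by rewrite /mnm_weight (bigD1 j) //= leq_addr.
  have := wgt_x om0 jg; rewrite mulnC; move: mj; nia.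
have [T0 HT] := ideal_elimination Ki (lead_eval gj).
(* Modulo J, multiplication by y_j^T0 raises the weight by at least one. *)
have step n h : (om <= n)%N -> MI (fun m => (n <= wt m)%N) h ->
    ideal_add J (MI (fun m => (n < wt m)%N)) ('X_j ^+ T0 * h).
  move=> on; have [I0 ID IM] : is_ideal (ideal_add J (MI (fun m => (n < wt m)%N))).
    by apply: ideal_add_ideal => //; apply/MI_ideal/wt_upc.
  move: h; apply: MI_ind => [|h h'|c m nm]; first by rewrite mulr0.
    by rewrite mulrDr; apply: ID.
  rewrite -mul_mpolyC mulrCA; apply: IM.
  have [i ig mi] := @wt_ge_om m (leq_trans on nm).
  have le_m : (U_(i) *+ cofac i <= m)%MM.
    apply/mnm_lepP => l; rewrite mulmnE mnm1E; case: eqP => [<-|//]; by rewrite mul1n.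
  have [a [b [Ja bw E]]] := HT i; rewrite /xi ig mpolyXn in E.
  have wU : wt (U_(i) *+ cofac i)%MM = om by rewrite wtMn wt1; have [] := cofacE ig.
  exists ('X_[m - U_(i) *+ cofac i] * a), ('X_[m - U_(i) *+ cofac i] * b); split.
  - exact: JM.
  - apply: (@MI_M _ _ (fun u => u = (m - U_(i) *+ cofac i)%MM)) bw; last exact: MI_X.
    move=> _ u -> uw; have := nm; rewrite -{1}(submK le_m) !wtD wU; lia.
  - by rewrite -mulrDr -E mulrCA -mpolyXD submK.
have iter s h : MI (fun m => (om <= wt m)%N) h ->
    ideal_add J (MI (fun m => (om + s <= wt m)%N)) ('X_j ^+ (T0 * s) * h).
  move=> hw; elim: s => [|s [a [b [Ja bw E]]]].
    by exists 0, h; split=> //; [rewrite addn0 | rewrite muln0 mul1r add0r].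
  have [|a' [b' [Ja' bw' E']]] := step (om + s)%N b _ bw; first exact: leq_addr.
  exists ('X_j ^+ T0 * a + a'), b'; split; first by apply: JD => //; apply: JM.
    by apply: MI_S bw' => m; rewrite addnS.
  by rewrite mulnS exprD -mulrA E mulrDr E' addrA.
(* After s such steps the weight exceeds om (p+1); the other power of y_j supplies the degree needed
   to land in L^(p+1). *)
pose s := (om * p.+1)%N; exists (T0 * s + delta * p.+1)%N => m wm mj.
have le_m : (U_(j) *+ (T0 * s + delta * p.+1) <= m)%MM.
  apply/mnm_lepP => l; rewrite mulmnE mnm1E; case: eqP => [<-|//]; by rewrite mul1n.
set m' := (m - U_(j) *+ (T0 * s + delta * p.+1))%MM.
have wm' : (om <= wt m')%N.
  by move: wm; rewrite -{1}(submK le_m) wtD wtMn wt1 wgt_y // mul0n addn0.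
have -> : 'X_[m] = 'X_j ^+ (delta * p.+1) * ('X_j ^+ (T0 * s) * 'X_[m']) :> R.
  by rewrite mulrA -exprD mpolyXn -mpolyXD addmC addnC submK.
have [|a [b [Ja bw ->]]] := iter s 'X_[m']; first exact: MI_X.
rewrite mulrDr; apply: JD; first exact: JM.
apply: JP; apply: (@MI_M _ _ (fun u => u = (U_(j) *+ (delta * p.+1))%MM)) bw; last first.
  by rewrite mpolyXn; apply: MI_X.
move=> _ u -> uw; rewrite /lex_mnm mdegD mdegMn mdeg1 wtD; apply/andP; split; lia.
Qed.

(** By pigeonhole some exponent reaches its threshold from [power_mem]. *)
Lemma reduction_contains_high : exists s, forall h,
  MI (fun m => (s <= mdeg m)%N && (om <= wt m)%N) h -> J h.
Proof.
have /fin_all_exists [T HT] := power_mem; have [J0 JD JM] := Ji.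
exists (\sum_j T j).+1; apply: MI_ind => // c m /andP[sm wm].
rewrite -mul_mpolyC; apply: JM.
have /existsP[j mj] : [exists j, (T j <= m j)%N].
  apply: contraLR sm => /existsPn H; rewrite -leqNgt mdegE; apply: leq_sum => j _.
  by apply: ltnW; rewrite ltnNge; apply: H.
exact: HT mj.
Qed.

End Globalisation.

Section CoreContains.

Variables (k : fieldType) (d g delta om : nat).
Hypotheses (char0 : [pchar k] =i pred0) (g_ge2 : (2 <= g)%N) (g_le_d : (g <= d)%N)
  (delta_ge2 : (2 <= delta)%N) (om_case : om = 1%N \/ om = delta).
Local Notation R := {mpoly k[d]}.
Local Notation wt := (@mnm_weight d g om).
Local Notation PP := (@lex_mnm d g delta om).

Lemma reduction_contains J L : ideal_eq L (MI (PP 1)) -> is_reduction J L ->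
  forall h : R, MI (fun m => (d * (delta - 2) + g < mdeg m)%N && (om <= wt m)%N) h -> J h.
Proof.
move=> LE Jred; have [a [aJ ared]] := reduction_red char0 g_ge2 g_le_d delta_ge2 om_case LE Jred.
have [Ji JL [p redJ]] := Jred; have [J0 JD JM] := Ji.
have JPP f : J f -> MI (PP 1) f by move=> /JL /LE.
have Jp h : MI (PP p.+1) h -> ideal_mul J (MI (PP p)) h.
  have LP q h' : ideal_exp L q h' <-> MI (PP q) h'.
    by rewrite (ideal_exp_eq q LE h'); have := exp_PP g_ge2 g_le_d delta_ge2 om_case q h'; exact.
  by move=> /LP /(redJ p (leqnn p)); apply: ideal_mul_le => // h' /LP.
have [s Js] := reduction_contains_high g_ge2 g_le_d delta_ge2 om_case Ji JPP Jp.
set Q := fun n (m : 'X_{1..d}) => (n <= mdeg m)%N && (om <= wt m)%N.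
(* [morley] writes the lowest component of h through the initial parts of the a_i. Using the a_i
   themselves instead leaves an error of higher degree and of weight at least [om]. *)
have step n h : (d * (delta - 2) + g < n)%N -> MI (Q n) h ->
    exists j r, [/\ J j, MI (Q n.+1) r & h = j + r].
  move=> n_big hQ; pose hn := mpart (fun m => mdeg m == n) h.
  have hnP : MI (fun m => mdeg m = n /\ (om <= wt m)%N) hn.
    by apply: MI_S (MI_mpart hQ) => m [/andP[_ ?] /eqP].
  have [r [rP hE]] := morley char0 g_ge2 g_le_d delta_ge2 om_case ared n_big hnP.
  exists (\sum_i r i * a i), (h - \sum_i r i * a i); split; last by rewrite addrC subrK.
    by apply: ideal_sum => // i _; apply: JM.
  have -> : h - \sum_i r i * a i = (h - hn) - \sum_i r i * (a i - mpart (fun m => mdeg m == delta) (a i)).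
    rewrite [in RHS](eq_bigr (fun i => r i * a i - r i * mpart (fun m => mdeg m == delta) (a i))).
      by rewrite sumrB -hE; ring.
    by move=> i _; rewrite mulrBr.
  apply: MI_B.
    move=> m; rewrite /hn mcoeffB mcoeff_mpart /=; have [_|mn] := eqVneq (mdeg m) n; first by rewrite subrr eqxx.
    by rewrite subr0 => /hQ /andP[nm ?]; apply/andP; split=> //; rewrite ltn_neqAle eq_sym mn.
  apply: MI_sum => i _; apply: (@MI_M _ _ (fun m => mdeg m = (n - delta)%N) (Q delta.+1)) (rP i) _.
    move=> m1 m2 d1 /andP[d2 w2]; rewrite /Q mdegD wtD; apply/andP; split; last by lia.
    by rewrite d1; have := om_gt0 delta_ge2 om_case; lia.
  move=> m; rewrite mcoeffB mcoeff_mpart /=; have [_|mn] := eqVneq (mdeg m) delta; first by rewrite subrr eqxx.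
  rewrite subr0 => /(JPP _ (aJ i)) /andP[]; rewrite !mul1n => d1 w1.
  by rewrite /Q w1 andbT ltn_neqAle eq_sym mn.
have iter t n h : (d * (delta - 2) + g < n)%N -> (s <= n + t)%N -> MI (Q n) h -> J h.
  elim: t n h => [|t IH] n h n_big sn hQ.
    by apply: Js; apply: MI_S hQ => m /andP[dm ->]; rewrite andbT; lia.
  have [j [r [Jj rQ ->]]] := step n h n_big hQ.
  by apply: JD => //; apply: IH rQ; lia.
by move=> h; apply: (iter s _ h (ltnSn _) (leq_addl _ _)).
Qed.

End CoreContains.

(** * A reduction avoiding a given element *)

Lemma mulmnDr n (m : 'X_{1..n}) a b : (m *+ (a + b) = m *+ a + m *+ b)%MM.
Proof. by apply/mnmP => i; rewrite mnmDE !mulmnE mulnDr. Qed.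

Section GradedRadical.

Variables (k : fieldType) (d g delta om n : nat) (f : 'I_n -> {mpoly k[d]}).
Local Notation R := {mpoly k[d]}.
Local Notation PP := (@lex_mnm d g delta om).
Local Notation gspan := (@gspan k d g delta om n f).

(* A graded radical of the ideal generated by f, relative to the powers of L. *)
Definition grad (p : nat) (h : R) : Prop :=
  MI (PP p) h /\ exists2 N, (0 < N)%N & gspan (p * N).-1 (h ^+ N).

Lemma grad_gen i : MI (PP 1) (f i) -> grad 1 (f i).
Proof.
move=> fP; split=> //; exists 1%N => //.
by rewrite -[_ ^+ 1]mul1r; apply: gspan_gen; apply: MI_PP0.
Qed.

Lemma grad_M p q a h : (0 < p)%N -> MI (PP q) a -> grad p h -> grad (q + p) (a * h).
Proof.
move=> p0 aP [hP [N N0 hN]]; split; first exact: MI_PP_M.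
exists N => //; rewrite exprMn (_ : (_ * N).-1 = q * N + (p * N).-1)%N; last first.
  have pN : (0 < p * N)%N by rewrite muln_gt0 p0.
  by rewrite mulnDl; lia.
by apply: gspan_M hN; apply: MI_PP_X.
Qed.

Lemma grad_root p e h : (0 < e)%N -> MI (PP p) h -> grad (p * e) (h ^+ e) -> grad p h.
Proof.
move=> e0 hP [_ [N N0 hN]]; split=> //; exists (e * N)%N; first by rewrite muln_gt0 e0.
by rewrite mulnA exprM.
Qed.

Lemma grad_0 p : grad p 0.
Proof. by split; [exact: MI_0 | exists 1%N; rewrite ?expr1 //; apply: gspan_0]. Qed.

(** In each term of the binomial expansion one of the two exponents reaches its bound. *)
Lemma grad_D p h h' : (0 < p)%N -> grad p h -> grad p h' -> grad p (h + h').
Proof.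
move=> p0 [hP [N N0 hN]] [hP' [N' N0' hN']]; split; first exact: MI_D.
exists (N + N')%N; first by lia.
have pN : (0 < p * N)%N by rewrite muln_gt0 p0.
have pN' : (0 < p * N')%N by rewrite muln_gt0 p0.
rewrite exprDn; apply: gspan_sum => i _; rewrite -scaler_nat; apply: gspan_Z.
have := ltn_ord i; rewrite ltnS => le_i; have [iN|iN] := leqP i N'.
  have -> : (p * (N + N')).-1 = (p * i + (p * (N' - i) + (p * N).-1))%N.
    have : (p * N' = p * i + p * (N' - i))%N by rewrite -mulnDr subnKC.
    by rewrite mulnDr; lia.
  rewrite mulrC; apply: gspan_M; first exact: MI_PP_X.
  rewrite (_ : N + N' - i = N' - i + N)%N; last by lia.
  by rewrite exprD; apply: gspan_M => //; apply: MI_PP_X.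
have -> : (p * (N + N')).-1 = (p * (N + N' - i) + (p * (i - N') + (p * N').-1))%N.
  have : (p * (N + N') = p * (N + N' - i) + p * i)%N by rewrite -mulnDr subnK.
  have : (p * i = p * (i - N') + p * N')%N by rewrite -mulnDr subnK // ltnW.
  lia.
apply: gspan_M; first exact: MI_PP_X.
rewrite -{2}(subnK (ltnW iN)) exprD; apply: gspan_M => //; exact: MI_PP_X.
Qed.

Lemma grad_Z p c h : (0 < p)%N -> grad p h -> grad p (c *: h).
Proof. by move=> p0; rewrite -mul_mpolyC -{2}[p]add0n; apply: grad_M => //; apply: MI_PP0. Qed.

Lemma grad_B p h h' : (0 < p)%N -> grad p h -> grad p h' -> grad p (h - h').
Proof. by move=> p0 Hh Hh'; apply: grad_D => //; rewrite -scaleN1r; apply: grad_Z. Qed.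

Lemma grad_sum p (I : Type) (r : seq I) (A : pred I) F : (0 < p)%N ->
  (forall i, A i -> grad p (F i)) -> grad p (\sum_(i <- r | A i) F i).
Proof.
move=> p0 H; elim/big_ind: _ => //; first exact: grad_0.
by move=> *; apply: grad_D.
Qed.

Hypotheses (g_ge2 : (2 <= g)%N) (g_le_d : (g <= d)%N)
  (delta_ge2 : (2 <= delta)%N) (om_case : om = 1%N \/ om = delta).

(** Pigeonhole: among more than sum N generators of L, some t occurs at least N(t) times, and the
    N(t)-th power of t lies in (f) L^(N(t)-1). *)
Lemma grad_red : (forall i, MI (fun m => mdeg m = delta /\ PP 1 m) (f i)) ->
  (forall m, mdeg m = delta -> PP 1 m -> grad 1 'X_[m]) -> red g delta om f.
Proof.
move=> fP H; split=> //.
pose T : finType := 'X_{1..d < delta.+1}.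
pose good (t : T) := (mdeg t == delta) && ((1 * delta <= mdeg t) && (1 * om <= mnm_weight g om t))%N.
have /fin_all_exists [N HN] (t : T) : exists N, good t ->
    (0 < N)%N /\ gspan N.-1 ('X_[t] ^+ N).
  have [/andP[/eqP dt Pt]|_] := boolP (good t); last by exists 0%N.
  by have [_ [N N0 HN]] := H t dt Pt; exists N; rewrite mul1n in HN.
have dec p m : PP p m -> exists (kap : T -> nat) m',
    [/\ forall t, (0 < kap t)%N -> good t, (\sum_t kap t = p)%N &
       m = (\sum_(t : T) (t : 'X_{1..d}) *+ kap t + m')%MM].
  elim: p m => [|p IH] m.
    move=> _; exists (fun=> 0%N), m; split=> //; first by rewrite big1.
    by rewrite big1 ?add0m // => t _; rewrite mulm0n.
  case/(PP_split g_ge2 g_le_d delta_ge2 om_case) => m1 [m2 [P1 /IH [kap [m' [kg ks kE]]] d1 ->]].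
  have m1D : (mdeg m1 < delta.+1)%N by rewrite d1.
  pose t1 : T := BMultinom m1D.
  exists (fun t => (t == t1) + kap t)%N, m'; split.
  - move=> t; case: eqP => [->|_]; last by rewrite add0n; apply: kg.
    by rewrite /good d1 eqxx /=; move: P1; rewrite /lex_mnm d1.
  - by rewrite big_split /= ks (bigD1 t1) //= eqxx big1 ?addn0 // => t /negbTE ->.
  - rewrite kE addmA; congr (_ + _)%MM; under [in RHS]eq_bigr do rewrite mulmnDr.
    rewrite big_split /= [X in _ = (X + _)%MM](_ : _ = m1) //.
    by rewrite (bigD1 t1) //= eqxx mulm1n big1 ?addm0 // => t /negbTE ->; rewrite mulm0n.
exists (\sum_t N t)%N; apply: MI_ind => [|h h'|c m /dec]; [exact: gspan_0|exact: gspan_D|].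
case=> kap [m' [kg ks ->]]; apply: gspan_Z.
(* The second condition makes t a generator of L; for other t the value of N is the default 0. *)
have /existsP[t Nt] : [exists t, (N t <= kap t) && (0 < kap t)]%N.
  apply: contraT => /existsPn none.
  have : (\sum_t kap t <= \sum_t N t)%N.
    apply: leq_sum => t _; have := none t; rewrite negb_and -!ltnNge ltnS; lia.
  by rewrite ks ltnn.
case/andP: Nt => Nt kt; have [N0 HN'] := HN t (kg t kt).
have PPX e (t' : T) : (0 < e)%N -> good t' -> PP e ((t' : 'X_{1..d}) *+ e)%MM.
  move=> _ /andP[_ /andP[]]; rewrite !mul1n => d1 w1.
  by rewrite /lex_mnm mdegMn wtMn ![(e * _)%N]mulnC !leq_mul.
have PP0 u : PP 0 u by rewrite /lex_mnm !mul0n.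
have PPk e t' : (e <= kap t')%N -> PP e ((t' : 'X_{1..d}) *+ e)%MM.
  case: e => [//|e] le; apply: PPX => //; apply: kg; exact: leq_trans (ltn0Sn e) le.
pose rest := (\sum_(t' | t' != t) (t' : 'X_{1..d}) *+ kap t')%MM.
have restP : PP (\sum_(t' | t' != t) kap t') rest.
  rewrite /rest; elim/big_rec2: _ => // t2 u p _ IH; exact: PP_add (PPk _ _ (leqnn _)) IH.
have -> : (\sum_t N t)%N = ((\sum_(t' | t' != t) kap t' + (kap t - N t)) + (N t).-1)%N.
  by move: ks; rewrite (bigD1 t) //=; lia.
have -> : (\sum_(t' : T) (t' : 'X_{1..d}) *+ kap t' + m' =
    (rest + (t *+ (kap t - N t) + m')) + t *+ N t)%MM.
  rewrite (bigD1 t) //= -/rest -[in LHS](subnK Nt) mulmnDr.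
  by apply/mnmP => l; rewrite !mnmDE; lia.
rewrite mpolyXD -mpolyXn; apply: gspan_M => //; apply: MI_X.
by apply: PP_add => //; rewrite -[X in PP X]addn0; apply: PP_add => //; apply: PPk; apply: leq_subr.
Qed.

End GradedRadical.

Lemma MI_mdegM n (A : comNzRingType) a b (f h : {mpoly A[n]}) :
  MI (fun m => mdeg m = a) f -> MI (fun m => mdeg m = b) h ->
  MI (fun m => mdeg m = (a + b)%N) (f * h).
Proof. by apply: MI_M => m1 m2 <- <-; rewrite mdegD. Qed.

Lemma MI_mdegX n (A : comNzRingType) a e (f : {mpoly A[n]}) :
  MI (fun m => mdeg m = a) f -> MI (fun m => mdeg m = (a * e)%N) (f ^+ e).
Proof.
move=> fa; elim: e => [|e IH]; last by rewrite exprS mulnS; apply: MI_mdegM.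
by move=> m; rewrite mcoeff1 muln0; case: (eqVneq m 0%MM) => [->|]; rewrite ?mdeg0 ?eqxx.
Qed.

Section SpecialReduction.

Variables (k : fieldType) (d g delta om p : nat).
Hypotheses (g_ge2 : (2 <= g)%N) (g_le_d : (g <= d)%N)
  (delta_ge2 : (2 <= delta)%N) (om_p : om = 1%N /\ p = g \/ om = delta /\ p = g.-1).
Local Notation R := {mpoly k[d]}.
Local Notation wt := (@mnm_weight d g om).
Local Notation wgt := (@var_weight d g om).
Local Notation PP := (@lex_mnm d g delta om).
Local Notation q := (d - g)%N.

Let om_case : om = 1%N \/ om = delta. Proof. by case: om_p => [] [-> _]; auto. Qed.
Let p_gt0 : (0 < p)%N. Proof. by case: om_p => [] [_ ->]; lia. Qed.
Let p_le_g : (p <= g)%N. Proof. by case: om_p => [] [_ ->]; lia. Qed.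

Definition lin_y : R := \sum_(l : 'I_d | (p <= l)%N) 'X_l.
(** Chosen so that x_1 is the sum of its own form and of the variables x_(p+1), ..., x_d. A power of
    x_1 can then be spread over all of these. *)
Definition spec_ell (i : 'I_d) : R := 'X_i - lin_y.
(* [c = Some l] stands for the variable y_(l-g+1), and [c = None] for [spec_ell i]. *)
Definition spec_z (i : 'I_d) (c : option 'I_d) : R := if c is Some l then 'X_l else spec_ell i.
Definition spec_rank (c : option 'I_d) : nat := if c is Some l then (l - g)%N else q.
Definition spec_ok (c : option 'I_d) : bool := if c is Some l then (g <= l)%N else true.
Definition spec_term (ic : 'I_d * option 'I_d) : R := 'X_ic.1 * spec_z ic.1 ic.2 ^+ delta.-1.
Definition spec_diag (n : nat) (ic : 'I_d * option 'I_d) : bool :=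
  [&& (ic.1 < p)%N, spec_ok ic.2 & (ic.1 + spec_rank ic.2 == n)%N].
Definition spec_row (n : nat) : R := \sum_(ic | spec_diag n ic) spec_term ic.
(** There are p+q antidiagonals; for p = g-1 the power of x_g is added, which makes d generators in
    both cases. *)
Definition spec_gen (l : 'I_d) : R :=
  if (l < p)%N then spec_row (q + l)%N else if (l < g)%N then 'X_l ^+ delta else spec_row (l - g)%N.

Lemma wgt_p (i : 'I_d) : (i < p)%N -> wgt i = om.
Proof.
rewrite /var_weight; case: om_p => [] [-> ->] ip; last by rewrite ip.
by rewrite ip; case: ifP.
Qed.

Lemma wgt_v (i : 'I_d) : (p <= i)%N -> (i < g)%N -> wgt i = 1%N /\ om = delta.
Proof.
rewrite /var_weight; case: om_p => [] [-> ->] pi ig; first by rewrite ltnNge pi in ig.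
by rewrite ltnNge pi ig.
Qed.

Lemma MI_var (i : 'I_d) : @MI d k (fun m => mdeg m = 1%N) 'X_i.
Proof. by apply: MI_X; rewrite mdeg1. Qed.

Lemma zz_deg i c : @MI d k (fun m => mdeg m = 1%N) (spec_z i c).
Proof.
case: c => [l|]; first exact: MI_var.
by apply: MI_B; [|apply: MI_sum => l _]; apply: MI_var.
Qed.

Lemma MI_varM (i : 'I_d) (h : R) : (i < p)%N -> MI (fun m => mdeg m = delta.-1) h ->
  @MI d k (fun m => mdeg m = delta /\ PP 1 m) ('X_i * h).
Proof.
move=> ip; apply: (@MI_M _ _ (fun u => u = U_(i)%MM)); last exact: MI_X.
move=> _ m -> dm; have d_m : mdeg (U_(i) + m)%MM = delta by rewrite mdegD mdeg1 dm; lia.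
by split=> //; rewrite /lex_mnm d_m mul1n leqnn mul1n wtD wt1 wgt_p // leq_addr.
Qed.

Lemma zzX_deg i c : @MI d k (fun m => mdeg m = delta.-1) (spec_z i c ^+ delta.-1).
Proof. by rewrite -[X in MI (fun m => _ = X)]mul1n; apply/MI_mdegX/zz_deg. Qed.

Lemma FF_PP n : @MI d k (fun m => mdeg m = delta /\ PP 1 m) (spec_row n).
Proof. by apply: MI_sum => -[i c] /and3P[/= ip _ _]; exact: MI_varM ip (@zzX_deg i c). Qed.

Lemma ff_PP l : @MI d k (fun m => mdeg m = delta /\ PP 1 m) (spec_gen l).
Proof.
rewrite /spec_gen; case: ltnP => lp; first exact: FF_PP.
case: ltnP => lg; last exact: FF_PP.
have [wl omE] := wgt_v lp lg.
rewrite mpolyXn; apply: MI_X; rewrite mdegMn mdeg1 mul1n; split=> //.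
by rewrite /lex_mnm mdegMn mdeg1 wtMn wt1 wl omE !mul1n leqnn.
Qed.

Lemma FF_row n : (n < p + q)%N -> exists l, spec_row n = spec_gen l.
Proof.
move=> npq; have [nq|qn] := ltnP n q.
  have ld : (g + n < d)%N by lia.
  exists (Ordinal ld); rewrite /spec_gen /= [(g + n < p)%N]ltnNge (leq_trans p_le_g) ?leq_addr //=.
  by rewrite ltnNge leq_addr /= addKn.
have ld : (n - q < d)%N by lia.
have lp : (n - q < p)%N by lia.
by exists (Ordinal ld); rewrite /spec_gen /= lp subnKC.
Qed.

Local Notation grad := (@grad k d g delta om d spec_gen).

Lemma zrk_inj c c' : spec_ok c -> spec_ok c' -> spec_rank c = spec_rank c' -> c = c'.
Proof.
case: c c' => [l|] [l'|] //=.
- by move=> gl gl' E; congr Some; apply/val_inj => /=; lia.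
- by move=> gl _; have := ltn_ord l; lia.
- by move=> _ gl; have := ltn_ord l'; lia.
Qed.

(** Only the choice of largest rank depends on i. The one of smaller rank is a variable, which can
    be exchanged between two terms of an antidiagonal. *)
Lemma zrk_lt c c' : spec_ok c -> spec_ok c' -> (spec_rank c < spec_rank c')%N -> exists l, c = Some l.
Proof.
case: c => [l|] /=; first by exists l.
by case: c' => [l'|] /= _ _; [have := ltn_ord l'|]; lia.
Qed.

(* Schmitt-Vogel: modulo earlier antidiagonals, the square of a term is a multiple
   of the sum of its antidiagonal. *)
Lemma grad_tau (i : 'I_d) c : (i < p)%N -> spec_ok c -> grad 1 (spec_term (i, c)).
Proof.
have [n] := ubnP (i + spec_rank c)%N; elim: n i c => // n IH i c lt_n ip cok.
have tauP (i' : 'I_d) c' : (i' < p)%N -> MI (PP 1) (spec_term (i', c')).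
  by move=> ip'; apply: MI_S (MI_varM ip' (@zzX_deg i' c')) => m [].
apply: (@grad_root _ _ _ _ _ _ _ 1 2) => //; first exact: tauP.
rewrite (_ : 1 * 2 = 1 + 1)%N //.
have ad : spec_diag (i + spec_rank c)%N (i, c) by rewrite /spec_diag /= ip cok eqxx.
have -> : spec_term (i, c) ^+ 2 = spec_term (i, c) * spec_row (i + spec_rank c)
    - \sum_(ic | spec_diag (i + spec_rank c)%N ic && (ic != (i, c))) spec_term (i, c) * spec_term ic.
  by rewrite /spec_row (bigD1 (i, c)) //= mulrDr mulr_sumr expr2; ring.
apply: grad_B => //.
  have zq : (spec_rank c <= q)%N by case: (c) cok => [l|] //= gl; have := ltn_ord l; lia.
  have [|l ->] := @FF_row (i + spec_rank c)%N; first by lia.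
  apply: (@grad_M _ _ _ _ _ _ _ 1 1) => //; first exact: tauP.
  by apply: grad_gen; apply: MI_S (@ff_PP l) => m [].
apply: grad_sum => // -[i' c'] /andP[/and3P[/= ip' cok' /eqP E] ne].
have [lt_i|lt_i|/val_inj eq_i] := ltngtP i i'.
- have [|l' c'E] := @zrk_lt c' c cok' cok; first by lia.
  have -> : spec_term (i, c) * spec_term (i', c') = ('X_i' * spec_z i c ^+ delta.-1) * spec_term (i, c').
    by rewrite /spec_term c'E /=; ring.
  apply: (@grad_M _ _ _ _ _ _ _ 1 1) => //; last by apply: IH => //; lia.
  by apply: MI_S (MI_varM ip' (@zzX_deg i c)) => m [].
- have [|l cE] := @zrk_lt c c' cok cok'; first by lia.
  have -> : spec_term (i, c) * spec_term (i', c') = ('X_i * spec_z i' c' ^+ delta.-1) * spec_term (i', c).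
    by rewrite /spec_term cE /=; ring.
  apply: (@grad_M _ _ _ _ _ _ _ 1 1) => //; last by apply: IH => //; lia.
  by apply: MI_S (MI_varM ip (@zzX_deg i' c')) => m [].
- by case/eqP: ne; rewrite eq_i; congr (_, _); apply: zrk_inj => //; move: E; rewrite eq_i; lia.
Qed.

(** A power of such a monomial is divisible by the generator x_l^delta if l < g, and by the term x_i
    x_l^(delta-1) otherwise. *)
Lemma grad_xl (i l : 'I_d) h : (i < p)%N -> (p <= l)%N ->
  MI (fun m => mdeg m = (delta - 2)%N) h -> grad 1 ('X_i * 'X_l * h).
Proof.
move=> ip pl; move: h; apply: MI_ind => [|h h' Hh Hh'|c m' dm'].
- by rewrite mulr0; apply: grad_0.
- by rewrite mulrDr; apply: grad_D.
rewrite -scalerAr; apply: grad_Z => //.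
have d1 : mdeg (U_(i) + U_(l) + m')%MM = delta by rewrite !mdegD !mdeg1 dm'; lia.
have P1 : @MI d k (PP 1) ('X_i * 'X_l * 'X_[m']).
  rewrite -!mpolyXD; apply: MI_X; rewrite /lex_mnm d1 !mul1n leqnn !wtD wt1 wgt_p //.
  by rewrite -addnA leq_addr.
have [lg|gl] := ltnP l g.
  have [wl omE] := wgt_v pl lg.
  apply: (@grad_root _ _ _ _ _ _ _ 1 delta) => //; first by lia.
  have -> : 'X_i * 'X_l * 'X_[m'] = 'X_i * 'X_[m'] * 'X_l :> R by rewrite mulrAC.
  rewrite exprMn (_ : 1 * delta = delta.-1 + 1)%N; last by lia.
  apply: grad_M => //; last first.
    have -> : 'X_l ^+ delta = spec_gen l by rewrite /spec_gen ltnNge pl lg.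
    by apply: grad_gen; apply: MI_S (@ff_PP l) => m [].
  rewrite -mpolyXD mpolyXn; apply: MI_X.
  have dm : mdeg (U_(i) + m')%MM = delta.-1 by rewrite mdegD mdeg1 dm'; lia.
  rewrite /lex_mnm mdegMn wtMn dm leqnn wtD wt1 wgt_p // [X in (_ <= X)%N]mulnC leq_mul ?leq_addr //.
  exact: leq_pred.
apply: (@grad_root _ _ _ _ _ _ _ 1 delta.-1) => //; first by lia.
have -> : ('X_i * 'X_l * 'X_[m']) ^+ delta.-1 =
    'X_[(U_(i) *+ (delta - 2) + m' *+ delta.-1)] * spec_term (i, Some l) :> R.
  rewrite /spec_term /= mpolyXD -!mpolyXn !exprMn (_ : 'X_i ^+ delta.-1 = 'X_i * 'X_i ^+ (delta - 2)).
    by ring.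
  by rewrite -exprS; congr (_ ^+ _); lia.
rewrite (_ : 1 * delta.-1 = (delta - 2) + 1)%N; last by lia.
apply: grad_M => //; last exact: grad_tau.
apply: MI_X; rewrite /lex_mnm mdegD !mdegMn mdeg1 dm' wtD !wtMn wt1 wgt_p //.
apply/andP; split; last by rewrite mulnC leq_addr.
by rewrite mul1n -mulnS prednK ?leqnn //; lia.
Qed.

Lemma grad_mon m : mdeg m = delta -> PP 1 m -> grad 1 'X_[m].
Proof.
move=> dm Pm; have XP : @MI d k (PP 1) 'X_[m] by apply: MI_X.
have [/existsP[i /andP[ip mi]]|/existsPn none] := boolP [exists i : 'I_d, (i < p)%N && (m i != 0)%N]; last first.
  have wm : (om <= wt m)%N by case/andP: Pm; rewrite !mul1n.
  have [i ig ci] := wt_ge_om g_ge2 g_le_d delta_ge2 om_case wm.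
  have c0 := cofac_gt0 g_ge2 g_le_d delta_ge2 om_case ig.
  have pi : (p <= i)%N by rewrite leqNgt; apply/negP => ip; have := none i; rewrite ip /=; lia.
  have [wi omE] := wgt_v pi ig.
  rewrite /cofac wi divn1 omE in ci.
  have -> : m = (U_(i) *+ delta)%MM.
    have le_m : (U_(i) *+ delta <= m)%MM.
      by apply/mnm_lepP => l; rewrite mulmnE mnm1E; case: eqP => [<-|//]; rewrite mul1n.
    have : mdeg (m - U_(i) *+ delta)%MM = 0%N.
      by move: dm; rewrite -{1}(submK le_m) mdegD mdegMn mdeg1; lia.
    by move/eqP; rewrite mdeg_eq0 => /eqP E; rewrite -(submK le_m) E add0m.
  have -> : 'X_[U_(i) *+ delta] = spec_gen i by rewrite /spec_gen ltnNge pi ig mpolyXn.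
  by apply: grad_gen; apply: MI_S (@ff_PP i) => u [].
have le_i : (U_(i) <= m)%MM by rewrite lep1mP.
have d1 : mdeg (m - U_(i))%MM = delta.-1 by move: dm; rewrite -{1}(submK le_i) mdegD mdeg1; lia.
have mE : m = (U_(i) + (m - U_(i)))%MM by rewrite addmC submK.
have [l lm] : exists l, (m - U_(i))%MM l != 0%N.
  apply/existsP; apply: contraT => /existsPn Z; move: d1; rewrite mdegE big1 => [|l _]; first by lia.
  by apply/eqP; rewrite -[_ == _]negbK Z.
have le_l : (U_(l) <= m - U_(i))%MM by rewrite lep1mP.
have [pl|lp] := leqP p l.
  rewrite mE -(submK le_l) [((_ - _) + U_(l))%MM]addmC !mpolyXD mulrA.
  apply: grad_xl => //; apply: MI_X.
  by move: d1; rewrite -{1}(submK le_l) mdegD mdeg1; lia.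
apply: (@grad_root _ _ _ _ _ _ _ 1 delta) => //; first by lia.
rewrite mE mpolyXD mulrC exprMn (_ : 1 * delta = delta.-1 + 1)%N; last by lia.
apply: grad_M => //.
  rewrite mpolyXn; apply: MI_X; rewrite /lex_mnm mdegMn wtMn d1 leqnn /=.
  have : (wt U_(l) <= wt (m - U_(i)))%N by apply: wt_le.
  rewrite wt1 wgt_p // => h; rewrite mulnC leq_mul // leq_pred //.
(* The difference between x_i^delta and the term x_i ell_i^(delta-1) is a multiple of x_i [lin_y],
   to which [grad_xl] applies. *)
have -> : 'X_i ^+ delta = spec_term (i, None) + 'X_i * ('X_i ^+ delta.-1 - spec_ell i ^+ delta.-1).
  by rewrite /spec_term /= mulrBr -exprS prednK; [ring | lia].
apply: grad_D => //; first exact: grad_tau.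
rewrite subrXX; set S := \sum_(j < _) _.
have SP : MI (fun m => mdeg m = (delta - 2)%N) S.
  apply: MI_sum => j _; have := ltn_ord j => jlt.
  rewrite (_ : delta - 2 = 1 * (delta.-1.-1 - j) + 1 * j)%N; last by lia.
  apply: MI_mdegM; apply: MI_mdegX; first exact: MI_var.
  exact: (@zz_deg i None).
have -> : 'X_i - spec_ell i = lin_y by rewrite /spec_ell; ring.
move: S SP => S SP; rewrite mulrA /lin_y mulr_sumr mulr_suml; apply: grad_sum => // l' pl'.
exact: grad_xl.
Qed.

Lemma ff_red : red g delta om spec_gen.
Proof. exact: (grad_red g_ge2 g_le_d delta_ge2 om_case (@ff_PP) grad_mon). Qed.

End SpecialReduction.

Section Nilpotent.

Variables (A : comNzRingType) (K : A -> Prop).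
Hypothesis Ki : is_ideal K.

Lemma pow_add_mod (a b : A) m n : K (a ^+ m.+1) -> K (b ^+ n.+1) ->
  K ((a + b) ^+ (m + n) - 'C(m + n, n)%:R * (a ^+ m * b ^+ n)) /\ K ((a + b) ^+ (m + n).+1).
Proof.
have [K0 KD KM] := Ki; move=> Ka Kb.
have high i j : (m < i)%N || (n < j)%N -> K (a ^+ i * b ^+ j).
  case/orP => /subnK <-; rewrite exprD; first by rewrite mulrAC; apply: KM.
  by rewrite mulrA; apply: KM.
have KMn (x : A) e : K x -> K (x *+ e) by move=> Kx; rewrite -mulr_natl; apply: KM.
split; rewrite exprDn.
  have nmn : (n < (m + n).+1)%N by lia.
  rewrite (bigD1 (Ordinal nmn)) //= addnK -mulr_natl [X in K (X - _)]addrC addrK.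
  apply: ideal_sum => // i ni; apply: KMn; apply: high.
  by have /eqP ni' := ni; have : i != n :> nat by []; have := ltn_ord i; lia.
by apply: ideal_sum => // i _; apply: KMn; apply: high; have := ltn_ord i; lia.
Qed.

(** The constant is a multinomial coefficient; its positivity makes it nonzero in characteristic
    zero. *)
Lemma pow_sum_mod (I : Type) (s : seq I) (P : pred I) (a : I -> A) (e : I -> nat) :
  (forall i, P i -> K (a i ^+ (e i).+1)) ->
  exists2 c, (0 < c)%N &
    K ((\sum_(i <- s | P i) a i) ^+ (\sum_(i <- s | P i) e i)
       - c%:R * \prod_(i <- s | P i) a i ^+ e i).
Proof.
have [K0 KD KM] := Ki; move=> Ka.
suff [c [c0 H _]] : exists c, [/\ (0 < c)%N, K ((\sum_(i <- s | P i) a i) ^+ (\sum_(i <- s | P i) e i)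
       - c%:R * \prod_(i <- s | P i) a i ^+ e i) &
       K ((\sum_(i <- s | P i) a i) ^+ (\sum_(i <- s | P i) e i).+1)] by exists c.
elim: s => [|i s [c [c0 H1 H2]]].
  by exists 1%N; rewrite !big_nil expr0 mulr1 subrr expr1.
rewrite !big_cons; case: ifP => Pi; last by exists c.
have [G1 G2] := pow_add_mod (Ka i Pi) H2.
set S := \sum_(j <- s | P j) a j in H1 H2 G1 G2 *.
set E := (\sum_(j <- s | P j) e j)%N in H1 H2 G1 G2 *.
exists ('C(e i + E, E) * c)%N; split=> //; first by rewrite muln_gt0 bin_gt0 leq_addl.
rewrite natrM; set W := \prod_(j <- s | P j) _ in H1 *.
have -> : (a i + S) ^+ (e i + E) - 'C(e i + E, E)%:R * c%:R * (a i ^+ e i * W) =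
   ((a i + S) ^+ (e i + E) - 'C(e i + E, E)%:R * (a i ^+ e i * S ^+ E)) +
   ('C(e i + E, E)%:R * a i ^+ e i) * (S ^+ E - c%:R * W) by ring.
by apply: KD => //; apply: KM.
Qed.

End Nilpotent.

Section RedReduction.

Variables (k : fieldType) (d g delta om : nat).
Hypotheses (g_ge2 : (2 <= g)%N) (g_le_d : (g <= d)%N)
  (delta_ge2 : (2 <= delta)%N) (om_case : om = 1%N \/ om = delta).
Local Notation R := {mpoly k[d]}.
Local Notation PP := (@lex_mnm d g delta om).

Lemma red_reduction n (f : 'I_n -> R) : red g delta om f ->
  is_reduction (ideal_span (fun h => exists i, h = f i)) (MI (PP 1)).
Proof.
move=> fred; have [p0 Hp0] := red_ge g_ge2 g_le_d delta_ge2 om_case fred.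
have [fP _] := fred.
have JL : ideal_le (ideal_span (fun h => exists i, h = f i)) (MI (PP 1)).
  apply: ideal_span_min; first exact/MI_ideal/PP_upc.
  by move=> _ [i ->]; apply: MI_S (fP i) => m [].
split=> //; first exact: ideal_span_ideal.
exists p0 => m le_m h; split; last by apply: ideal_mul_le.
have EP q := exp_PP (k := k) g_ge2 g_le_d delta_ge2 om_case q.
move=> /(EP m.+1 h) /(Hp0 m h le_m) [b [bP ->]].
apply: ideal_sum; first exact: ideal_span_ideal.
move=> i _; rewrite mulrC; apply: ideal_mul_gen.
  by apply: ideal_span_gen; exists i.
by apply/EP; apply: bP.
Qed.

End RedReduction.

Lemma big_option (V : Type) (idx : V) (op : Monoid.com_law idx) (I : finType)
    (P : pred (option I)) (F : option I -> V) : P None ->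
  \big[op/idx]_(c | P c) F c = op (F None) (\big[op/idx]_(l | P (Some l)) F (Some l)).
Proof.
move=> PN; rewrite (bigD1 None) //=; congr (op _ _).
rewrite (reindex_omap Some id) /=; last by case=> // /andP[].
by apply: eq_bigl => l; rewrite eqxx !andbT.
Qed.

(** * An element of degree d (delta-2) + g outside the special reduction *)

Section SocleElement.

Variables (k : fieldType) (d g delta om p : nat).
Hypotheses (char0 : [pchar k] =i pred0) (g_ge2 : (2 <= g)%N) (g_le_d : (g <= d)%N)
  (delta_ge2 : (2 <= delta)%N) (om_p : om = 1%N /\ p = g \/ om = delta /\ p = g.-1).
Local Notation R := {mpoly k[d]}.
Local Notation wt := (@mnm_weight d g om).
Local Notation q := (d - g)%N.
Local Notation ff := (@spec_gen k d g delta p).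
Local Notation FF := (@spec_row k d g delta p).
Local Notation zz := (@spec_z k d p).
Local Notation ell := (@spec_ell k d p).
Local Notation tau := (@spec_term k d delta p).
Local Notation zrk := (@spec_rank d g).
Local Notation zok := (@spec_ok d g).
Local Notation antidiag := (@spec_diag d g p).

Let om_case : om = 1%N \/ om = delta. Proof. by case: om_p => [] [-> _]; auto. Qed.
Let om0 : (0 < om)%N. Proof. exact: om_gt0 delta_ge2 om_case. Qed.
Let p_gt0 : (0 < p)%N. Proof. by case: om_p => [] [_ ->]; lia. Qed.
Let p_le_g : (p <= g)%N. Proof. by case: om_p => [] [_ ->]; lia. Qed.
Let d_gt0 : (0 < d)%N. Proof. by lia. Qed.
Let o0 : 'I_d := Ordinal d_gt0.

(** The part of the ideal generated by f that the residue functional is known to kill. *)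
Let NN (h : R) : Prop := exists b : 'I_d -> R,
  (forall i, MI (fun m => (q * om <= wt m)%N) (b i)) /\ h = \sum_i b i * ff i.

Let NN_ideal : is_ideal NN.
Proof.
split.
- exists (fun=> 0); split=> [i|]; first exact: MI_0.
  by rewrite big1 // => i _; rewrite mul0r.
- move=> _ _ [b [bP ->]] [b' [bP' ->]]; exists (fun i => b i + b' i); split=> [i|].
    exact: MI_D.
  by rewrite -big_split; apply: eq_bigr => i _; rewrite mulrDl.
- move=> r _ [b [bP ->]]; exists (fun i => r * b i); split=> [i|].
    have [_ _] := @MI_ideal d k (fun m => (q * om <= wt m)%N) (ltac:(by move=> m m' /= h; rewrite wtD; lia)).
    exact.
  by rewrite mulr_sumr; apply: eq_bigr => i _; rewrite mulrA.
Qed.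

Let NN_gen b l : MI (fun m => (q * om <= wt m)%N) b -> NN (b * ff l).
Proof.
move=> bP; exists (fun i => if i == l then b else 0); split=> [i|].
  by case: (i == l) => //; apply: MI_0.
by rewrite (bigD1 l) //= eqxx big1 ?addr0 // => i /negbTE ->; rewrite mul0r.
Qed.

Let MI_wtX (i : 'I_d) e : (i < p)%N -> @MI d k (fun m => (e * om <= wt m)%N) ('X_i ^+ e).
Proof. by move=> ip; rewrite mpolyXn; apply: MI_X; rewrite wtMn wt1 (wgt_p om_p ip) mulnC. Qed.

Let MI_wtM a b (f h : R) : MI (fun m => (a * om <= wt m)%N) f ->
  MI (fun m => (b * om <= wt m)%N) h -> MI (fun m => ((a + b) * om <= wt m)%N) (f * h).
Proof. by apply: MI_M => m1 m2 h1 h2; rewrite wtD mulnDl leq_add. Qed.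

Let zrk_le c : (zrk c <= q)%N.
Proof. by case: c => [l|] //=; have := ltn_ord l; lia. Qed.

(** Schmitt-Vogel elimination with control of the weight. The other terms of the antidiagonal have i
    > 0, hence smaller rank; the powers of x_1 set free by the drop in rank join Y together with
    x_i, so the total weight is kept. *)
Let NN_zz c Y : zok c -> MI (fun m => ((q - zrk c) * om <= wt m)%N) Y ->
  NN ('X_o0 ^+ (zrk c).+1 * Y * zz o0 c ^+ delta.-1).
Proof.
have [N0 ND NM] := NN_ideal.
have [n] := ubnP (zrk c); elim: n c Y => // n IH c Y lt_n cok YP.
have cq := zrk_le c.
have ad : antidiag (zrk c) (o0, c) by rewrite /spec_diag /= p_gt0 cok add0n eqxx.
have -> : 'X_o0 ^+ (zrk c).+1 * Y * zz o0 c ^+ delta.-1 = 'X_o0 ^+ zrk c * Y * FF (zrk c)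
    - \sum_(ic | antidiag (zrk c) ic && (ic != (o0, c))) 'X_o0 ^+ zrk c * Y * tau ic.
  by rewrite /spec_row (bigD1 (o0, c)) //= mulrDr mulr_sumr exprS /spec_term /=; ring.
apply: ideal_sub => //.
  have [|l ->] := @FF_row k d g delta om p g_ge2 g_le_d delta_ge2 om_p (zrk c); first by lia.
  apply: NN_gen; have := MI_wtM (@MI_wtX o0 (zrk c) p_gt0) YP.
  by apply: MI_S => m; rewrite subnKC.
apply: ideal_sum => // -[i c'] /andP[/and3P[/= ip' cok' /eqP E] ne].
have i0 : (0 < i)%N.
  rewrite lt0n; apply: contraNneq ne => i0; rewrite xpair_eqE -val_eqE /= i0 eqxx /=.
  by apply/eqP; apply: (zrk_inj g_ge2 g_le_d delta_ge2 om_p cok' cok); rewrite -E i0.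
have [|l c'E] := zrk_lt g_ge2 g_le_d delta_ge2 om_p cok' cok; first by lia.
have -> : 'X_o0 ^+ zrk c * Y * tau (i, c') =
    'X_o0 ^+ (zrk c').+1 * ('X_o0 ^+ i.-1 * 'X_i ^+ 1 * Y) * zz o0 c' ^+ delta.-1.
  rewrite (_ : zrk c = (zrk c').+1 + i.-1)%N; last by lia.
  by rewrite exprD c'E /spec_term /= expr1; ring.
apply: IH => //; first by lia.
have := MI_wtM (MI_wtM (@MI_wtX o0 i.-1 p_gt0) (@MI_wtX i 1 ip')) YP.
by apply: MI_S => m; rewrite (_ : i.-1 + 1 + (q - zrk c) = q - zrk c')%N //; lia.
Qed.

Let QQ (h : R) : Prop := NN ('X_o0 ^+ q.+1 * h).

Let QQ_ideal : is_ideal QQ.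
Proof.
have [N0 ND NM] := NN_ideal; split; rewrite /QQ.
- by rewrite mulr0.
- by move=> a b Ha Hb; rewrite mulrDr; apply: ND.
- by move=> r a Ha; rewrite mulrCA; apply: NM.
Qed.

Let QQ_zz c : zok c -> QQ (zz o0 c ^+ delta.-1).
Proof.
move=> cok; have := @NN_zz c ('X_o0 ^+ (q - zrk c)) cok (@MI_wtX o0 _ p_gt0).
by rewrite -exprD addSn subnKC // zrk_le.
Qed.

Let QQ_v (l : 'I_d) : (p <= l)%N -> (l < g)%N -> QQ ('X_l ^+ delta).
Proof.
move=> pl lg; have -> : 'X_l ^+ delta = ff l by rewrite /spec_gen ltnNge pl lg.
apply: NN_gen; have := @MI_wtX o0 q.+1 p_gt0; apply: MI_S => m.
by apply: leq_trans; rewrite leq_mul2r leqnSn orbT.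
Qed.

(** The highest powers of the summands of x_1 that are not known to lie in [QQ]. *)
Let efac (c : option 'I_d) : nat :=
  if c is Some l then (if (l < g)%N then delta.-1 else delta - 2)%N else (delta - 2)%N.
Let inx (c : option 'I_d) : bool := if c is Some l then (p <= l)%N else true.

Definition socle_exp : nat := (\sum_(c | inx c) efac c)%N.

Lemma socle_expE : socle_exp = (q.+1 * (delta - 2) + (g - p) * delta.-1)%N.
Proof.
rewrite /socle_exp big_option //=.
have s_g := sum_ord_ltn g_le_d; have s_p := sum_ord_ltn (leq_trans p_le_g g_le_d).
have s_v : (\sum_(l < d) ((p <= l) && (l < g)) = g - p)%N.
  suff : (\sum_(l < d) ((p <= l) && (l < g)) + \sum_(l < d) (l < p) = \sum_(l < d) (l < g))%N by lia.
  by rewrite -big_split; apply: eq_bigr => l _ /=; case: ltnP; case: ltnP => //=; lia.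
have s_y : (\sum_(l < d) ~~ (l < g) = q)%N.
  suff : (\sum_(l < d) ~~ (l < g)%N + \sum_(l < d) (l < g) = \sum_(l < d) 1)%N.
    by rewrite s_g sum1_card card_ord; lia.
  by rewrite -big_split; apply: eq_bigr => l _ /=; case: ltnP.
rewrite big_mkcond (eq_bigr (fun l : 'I_d => ((p <= l) && (l < g)) * delta.-1 + ~~ (l < g) * (delta - 2))%N).
  by rewrite big_split /= -!big_distrl /= s_v s_y; lia.
by move=> l _; case: (ltnP l p) => lp; case: (ltnP l g) => lg /=; rewrite ?mul0n ?mul1n; lia.
Qed.

Definition socle : R :=
  'X_o0 * ('X_o0 ^+ socle_exp * \prod_(i : 'I_d | (0 < i < p)%N) ('X_i - 'X_o0) ^+ delta.-1).

Let x0E : 'X_o0 = \sum_(c | inx c) zz o0 c.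
Proof.
by rewrite big_option //= /spec_ell subrK.
Qed.
Let Wz : R := \prod_(c | inx c) zz o0 c ^+ efac c.
Let Wx : R := \prod_(i : 'I_d | (0 < i < p)%N) ell i ^+ delta.-1.

(** The power of x_1, a sum of the z, is a multinomial multiple of the product of their top powers.
    Then x_i - x_1 may be replaced by ell_i: the difference is a multiple of ell_1, and together
    with the factor ell_1^(delta-2) of [Wz] this falls into [QQ]. *)
Let QQ_socle : exists2 c, (0 < c)%N &
  QQ ('X_o0 ^+ socle_exp * \prod_(i : 'I_d | (0 < i < p)%N) ('X_i - 'X_o0) ^+ delta.-1
      - c%:R * (Wz * Wx)).
Proof.
have [Q0 QD QM] := QQ_ideal.
have [|c c0 Hc] := @pow_sum_mod R QQ QQ_ideal _ (index_enum (option 'I_d)) inx (zz o0) efac.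
  case=> [l|] /= pl; rewrite /efac.
    case: ltnP => lg; first by rewrite prednK; [apply: QQ_v | lia].
    by have := @QQ_zz (Some l) lg; rewrite (_ : delta.-1 = (delta - 2).+1) //; lia.
  by have := @QQ_zz None isT; rewrite (_ : delta.-1 = (delta - 2).+1) //; lia.
exists c => //; rewrite -x0E -/socle_exp -/Wz in Hc.
set Px := \prod_(i < d | _) _.
have -> : 'X_o0 ^+ socle_exp * Px - c%:R * (Wz * Wx) =
  Px * ('X_o0 ^+ socle_exp - c%:R * Wz) + c%:R * (Wz * (Px - Wx)) by ring.
apply: (QD); first exact: QM.
apply: (QM); have WKi : is_ideal (fun h => QQ (Wz * h)).
  split; first by rewrite mulr0.
    by move=> a b Ha Hb; rewrite mulrDr; apply: QD.
  by move=> r a Ha; rewrite mulrCA; apply: QM.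
apply: (ideal_prod_sub (K := fun h => QQ (Wz * h))) => // i _.
rewrite subrXX (_ : 'X_i - 'X_o0 - ell i = - ell o0); last by rewrite /spec_ell; ring.
set S := \sum_(j < _) _; rewrite /Wz big_option //=.
set W' := \prod_(l | _) _.
have -> : ell o0 ^+ (delta - 2) * W' * (- ell o0 * S) = (- W' * S) * ell o0 ^+ delta.-1.
  by rewrite (_ : delta.-1 = (delta - 2).+1) ?exprS; [ring | lia].
by apply: QM; have := @QQ_zz None isT.
Qed.

Let TT (n : nat) (j : 'I_d) : R := \sum_(c | antidiag n (j, c)) zz j c ^+ delta.-1.
Let kk (l : 'I_d) : nat := if (l < p)%N then (q + l)%N else (l - g)%N.

Let FF_TT n : FF n = \sum_j TT n j * 'X_j.
Proof.
rewrite /spec_row /TT; under [RHS]eq_bigr => j _ do rewrite mulr_suml.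
rewrite (pair_big_dep xpredT (fun j c => antidiag n (j, c))) /=.
by apply: eq_big => [[j c]|[j c] _] //; rewrite /spec_term /= mulrC.
Qed.

Let TT_eq (j : 'I_d) c : (j < p)%N -> zok c -> TT (j + zrk c) j = zz j c ^+ delta.-1.
Proof.
move=> jp cok; rewrite /TT (big_pred1 c) // => c'; rewrite /spec_diag /= jp /= eqn_add2l.
apply/andP/eqP => [[cok' /eqP E]|->]; last by rewrite cok eqxx.
exact: (zrk_inj g_ge2 g_le_d delta_ge2 om_p).
Qed.

Let TT_0 n (j : 'I_d) : (p <= j)%N || (j + q < n)%N -> TT n j = 0.
Proof.
move=> H; rewrite /TT big1 // => c /and3P[/= jp _ /eqP E]; have := zrk_le c.
by move: H jp E; lia.
Qed.

(** In the terms with i = 0 the factor x_1 is kept in the coefficient and one factor z is expanded;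
    for z = ell_1 the expansion is x_1 - [lin_y]. This produces the column weights [nup]. *)
Let AA : 'M[R]_d := \matrix_(l, j)
  if (0 < j < p)%N then (if (p <= l < g)%N then 0 else TT (kk l) j)
  else if l == o0 then (if j == o0 then 'X_o0 * ell o0 ^+ (delta - 2)
                        else - ('X_o0 * ell o0 ^+ (delta - 2)))
  else if (l < p)%N then 0
  else if j == l then (if (l < g)%N then 'X_l ^+ delta.-1 else 'X_o0 * 'X_l ^+ (delta - 2))
  else 0.

Let neg_range (j : 'I_d) : ~~ (0 < j < p)%N && (j != o0) = (p <= j)%N.
Proof. by rewrite -val_eqE /=; lia. Qed.

Let AA_row l : ff l = \sum_j AA l j * 'X_j.
Proof.
rewrite (bigID (fun j : 'I_d => 0 < j < p)%N) /=.
rewrite [X in X + _](eq_bigr (fun j => (if (p <= l < g)%N then 0 else TT (kk l) j) * 'X_j)); last first.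
  by move=> j jp; rewrite mxE jp.
rewrite [X in _ + X](eq_bigr (fun j => (if l == o0 then (if j == o0 then 'X_o0 * ell o0 ^+ (delta - 2)
      else - ('X_o0 * ell o0 ^+ (delta - 2)))
    else if (l < p)%N then 0
    else if j == l then (if (l < g)%N then 'X_l ^+ delta.-1 else 'X_o0 * 'X_l ^+ (delta - 2))
    else 0) * 'X_j)); last by move=> j /negbTE jp; rewrite mxE jp.
have [/andP[pl lg]|nv] := boolP (p <= l < g)%N.
  have l0 : l != o0 by rewrite -val_eqE /=; lia.
  rewrite big1 => [|j _]; last by rewrite mul0r.
  rewrite add0r (negbTE l0) ltnNge pl lg /= (bigD1 l) /=; last by lia.
  rewrite eqxx big1 ?addr0 => [|j /andP[_ /negbTE ->]]; last by rewrite mul0r.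
  by rewrite -exprSr prednK ?/spec_gen ?[(l < p)%N]ltnNge ?pl ?lg //; lia.
have -> : ff l = FF (kk l) by rewrite /spec_gen /kk; case: ltnP => // pl; case: ltnP => // lg; rewrite pl lg in nv.
rewrite FF_TT (bigID (fun j : 'I_d => 0 < j < p)%N) /=; congr (_ + _).
rewrite (bigD1 o0) //= big1 ?addr0 => [|j]; last first.
  by rewrite neg_range => pj; rewrite TT_0 ?pj ?mul0r.
rewrite [RHS](bigD1 o0) //= ?eqxx.
rewrite [X in _ + X](eq_bigl (fun j : 'I_d => p <= j)%N) => [|j]; last exact: neg_range.
have [lo|lo] := eqVneq l o0.
  rewrite lo /kk /= p_gt0 addn0 (_ : q = o0 + zrk None)%N // TT_eq //=.
  rewrite [X in _ = _ + X](eq_bigr (fun j => - ('X_o0 * ell o0 ^+ (delta - 2)) * 'X_j)); last first.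
    by move=> j pj; rewrite (_ : (j == o0) = false) // -val_eqE /=; apply/negbTE; lia.
  rewrite -mulr_sumr (_ : \sum_(j < d | (p <= j)%N) 'X_j = 'X_o0 - ell o0); last by rewrite /spec_ell subKr.
  by rewrite (_ : delta.-1 = (delta - 2).+1) ?exprS; [ring | lia].
have l_gt0 : (0 < l)%N by rewrite lt0n -[X in _ != X]/(val o0) val_eqE.
have [lp|pl] := ltnP l p.
  rewrite TT_0 ?mul0r ?big1 ?addr0 //; last by rewrite /kk lp /=; lia.
  by move=> j _; rewrite mul0r.
have gl : (g <= l)%N by move: nv; rewrite pl /= -leqNgt.
rewrite [in LHS]/kk ltnNge pl /= (_ : l - g = o0 + zrk (Some l))%N // TT_eq //=.
rewrite mul0r add0r.
rewrite (bigD1 l) //= eqxx big1 ?addr0 => [|j /andP[_ /negbTE ->]]; last by rewrite mul0r.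
rewrite ltnNge gl /= (_ : delta.-1 = (delta - 2).+1) ?exprS; [ring | lia].
Qed.
Let AA_wt l j : MI (fun m => (nup g om j <= wt m)%N) (AA l j).
Proof.
have x0P (h : R) : MI (fun m => (om <= wt m)%N) ('X_o0 * h).
  have X1 := @MI_wtX o0 1 p_gt0; rewrite expr1 mul1n in X1.
  by apply: (@MI_M _ _ _ (fun=> True)) X1 _ => // m1 m2 h1 _; rewrite wtD (leq_trans h1) ?leq_addr.
rewrite mxE; case: ifP => [jp|njp].
  have -> : nup g om j = 0%N by rewrite /nup; case: om_p => [] [E1 E2]; move: jp; rewrite E2 ?E1; repeat case: ifP => //; lia.
  by move=> m _.
have nup_le : (nup g om j <= om)%N by rewrite /nup; repeat case: ifP => //; lia.
have x0W (h : R) : MI (fun m => (nup g om j <= wt m)%N) ('X_o0 * h).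
  by apply: MI_S (x0P h) => m; apply: leq_trans.
case: ifP => _; first by case: ifP => _; [|apply: MI_N]; apply: x0W.
case: (ltnP l p) => pl; first exact: MI_0.
case: (eqVneq j l) pl => [<- pl|_ _]; last exact: MI_0.
case: ltnP => lg; last exact: x0W.
have [wl omE] := wgt_v om_p pl lg.
rewrite mpolyXn; apply: MI_X; rewrite wtMn wt1 wl mul1n -omE.
rewrite /nup; case: om_p => [] [E1 E2]; first by move: lg; rewrite -E2 ltnNge pl.
by move: pl lg; rewrite E2; repeat case: ifP => //; lia.
Qed.

Let AA_det : \det AA = 'X_o0 ^+ q.+1 * (Wz * Wx).
Proof.
(* The matrix is triangular for the order 0, then p, ..., d-1, then 1, ..., p-1. *)
pose rk (l : 'I_d) : nat := if l == 0%N :> nat then 0%N else if (p <= l)%N then (l - p).+1 else (d - p + l)%N.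
rewrite (@det_rank_trig _ _ rk) => [||l j].
- rewrite (bigID (fun j : 'I_d => 0 < j < p)%N) /= mulrC [in RHS]mulrA; congr (_ * _); last first.
    apply: eq_bigr => j jp; rewrite mxE jp (_ : (p <= j < g)%N = false); last by lia.
    have [_ jp2] := andP jp.
    by rewrite /kk jp2 (_ : q + j = j + zrk None)%N ?TT_eq //= addnC.
  rewrite (bigD1 o0) //= mxE /= ?eqxx.
  rewrite (eq_bigl (fun j : 'I_d => p <= j)%N) => [|j]; last exact: neg_range.
  rewrite /Wz big_option //= exprS -!mulrA; congr (_ * _); rewrite mulrCA; congr (_ * _).
  transitivity (\prod_(l < d | (p <= l)%N) (('X_o0 : R) ^+ nat_of_bool (~~ (l < g)%N) * 'X_l ^+ efac (Some l))).
    apply: eq_bigr => l pl; rewrite mxE (_ : (0 < l < p)%N = false); last by lia.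
    rewrite (_ : (l == o0) = false); last by rewrite -val_eqE /=; lia.
    rewrite ltnNge pl /= eqxx; case: ifP => _; by rewrite ?expr0 ?expr1 ?mul1r.
  rewrite big_split prodrXr; congr ('X_o0 ^+ _ * _).
  rewrite big_mkcond /= -[RHS](_ : (\sum_(l < d) 1 - \sum_(l < d) (l < g) = q)%N); last first.
    by rewrite sum_ord_ltn // sum1_card card_ord.
  apply/eqP; rewrite -(eqn_add2r (\sum_(l < d) (l < g))) subnK; last by apply: leq_sum => l _; case: ltnP.
  apply/eqP; rewrite -big_split; apply: eq_bigr => l _ /=.
  by case: (ltnP l g) => lg; case: (leqP p l) => pl //=; lia.
- move=> l l'; rewrite /rk => E; apply/val_inj => /=; move: E (ltn_ord l) (ltn_ord l').
  by repeat case: ifP => //; lia.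
- rewrite mxE /rk; have := ltn_ord l; have := ltn_ord j.
  case: ifP => jp.
    case: ifP => vl; first by rewrite eqxx.
    case: (leqP p l) => pl jd ld TTn; first by repeat case: ifP; lia.
    case: (leqP l j) => lj; first by repeat case: ifP; lia.
    by move: TTn; rewrite /kk pl TT_0 ?eqxx //; lia.
  case: (eqVneq l o0) => [->|l0] //.
  case: (ltnP l p) => pl; first by rewrite eqxx.
  by case: (eqVneq j l) => [->|_]; rewrite ?pl ?leqnn ?eqxx /=.
Qed.

Lemma socle_notin : ~ ideal_span (fun h => exists i, h = ff i) socle.
Proof.
case=> n [r [s [Hs uE]]].
have fred := ff_red k g_ge2 g_le_d delta_ge2 om_p.
have [phi [phi_lin phi0 phiD]] := residue_R char0 g_ge2 g_le_d delta_ge2 om_case fred.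
have phiZD a x y : phi (a *: x + y) = a * phi x + phi y := phi_lin a x y.
have phi00 : phi 0 = 0.
  by have := phiZD (-1) 0 0; rewrite scaler0 addr0 mulN1r addNr.
have phiZ a x : phi (a *: x) = a * phi x by rewrite -[a *: x]addr0 phiZD phi00 addr0.
have phiA x y : phi (x + y) = phi x + phi y by rewrite -{1}[x]scale1r phiZD mul1r.
have phiNN h : NN h -> phi h = 0.
  case=> b [bP ->]; elim/big_ind: _ => // [x y Hx Hy|i _]; first by rewrite phiA Hx Hy addr0.
  by rewrite mulrC phi0.
have [N0 ND NM] := NN_ideal.
have uN : NN ('X_o0 ^+ q * socle).
  rewrite uE mulr_sumr; apply: ideal_sum => // i _; have [l ->] := Hs i.
  by rewrite mulrCA; apply: NM; apply: NN_gen; apply: MI_wtX.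
have [c c0 Qc] := QQ_socle.
have := phiD AA AA_wt AA_row; apply/negP; rewrite negbK; apply/eqP.
have : NN (c%:R *: \det AA).
  rewrite -mul_mpolyC rmorph_nat AA_det -[X in NN X](subKr ('X_o0 ^+ q * socle)).
  apply: ideal_sub => //; move: Qc; rewrite /QQ; congr NN.
  by rewrite /socle exprSr; ring.
move=> /phiNN; rewrite phiZ => /eqP; rewrite mulf_eq0 (proj1 (pcharf0P k) char0).
by rewrite eqn0Ngt c0 => /eqP.
Qed.

End SocleElement.

(** * Symmetries of the core *)

Section Automorphisms.

Variables (k : fieldType) (d g delta om : nat).
Hypotheses (char0 : [pchar k] =i pred0) (g_ge2 : (2 <= g)%N) (g_le_d : (g <= d)%N)
  (delta_ge2 : (2 <= delta)%N) (om_case : om = 1%N \/ om = delta).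
Local Notation R := {mpoly k[d]}.
Local Notation wt := (@mnm_weight d g om).
Local Notation wgt := (@var_weight d g om).
Local Notation PP := (@lex_mnm d g delta om).
Local Notation C := (core (@MI d k (PP 1))).

Definition subst (s : 'I_d -> R) : R -> R := mmap (@mpolyC d k) s.

HB.instance Definition _ s := GRing.RMorphism.on (subst s).

Lemma substX s m : subst s 'X_[m] = mmap1 s m.
Proof. exact: mmapX. Qed.

Lemma substU s i : subst s 'X_i = s i.
Proof. by rewrite substX mmap1U. Qed.

Lemma substZ s c f : subst s (c *: f) = c *: subst s f.
Proof. by rewrite /subst mmapZ mul_mpolyC. Qed.

Lemma substK s s' : (forall i, subst s (s' i) = 'X_i) -> cancel (subst s') (subst s).
Proof.
move=> ss' f; rewrite {1}[f]mpolyE (raddf_sum (subst s')) (raddf_sum (subst s)) [RHS]mpolyE; apply: eq_bigr => m _.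
rewrite /= !substZ substX; congr (_ *: _).
rewrite -[in RHS]mmap1_id /mmap1 rmorph_prod; apply: eq_bigr => i _ /=.
by rewrite rmorphXn /= ss'.
Qed.

Definition wt_subst (s : 'I_d -> R) : Prop :=
  forall i, MI (fun m => mdeg m = 1%N /\ (wgt i <= wt m)%N) (s i).

Lemma subst_PP s p f : wt_subst s -> MI (PP p) f -> MI (PP p) (subst s f).
Proof.
move=> sP; move: f; apply: MI_ind => [|f h|c m Pm].
- by rewrite raddf0; apply: MI_0.
- by rewrite raddfD; apply: MI_D.
rewrite substZ substX; apply: MI_Z.
have : MI (fun u => mdeg u = mdeg m /\ (wt m <= wt u)%N) (mmap1 s m).
  rewrite mdegE /mnm_weight /mmap1.
  elim/big_rec3: _ => [|i a b y _ IH].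
    by move=> u; rewrite mcoeff1; case: (eqVneq u 0%MM) => [->|]; rewrite ?mdeg0 ?eqxx.
  apply: (MI_M (P := fun u => mdeg u = m i /\ (m i * wgt i <= wt u)%N) _ _ IH).
    by move=> u v [d1 h1] [d2 h2]; rewrite mdegD d1 d2 -/(wt _) wtD; split=> //; apply: leq_add.
  elim: (m i) => [|e IHe].
    by move=> u; rewrite mcoeff1; case: (eqVneq u 0%MM) => [->|]; rewrite ?mdeg0 ?eqxx.
  rewrite exprS; apply: MI_M (sP i) IHe => u v [d1 h1] [d2 h2].
  by rewrite mdegD d1 d2 wtD mulSn; split=> //; apply: leq_add.
by apply: MI_S => u [du wu]; move: Pm; rewrite /lex_mnm du => /andP[-> /leq_trans ->].
Qed.

(** Such an automorphism preserves all powers of L, so the preimage of a reduction is a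
    reduction. *)
Lemma core_subst s s' f : wt_subst s -> wt_subst s' ->
  (forall i, subst s (s' i) = 'X_i) -> (forall i, subst s' (s i) = 'X_i) ->
  C f -> C (subst s f).
Proof.
move=> sP sP' ss' ss Cf J [Ji JL [m0 Jm]]; have [J0 JD JM] := Ji.
have K := substK ss'; have K' := substK ss.
have EP q := exp_PP (k := k) g_ge2 g_le_d delta_ge2 om_case q.
suff Jred : is_reduction (fun h => J (subst s h)) (MI (PP 1)) by exact: Cf Jred.
have JL' : ideal_le (fun h => J (subst s h)) (MI (PP 1)).
  by move=> h /JL Hh; rewrite -[h]K'; apply: subst_PP.
split=> //.
  split; first by rewrite raddf0.
    by move=> a b Ja Jb; rewrite raddfD; apply: JD.
  by move=> r a Ja; rewrite rmorphM; apply: JM.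
exists m0 => m le_m h; split; last by apply: ideal_mul_le.
move=> /(EP m.+1) /(subst_PP sP) /(EP m.+1) /(Jm m le_m) [n [r [t [Ht E]]]].
rewrite -[h]K' E raddf_sum; apply: ideal_sum; first exact: ideal_span_ideal.
move=> i _; have [a [b [Ja Lb ->]]] := Ht i; rewrite /= !(rmorphM (subst s')) /=.
have [_ _ IM] := ideal_span_ideal (fun f => exists a b, [/\ J (subst s a), ideal_exp (MI (PP 1)) m b & f = a * b]).
apply: IM; apply: ideal_mul_gen; first by rewrite K.
by apply/EP; apply: subst_PP => //; apply/EP.
Qed.

Lemma core_ideal : is_ideal C.
Proof.
split.
- by move=> J [[]].
- by move=> a b Ca Cb J Jr; have [[_ JD _] _ _] := Jr; apply: JD; [apply: Ca | apply: Cb].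
- by move=> r a Ca J Jr; have [[_ _ JM] _ _] := Jr; apply: JM; apply: Ca.
Qed.

Lemma core_sub f : C f -> MI (PP 1) f.
Proof.
apply; split=> //; first exact/MI_ideal/PP_upc.
by exists 0%N.
Qed.

Lemma wt_subst_X i : @MI d k (fun m => mdeg m = 1%N /\ (wgt i <= wt m)%N) 'X_i.
Proof. by apply: MI_X; rewrite mdeg1 wt1. Qed.

Definition scale_var (j : 'I_d) (c : k) (i : 'I_d) : R := (if i == j then c else 1) *: 'X_i.

Lemma subst_scale j c m : subst (scale_var j c) 'X_[m] = c ^+ m j *: 'X_[m].
Proof.
rewrite substX -[in RHS]mmap1_id /mmap1 (bigD1 j) //= [in RHS](bigD1 j) //= /scale_var eqxx exprZn.
rewrite -scalerAl; congr (_ *: (_ * _)); apply: eq_bigr => i /negbTE ->.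
by rewrite scale1r.
Qed.

Lemma core_scale j c f : c != 0 -> C f -> C (subst (scale_var j c) f).
Proof.
move=> c0; apply: (@core_subst _ (scale_var j c^-1)).
- by move=> i; apply: MI_Z; apply: wt_subst_X.
- by move=> i; apply: MI_Z; apply: wt_subst_X.
- move=> i; rewrite substZ substU /scale_var scalerA; case: eqP; rewrite ?mulVf ?mulr1 ?scale1r //.
- move=> i; rewrite substZ substU /scale_var scalerA; case: eqP; rewrite ?mulfV ?mulr1 ?scale1r //.
Qed.

(** Scaling x_j by 2 separates monomials with different exponents of x_j: subtracting a multiple of
    f removes m' and keeps m, and the support shrinks. *)
Lemma core_monomial f m : C f -> m \in msupp f -> C 'X_[m].
Proof.
have [C0 CD CM] := core_ideal.
have [n] := ubnP (size (msupp f)); elim: n f => // n IH f lt_n Cf mf.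
have [/allP all_m|/allPn[m' m'f mm']] := boolP (all (pred1 m) (msupp f)).
  have fE : f = f@_m *: 'X_[m].
    apply/mpolyP => u; rewrite mcoeffZ mcoeffX; have [->|mu] := eqVneq m u; first by rewrite mulr1.
    rewrite mulr0; apply: memN_msupp_eq0; apply: contra mu => /all_m /= /eqP ->; exact: eqxx.
  have fm : f@_m != 0 by rewrite -mcoeff_msupp.
  by rewrite -['X_[m]]scale1r -(mulVf fm) -scalerA -fE -mul_mpolyC; apply: CM.
have [j mj] : exists j, m j != m' j.
  apply/existsP; apply: contraT => /existsPn E; case/eqP: mm'; apply/mnmP => j.
  by apply/esym/eqP; rewrite -[_ == _]negbK; apply: E.
have two0 : 2%:R != 0 :> k by rewrite (proj1 (pcharf0P k) char0).
pose h := subst (scale_var j 2%:R) f - (2%:R ^+ m' j) *: f.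
have hE u : h@_u = (2%:R ^+ u j - 2%:R ^+ m' j) * f@_u.
  rewrite mcoeffB mcoeffZ mulrBl; congr (_ - _).
  rewrite {1}[f]mpolyE (raddf_sum (subst _)) raddf_sum /= [in RHS](mpolyE f) raddf_sum mulr_sumr.
  apply: eq_bigr => v _; rewrite substZ subst_scale !mcoeffZ mcoeffX.
  by rewrite /= mcoeffZ mcoeffX; case: eqP => [->|_] /=; ring.
have Ch : C h.
  apply: (ideal_sub core_ideal); first exact: core_scale.
  by rewrite -mul_mpolyC; apply: CM.
apply: (IH h) => //; last first.
  rewrite mcoeff_msupp hE mulf_neq0 -?mcoeff_msupp // subr_eq0 -!natrX.
  rewrite -subr_eq0; apply/negP => /eqP E.
  have : (2 ^ m j == 2 ^ m' j)%N.
    have [le|/ltnW le] := leqP (2 ^ m' j) (2 ^ m j)%N.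
      by move/eqP: E; rewrite -natrB // (proj1 (pcharf0P k) char0) subn_eq0 eqn_leq le andbT.
    move/eqP: E; rewrite -oppr_eq0 opprB -natrB // (proj1 (pcharf0P k) char0) subn_eq0 eqn_leq le //.
  by rewrite eqn_exp2l // (negbTE mj).
rewrite ltnS in lt_n; apply: leq_trans lt_n.
have : (size (msupp h) <= size (rem m' (msupp f)))%N.
  apply: uniq_leq_size; first exact: msupp_uniq.
  move=> u; rewrite mem_rem_uniq ?msupp_uniq // inE /= mcoeff_msupp hE => nz.
  apply/andP; split; last by rewrite mcoeff_msupp; apply: contraNneq nz => ->; rewrite mulr0.
  by apply: contraNneq nz => ->; rewrite subrr mul0r.
have : (0 < size (msupp f))%N by case: (msupp f) m'f.
by rewrite size_rem // => s0 le; rewrite -(prednK s0) ltnS.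
Qed.

Lemma core_X_mul m m' : C 'X_[m] -> C 'X_[m' + m].
Proof. by have [_ _ CM] := core_ideal; rewrite mpolyXD => /CM. Qed.

Definition shear (j l : 'I_d) (i : 'I_d) : R := if i == j then 'X_j + 'X_l else 'X_i.

Definition transfer (j l : 'I_d) b (m : 'X_{1..d}) : 'X_{1..d} :=
  (m - U_(j) *+ b + U_(l) *+ b)%MM.

(** The new monomial occurs in the sheared one with a binomial coefficient, nonzero in
    characteristic zero. The inequality of weights makes the shear preserve L. *)
Lemma core_transfer (j l : 'I_d) b (m : 'X_{1..d}) : l != j -> (wgt j <= wgt l)%N -> (b <= m j)%N ->
  C 'X_[m] -> C 'X_[transfer j l b m].
Proof.
move=> lj wjl bm Cm; pose s' i : R := if i == j then 'X_j - 'X_l else 'X_i.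
have Cs : C (subst (shear j l) 'X_[m]).
  apply: (@core_subst _ s') => // i; rewrite /shear /s'.
  - case: eqP => [->|_]; last exact: wt_subst_X.
    by apply: MI_D; apply: MI_X; rewrite mdeg1 wt1.
  - case: eqP => [->|_]; last exact: wt_subst_X.
    by apply: MI_B; apply: MI_X; rewrite mdeg1 wt1.
  - case: eqP => [->|/eqP /negbTE ij]; last by rewrite substU ij.
    by rewrite raddfB /= !substU eqxx (negbTE lj) addrK.
  - case: eqP => [->|/eqP /negbTE ij]; last by rewrite substU ij.
    by rewrite raddfD /= !substU eqxx (negbTE lj) subrK.
apply: core_monomial Cs _.
have mE : m = (m - U_(j) *+ m j + U_(j) *+ m j)%MM.
  by rewrite submK //; apply/mnm_lepP => i; rewrite mulmnE mnm1E; case: eqP => [->|_]; rewrite ?mul1n.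
pose m0 := (m - U_(j) *+ m j)%MM.
have m0j : m0 j = 0%N by rewrite mnmBE mulmnE mnm1E eqxx mul1n subnn.
have -> : subst (shear j l) 'X_[m] =
    \sum_(i < (m j).+1) 'C(m j, i)%:R *: 'X_[m0 + U_(j) *+ (m j - i) + U_(l) *+ i].
  rewrite {1}mE mpolyXD rmorphM /= !substX.
  have -> : mmap1 (shear j l) (U_(j) *+ m j) = ('X_j + 'X_l) ^+ m j.
    rewrite /mmap1 (bigD1 j) //= big1 ?mulr1 => [|i /negbTE ij].
      by rewrite mulmnE mnm1E eqxx mul1n /shear eqxx.
    by rewrite mulmnE mnm1E eq_sym ij mul0n expr0.
  have -> : mmap1 (shear j l) (m - U_(j) *+ m j)%MM = 'X_[m0].
    rewrite -[RHS]mmap1_id /mmap1; apply: eq_bigr => i _; rewrite /shear.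
    by case: eqP => [->|//]; rewrite -/m0 m0j !expr0.
  rewrite exprDn mulr_sumr; apply: eq_bigr => i _.
  by rewrite -scaler_nat -scalerAr !mpolyXn -!mpolyXD addmA.
rewrite mcoeff_msupp raddf_sum /=.
have bltn : (b < (m j).+1)%N by rewrite ltnS.
have tE (i : 'I_(m j).+1) : (m0 + U_(j) *+ (m j - i) + U_(l) *+ i)%MM l = (m l + i)%N.
  rewrite !mnmDE !mnmBE !mulmnE !mnm1E eqxx eq_sym (negbTE lj); lia.
rewrite (bigD1 (Ordinal bltn)) //= big1 ?addr0 => [|i ib]; last first.
  rewrite mcoeffZ mcoeffX; case: eqP => [/mnmP /(_ l)|]; last by rewrite mulr0.
  rewrite tE /transfer mnmDE mnmBE !mulmnE !mnm1E eqxx eq_sym (negbTE lj) => E.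
  by case/eqP: ib; apply/val_inj => /=; lia.
rewrite mcoeffZ mcoeffX (_ : (_ + _ + _ == _)%MM) ?mulr1.
  by rewrite (proj1 (pcharf0P k) char0) -lt0n bin_gt0.
apply/eqP/mnmP => i; rewrite /transfer !mnmDE !mnmBE !mulmnE !mnm1E.
by case: (eqVneq j i) => [<-|ij]; lia.
Qed.

End Automorphisms.

(** * Upper bound for the core *)

Section CoreContained.

Variables (k : fieldType) (d g delta om p : nat).
Hypotheses (char0 : [pchar k] =i pred0) (g_ge2 : (2 <= g)%N) (g_le_d : (g <= d)%N)
  (delta_ge2 : (2 <= delta)%N) (om_p : om = 1%N /\ p = g \/ om = delta /\ p = g.-1).
Local Notation R := {mpoly k[d]}.
Local Notation wt := (@mnm_weight d g om).
Local Notation wgt := (@var_weight d g om).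
Local Notation PP := (@lex_mnm d g delta om).
Local Notation C := (core (@MI d k (PP 1))).

Let om_case : om = 1%N \/ om = delta. Proof. by case: om_p => [] [-> _]; auto. Qed.
Let om0 : (0 < om)%N. Proof. exact: om_gt0 delta_ge2 om_case. Qed.
Let p_gt0 : (0 < p)%N. Proof. by case: om_p => [] [_ ->]; lia. Qed.
Let p_le_g : (p <= g)%N. Proof. by case: om_p => [] [_ ->]; lia. Qed.

Let coreT := core_transfer char0 g_ge2 g_le_d delta_ge2 om_case.

Section FirstVariable.

Variable o : 'I_d.
Hypothesis o0 : o = 0%N :> nat.

Let wo : wgt o = om. Proof. by rewrite (wgt_p om_p) ?o0. Qed.

Lemma transferE (j l : 'I_d) b (m : 'X_{1..d}) i : l != j ->
  transfer j l b m i = (if i == j then m i - b else if i == l then m i + b else m i)%N.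
Proof.
move=> lj; rewrite /transfer mnmDE mnmBE !mulmnE !mnm1E ![_ == i]eq_sym.
by have [->|ij] := eqVneq i j; [rewrite eq_sym (negbTE lj); lia | case: eqP => _; lia].
Qed.

Lemma mdeg_transfer (j l : 'I_d) b (m : 'X_{1..d}) : (b <= m j)%N ->
  mdeg (transfer j l b m) = mdeg m.
Proof.
move=> bm; have le_m : (U_(j) *+ b <= m)%MM.
  by apply/mnm_lepP => i; rewrite mulmnE mnm1E; case: eqP => [<-|//]; rewrite mul1n.
by rewrite /transfer mdegD -[in RHS](submK le_m) mdegD !mdegMn !mdeg1.
Qed.

(** x_1 has the largest weight, so every other variable can be transferred to it. *)
Lemma core_first_power m : C 'X_[m] -> C 'X_[U_(o) *+ mdeg m].
Proof.
have [n] := ubnP (mdeg m - m o)%N; elim: n m => // n IH m lt_n Cm.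
have [/existsP[j /andP[jo mj]]|/existsPn none] := boolP [exists j, (j != o) && (0 < m j)%N].
  have oj : o != j by rewrite eq_sym.
  have wj : (wgt j <= wgt o)%N by rewrite wo wgt_le.
  have := IH (transfer j o (m j) m); rewrite mdeg_transfer // transferE // (negbTE oj) eqxx.
  have mo : (m o + m j <= mdeg m)%N.
    by rewrite mdegE (bigD1 o) //= (bigD1 j) //=; lia.
  by apply; [lia | apply: coreT].
have -> : (U_(o) *+ mdeg m)%MM = m; last by [].
have zero j : j != o -> m j = 0%N.
  by move=> jo; have := none j; rewrite jo /= -eqn0Ngt => /eqP.
apply/mnmP => i; rewrite mulmnE mnm1E eq_sym; case: eqP => [->|/eqP /zero -> //].
by rewrite mul1n mdegE (bigD1 o) //= big1 ?addn0.
Qed.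

Definition spread (e n : nat) : 'X_{1..d} :=
  [multinom if i == o then (e - n * delta.-1)%N else if (i <= n)%N then delta.-1 else 0%N | i < d].

(** x_2, ..., x_p have the same weight as x_1, so transfers away from x_1 are allowed too. *)
Lemma core_spread e n : (n < p)%N -> (n * delta.-1 <= e)%N ->
  C 'X_[U_(o) *+ e] -> C 'X_[spread e n].
Proof.
move=> np ne Ce; elim: n np ne => [_ _|n IH np ne].
  rewrite (_ : spread e 0 = U_(o) *+ e)%MM //; apply/mnmP => i.
  rewrite mulmnE mnm1E mnmE leqn0 -o0 val_eqE [o == i]eq_sym.
  by case: eqP => _; rewrite o0 ?mul0n ?subn0 ?mul1n.
have ld : (n.+1 < d)%N by lia.
pose l : 'I_d := Ordinal ld.
have lo : l != o by rewrite -val_eqE /= o0.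
have -> : spread e n.+1 = transfer o l delta.-1 (spread e n).
  apply/mnmP => i; rewrite transferE // !mnmE; have [_|io] := eqVneq i o; first by rewrite mulSn; lia.
  rewrite -[i == l]val_eqE /= [(i <= n.+1)%N]leq_eqVlt ltnS.
  by case: (eqVneq (i : nat) n.+1) => [->|_] //=; rewrite ltnn.
apply: coreT => //; first by rewrite wo (wgt_p om_p).
  by rewrite mnmE eqxx; rewrite mulSn in ne; lia.
by apply: IH; [lia | rewrite mulSn in ne; lia].
Qed.

Definition shift (i : 'I_d) : R := if (0 < i < p)%N then 'X_i - 'X_o else 'X_i.

Lemma core_shift f : C f -> C (subst shift f).
Proof.
pose s' (i : 'I_d) : R := if (0 < i < p)%N then 'X_i + 'X_o else 'X_i.
have so : shift o = 'X_o by rewrite /shift o0.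
have so' : s' o = 'X_o by rewrite /s' o0.
have wx (i : 'I_d) : (0 < i < p)%N -> @MI d k (fun m => mdeg m = 1%N /\ (wgt i <= wt m)%N) 'X_o.
  by move=> _; apply: MI_X; rewrite mdeg1 wt1 wo wgt_le.
apply: (core_subst g_ge2 g_le_d delta_ge2 om_case (s' := s')) => i.
- by rewrite /shift; case: ifP => ip; [apply: MI_B; [|exact: wx ip]|]; apply: wt_subst_X.
- by rewrite /s'; case: ifP => ip; [apply: MI_D; [|exact: wx ip]|]; apply: wt_subst_X.
- rewrite /s'; case: ifP => ip; last by rewrite substU /shift ip.
  by rewrite raddfD /= !substU so /shift ip subrK.
- rewrite /shift; case: ifP => ip; last by rewrite substU /s' ip.
  by rewrite raddfB /= !substU so' /s' ip addrK.
Qed.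

End FirstVariable.

Lemma core_degree m : C 'X_[m] -> (d * (delta - 2) + g < mdeg m)%N.
Proof.
move=> Cm; rewrite ltnNge; apply/negP => le_m; set e := (_ + _)%N in le_m.
apply: (socle_notin char0 (g_ge2 := g_ge2) (g_le_d := g_le_d) (delta_ge2 := delta_ge2) (om_p := om_p)).
have Jred := red_reduction g_ge2 g_le_d delta_ge2 om_case (ff_red k g_ge2 g_le_d delta_ge2 om_p).
suff : C (socle k g_ge2 g_le_d delta_ge2 om_p) by apply.
rewrite /socle; set o := Ordinal _; have o0 : o = 0%N :> nat by [].
(* Giving delta-1 to each of x_2, ..., x_p leaves x_1 with exactly the exponent it has in
   [socle]. *)
have eE : e = (socle_exp d g delta p).+1 + p.-1 * delta.-1.
  rewrite (socle_expE g_ge2 g_le_d delta_ge2 om_p) /e.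
  rewrite -[delta.-1](_ : (delta - 2).+1 = _); last by lia.
  have g_p : (g - p + p = g)%N by rewrite subnK.
  move: (delta - 2)%N => c; have : (d - g + g = d)%N by rewrite subnK.
  by move: g_p p_gt0; clear; nia.
have Ce : C 'X_[U_(o) *+ e].
  by rewrite -(subnK le_m) mulmnDr; apply: core_X_mul; apply: core_first_power.
have Cs : C 'X_[spread o e p.-1] by apply: core_spread => //; [lia | rewrite eE leq_addl].
have := core_shift o0 Cs; congr C.
rewrite substX /mmap1 (bigID (fun i : 'I_d => 0 < i < p)%N) /= mulrC mulrA -exprS.
congr (_ * _).
  rewrite (bigD1 o) //= big1 ?mulr1 => [|i /andP[ip io]]; last first.
    rewrite /spread mnmE (negbTE io); case: leqP => // ip'.
    by move: ip io; rewrite -val_eqE /=; lia.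
  by rewrite /shift mnmE eqxx /= eE addnK.
apply: eq_bigr => i ip; rewrite /shift ip mnmE (_ : (i == o) = false); last first.
  by rewrite -val_eqE /=; lia.
by rewrite (_ : (i <= p.-1)%N) //; lia.
Qed.

Lemma core_contained f : C f ->
  MI (fun m => (d * (delta - 2) + g < mdeg m)%N && (om <= wt m)%N) f.
Proof.
move=> Cf m fm; have mf : m \in msupp f by rewrite mcoeff_msupp.
rewrite (core_degree (core_monomial char0 g_ge2 g_le_d delta_ge2 om_case Cf mf)) /=.
by have /andP[_] := core_sub Cf fm; rewrite mul1n.
Qed.

End CoreContained.

(** * Assembly of the two inclusions *)

Lemma core_eq (A : comNzRingType) (L L' : A -> Prop) : ideal_eq L L' -> ideal_eq (core L) (core L').
Proof.
suff H (I I' : A -> Prop) : ideal_eq I I' -> ideal_le (core I) (core I').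
  by move=> LL' f; split; apply: H => // h; rewrite LL'.
move=> II' f If J [Ji JI [m0 Jm]]; apply: If; split=> //; first by move=> h /JI /II'.
have E m := ideal_exp_eq m II'.
exists m0 => m le_m; apply: ideal_eq_trans (E m.+1) _; apply: ideal_eq_trans (Jm m le_m) _.
by apply: ideal_mul_eq => // h; rewrite E.
Qed.

Lemma core_lex (k : fieldType) d g delta om : [pchar k] =i pred0 ->
  (2 <= g)%N -> (g <= d)%N -> (2 <= delta)%N -> om = 1%N \/ om = delta ->
  ideal_eq (core (@MI d k (@lex_mnm d g delta om 1)))
    (ideal_mul (MI (@lex_mnm d g delta om 1))
      (ideal_exp (max_ideal k d) (d * (delta - 2) + g - delta + 1)%N)).
Proof.
move=> char0 g_ge2 g_le_d delta_ge2 om_case f.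
(* The natural-number subtraction in the exponent is therefore not truncated. *)
have le : (delta <= d * (delta - 2) + g)%N by nia.
have -> : (d * (delta - 2) + g - delta + 1 = (d * (delta - 2) + g).+1 - delta)%N by lia.
have := mul_PP_max (k := k) g_ge2 g_le_d delta_ge2 om_case ((d * (delta - 2) + g).+1 - delta) f.
rewrite subnK; last by lia.
move=> ->; split=> [|fP J Jred].
  have [p om_p] : exists p, om = 1%N /\ p = g \/ om = delta /\ p = g.-1.
    by case: om_case => ->; [exists g | exists g.-1]; auto.
  exact: (core_contained char0 g_ge2 g_le_d delta_ge2 om_p).
exact: (reduction_contains char0 g_ge2 g_le_d delta_ge2 om_case _ Jred).
Qed.

Theorem theorem6p11 (k : fieldType) (char0 : [pchar k] =i pred0)
    (d g delta : nat) (g_ge2 : (2 <= g)%N) (g_le_d : (g <= d)%N)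
    (delta_ge2 : (2 <= delta)%N) (L : {mpoly k[d]} -> Prop)
    (L_def : ideal_eq L (lex_ideal1 k d g delta) \/
             ideal_eq L (lex_ideal2 k d g delta)) :
  ideal_eq (core L)
    (ideal_mul L
       (ideal_exp (max_ideal k d) (d * (delta - 2) + g - delta + 1)%N)).
Proof.
have [om [om_case LE]] : exists om, (om = 1%N \/ om = delta) /\ ideal_eq L (MI (@lex_mnm d g delta om 1)).
  case: L_def => LE; [exists delta | exists 1%N]; split; auto.
    exact: ideal_eq_trans LE (lex_ideal1_MI g_ge2 g_le_d delta_ge2).
  exact: ideal_eq_trans LE (lex_ideal2_MI g_ge2 g_le_d delta_ge2).
apply: ideal_eq_trans (core_eq LE) _.
apply: ideal_eq_trans (core_lex char0 g_ge2 g_le_d delta_ge2 om_case) _.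
by apply: ideal_mul_eq => // h; rewrite LE.
Qed.
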